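(* Let $\hbar>0$, $n\in\mathbb{N}$, and let $f\in L^2(\mathbb{R}^n)$ with Wigner function $Wf$ on $\mathbb{R}^{2n}$. Suppose the negative part $\mathcal{N}_-(Wf)=\{z\in\mathbb{R}^{2n}:Wf(z)<0\}$ is nonempty and $\mathcal{N}_-(Wf)\subset B_{R_0}(z_0)$ for some $R_0>0$ and $z_0\in\mathbb{R}^{2n}$, where $B_{R_0}(z_0)$ is the ball of radius $R_0$ centered at $z_0$. Then $$R_0\geq\frac12\sqrt{\frac{\hbar}{2}\sqrt[n]{\frac{n!}{2}}}.$$
   Context: For $f\in L^2(\mathbb{R}^n)$, the Wigner function is $Wf(x,p)=\frac{1}{(2\pi\hbar)^n}\int_{\mathbb{R}^n} f(x+\tau/2)\overline{f(x-\tau/2)}e^{-\frac{i}{\hbar}p\cdot\tau}\,d\tau$, $(x,p)\in\mathbb{R}^{2n}$. *)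

(* Defs.v *)
From HB Require Import structures.
From mathcomp Require Import all_boot all_order all_algebra.
From mathcomp Require Import all_classical all_reals all_analysis.
From mathcomp Require Import complex.
Set Implicit Arguments. Unset Strict Implicit. Unset Printing Implicit Defensive.
Import Order.TTheory GRing.Theory Num.Theory.
Local Open Scope classical_set_scope.
Local Open Scope ring_scope.

Section Wigner.
Variable R : realType.

(* Points of R^n are n-tuples of reals; n.-tuple R carries the product
   (Borel) sigma-algebra of MathComp-Analysis. *)

(* Integral over R^n w.r.t. n-dimensional Lebesgue measure of a
   nonnegative function, computed as the iterated Lebesgue integral
   (by Tonelli this is the integral for the product measure). *)
Fixpoint nnintRn (n : nat) : (n.-tuple R -> \bar R) -> \bar R :=
  match n with
  | 0 => fun F => F [tuple]
  | m.+1 => fun F =>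
      (\int[@lebesgue_measure R]_x nnintRn (fun t : m.-tuple R => F (cons_tuple x t)))%E
  end.

Definition intRn n (F : n.-tuple R -> R) : R :=
  fine (nnintRn (fun t => (Num.max (F t) 0)%:E))
  - fine (nnintRn (fun t => (Num.max (- F t) 0)%:E)).

Definition cintRn n (F : n.-tuple R -> R[i]) : R[i] :=
  ((intRn (fun t => complex.Re (F t)))%:C
   + 'i * (intRn (fun t => complex.Im (F t)))%:C)%C.

Definition L2Rn n (f : n.-tuple R -> R[i]) : Prop :=
  measurable_fun setT (fun t => complex.Re (f t)) /\
  measurable_fun setT (fun t => complex.Im (f t)) /\
  (nnintRn (fun t => (complex.Re (f t) ^+ 2 + complex.Im (f t) ^+ 2)%:E) < +oo)%E.

Definition expi (th : R) : R[i] := ((cos th)%:C + 'i * (sin th)%:C)%C.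

Definition tadd n (x y : n.-tuple R) : n.-tuple R := [tuple tnth x i + tnth y i | i < n].
Definition tscale n (a : R) (x : n.-tuple R) : n.-tuple R := [tuple a * tnth x i | i < n].
Definition tdot n (x y : n.-tuple R) : R := \sum_(i < n) tnth x i * tnth y i.

Definition Wigner (hbar : R) n (f : n.-tuple R -> R[i])
    (z : n.-tuple R * n.-tuple R) : R[i] :=
  let: (x, p) := z in
  ((((2 * pi * hbar) ^+ n)^-1)%:C *
   cintRn (fun tau => f (tadd x (tscale (2^-1) tau))
                      * (f (tadd x (tscale (-(2^-1)) tau)))^*
                      * expi (- (tdot p tau / hbar))))%C.

Definition dist2n n (z w : n.-tuple R * n.-tuple R) : R :=
  Num.sqrt (\sum_(i < n) (tnth z.1 i - tnth w.1 i) ^+ 2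
            + \sum_(i < n) (tnth z.2 i - tnth w.2 i) ^+ 2).

Definition euclid_ball n (z0 : n.-tuple R * n.-tuple R) (r : R) :
  set (n.-tuple R * n.-tuple R) := [set z | dist2n z z0 < r].

End Wigner.

(* Main.v *)
Require Import Defs.
From HB Require Import structures.
From mathcomp Require Import all_boot all_order all_algebra.
From mathcomp Require Import all_classical all_reals all_analysis.
From mathcomp Require Import measurable_realfun complex.
From mathcomp Require Import ring lra.
Set Implicit Arguments. Unset Strict Implicit. Unset Printing Implicit Defensive.
Import Order.TTheory GRing.Theory Num.Theory.
Import numFieldNormedType.Exports.
Local Open Scope classical_set_scope.
Local Open Scope ring_scope.

(** With [k = 4 / hbar] and [w] the Wigner function times [(pi * hbar)^n], the function
    [h_m z = w (m + z) * w (m - z)] is, for every centre [m], a fixed point of the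
    symplectic Fourier transform scaled by [C = (k / 2 pi)^n]; hence [|h_m|] is bounded by
    [C] times its L1 norm, and [w m ^ 2] is [C] times the integral of [h_m]. If the
    negativity set has measure less than [1 / (4 C)] and [w m = 0], then the L1 norm of
    [h_m] is strictly below itself unless [h_m = 0]. So zeros of [w] propagate by
    reflection: along any line starting at a point where [w < 0], the first zero forces [w]
    to vanish on the whole rest of the line. By continuity [w <= 0] everywhere, with bounded
    support; then [h_m >= 0] for all [m], and taking [m] near a supporting hyperplane of the
    support squeezes [h_m] into a thin slab, whose Fourier transform cannot have bounded
    support along the conjugate axis. The ball of the theorem is majorized by a Gaussian
    (by a square when [n = 1]), which avoids computing volumes of balls. *)

(** * Lebesgue measure on tuples *)

(** The obstacle is that [h_m] is bounded but not known to be integrable, so its Fourier transform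
    cannot be written down at once. What is available is [Kfun], the inverse transform of [h_m] in
    momentum alone: it is integrable in its second argument and symmetric in its two arguments, and
    this symmetry is the whole source of self-duality. It is exploited through a window, a Laplace
    kernel in momentum times a Cauchy kernel in position. With this mixed choice the single formula
    that the Laplace kernel has the Cauchy kernel as transform serves both variables, and no
    inversion theorem is called for. The windowed identity bounds the integral of [h_m] uniformly in
    the window; a finite negative part then gives integrability by Fatou, and the window can be
    removed.

    On the constants: a ball of radius [R0] in dimension 2n has volume (pi R0^2)^n / n!, and C = (2
    / (pi hbar))^n, so smallness of its measure would ask for (2 R0^2 / hbar)^n < n! / 4. Negating
    the claim gives (8 R0^2 / hbar)^n < n! / 2, and this exponential slack pays for the Gaussian
    majorant. *)

Section lebesgue_tuple.
Variable R : realType.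
Local Notation leb := (@lebesgue_measure R).
Local Open Scope ereal_scope.

Lemma measurable_cons_tuple n :
  measurable_fun [set: measurableTypeR R * n.-tuple R]
    (fun p => cons_tuple p.1 p.2 : n.+1.-tuple R).
Proof. exact: measurable_cons. Qed.

Section step.
Variables (n : nat) (m : {sigma_finite_measure set (n.-tuple R) -> \bar R}).

Definition leb_cons : set (n.+1.-tuple R) -> \bar R :=
  pushforward (leb \x m) (fun p => cons_tuple p.1 p.2).

HB.instance Definition _ := Measure.copy leb_cons
  (measure_function_pushforward__canonical__measure_function_Measure
     (leb \x m) (@measurable_cons_tuple n)).

(** The cover consists of boxes [F k] times [G k] pulled back by [u], the inverse of cons. Both
    covers are nondecreasing, so that the diagonal boxes already exhaust the product. *)
Let leb_cons_sigma_finite : sigma_finite setT leb_cons.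
Proof.
have /sigma_finiteP[F [TF ndF Foo]] := sigma_finiteT leb.
have /sigma_finiteP[G [TG ndG Goo]] := sigma_finiteT m.
pose u (t : n.+1.-tuple R) : measurableTypeR R * n.-tuple R :=
  (thead t, [tuple of behead t]).
have mu : measurable_fun setT u.
  apply/measurable_fun_pairP; split; last exact: measurable_behead.
  exact: measurable_tnth.
exists (fun k => u @^-1` (F k `*` G k)).
  rewrite -preimage_bigcup -[LHS](preimage_setT u); congr (_ @^-1` _).
  apply/esym; rewrite -subTset => -[x y] _.
  have [i _ Fx] : (\bigcup_i F i) x by rewrite -TF.
  have [j _ Gy] : (\bigcup_i G i) y by rewrite -TG.
  exists (maxn i j) => //; split.
  - by move: x Fx; exact/subsetPset/ndF/leq_maxl.
  - by move: y Gy; exact/subsetPset/ndG/leq_maxr.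
move=> k; have [mF Fk] := Foo k; have [mG Gk] := Goo k.
have mFG : measurable (F k `*` G k) by exact: measurableX.
split; first by rewrite -[X in measurable X]setTI; exact: mu.
rewrite /leb_cons /pushforward (_ : _ @^-1` _ = F k `*` G k).
  by rewrite product_measure1E// lte_mul_pinfty// ge0_fin_numE.
have uK x (t : n.-tuple R) : u (cons_tuple x t) = (x, t).
  by rewrite /u theadE; congr (_, _); exact: val_inj.
by apply/seteqP; split => -[x t]; rewrite /preimage/mkset uK.
Qed.

HB.instance Definition _ := Measure_isSigmaFinite.Build _ _ _ leb_cons
  leb_cons_sigma_finite.
End step.

(** Lebesgue measure built by the same recursion as [nnintRn], so that Tonelli identifies the two
    integrals. Sigma-finiteness is carried along because the next product needs it. *)
Fixpoint lebn n : {sigma_finite_measure set (n.-tuple R) -> \bar R} :=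
  match n with
  | 0 => \d_([tuple] : 0.-tuple R)
  | m.+1 => leb_cons (lebn m)
  end.

Lemma ge0_integral_lebn0 (F : 0.-tuple R -> \bar R) :
  measurable_fun setT F -> \int[lebn 0]_t F t = F [tuple].
Proof.
by move=> mF; rewrite /= integral_dirac// diracT mul1e.
Qed.

Lemma ge0_integral_lebnS n (F : n.+1.-tuple R -> \bar R) :
  measurable_fun setT F -> (forall t, 0 <= F t) ->
  \int[lebn n.+1]_t F t = \int[leb]_x \int[lebn n]_t F (cons_tuple x t).
Proof.
move=> mF F0; rewrite /= /leb_cons.
rewrite (ge0_integral_pushforward (@measurable_cons_tuple n) (leb \x lebn n)) //=.
rewrite preimage_setT fubini_tonelli1//.
by apply: measurableT_comp => //; exact: measurable_cons_tuple.
Qed.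

Lemma measurable_section_cons n (F : n.+1.-tuple R -> \bar R) x :
  measurable_fun setT F -> measurable_fun setT (fun t => F (cons_tuple x t)).
Proof.
move=> mF; apply: measurableT_comp => //.
by apply: (@measurable_cons _ _ _ _ (fun=> x) n id).
Qed.

Lemma nnintRn_lebn n (F : n.-tuple R -> \bar R) :
  measurable_fun setT F -> (forall t, 0 <= F t) ->
  nnintRn F = \int[lebn n]_t F t.
Proof.
elim: n F => [|n IHn] F mF F0; first by rewrite ge0_integral_lebn0.
rewrite ge0_integral_lebnS//=; apply: eq_integral => x _.
by rewrite IHn//; exact: measurable_section_cons.
Qed.

End lebesgue_tuple.

(** * Homotheties and translations *)

Section affine_change.
Variable R : realType.
Local Notation leb := (@lebesgue_measure R).
Local Open Scope ereal_scope.

Lemma measurable_affine (a c : R) :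
  measurable_fun setT (fun x : measurableTypeR R => (a + c * x)%R : measurableTypeR R).
Proof. by apply: measurable_funD => //; exact: measurable_funM. Qed.

(** The pushforward scaled by [c] agrees with Lebesgue measure on half-open intervals, which
    determine it. *)
Let leb_affine_pos (a c : R) (A : set (measurableTypeR R)) : (0 < c)%R ->
  measurable A -> leb ((fun x : R => (a + c * x)%R) @^-1` A) = (c^-1)%:E * leb A.
Proof.
move=> c0 mA.
suff nuE : leb A = c%:E * leb ((fun x : R => (a + c * x)%R) @^-1` A).
  by rewrite nuE muleA -EFinM mulVf ?gt_eqF// mul1e.
pose nu := measure_function_pushforward__canonical__measure_function_Measure
     leb (measurable_affine a c).
apply: (@lebesgue_measure_unique _ (mscale (NngNum (ltW c0)) nu)) => //= _ [[u v]] _ <-.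
rewrite /mscale/= /pushforward.
rewrite (_ : _ @^-1` _ = `](u - a) / c, (v - a) / c]%classic)%R; last first.
  apply/seteqP; split => x /=; rewrite !in_itv/= ltr_pdivrMr// ler_pdivlMr// (mulrC x);
    rewrite ltrBlDl lerBrDl => //.
rewrite !lebesgue_measure_itv/= !lte_fin ltr_pM2r ?invr_gt0// ltrD2r.
case: ifPn => _; last by rewrite mule0.
rewrite -!EFinB -EFinM; congr (_%:E).
by field; rewrite gt_eqF.
Qed.

Lemma ge0_integral_leb_affine (a c : R) (F : R -> \bar R) : c != 0%R ->
  measurable_fun [set: measurableTypeR R] F -> (forall x, 0 <= F x) ->
  \int[leb]_x F (a + c * x)%R = (`|c|^-1)%:E * \int[leb]_x F x.
Proof.
(* A negative [c] is reduced to [- c] by the reflection invariance of Lebesgue measure. *)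
wlog c0 : c F / (0 < c)%R => [wl|_ mF F0].
  move=> c0 mF F0; have [/wl->//|cneg] := ltP 0%R c.
  have {}c0 : (c < 0)%R by rewrite lt_neqAle c0.
  pose G x := F (a + - c * x)%R.
  have mG : measurable_fun [set: measurableTypeR R] G.
    by apply: measurableT_comp => //; exact: measurable_affine.
  rewrite -normrN -(wl (- c)%R)// ?oppr_gt0 ?oppr_eq0 ?lt_eqF//.
  have mN : measurable_fun setT (-%R : measurableTypeR R -> measurableTypeR R).
    exact: oppr_measurable.
  transitivity (\int[pushforward leb (-%R : R -> measurableTypeR R)]_x G x).
    rewrite (ge0_integral_pushforward mN)//= ?preimage_setT.
      by apply: eq_integral => x _; rewrite /G/= mulrNN.
    by move=> x _; exact: F0.
  by apply: eq_measure_integral => //= A mA _; exact: lebesgue_measureN.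
rewrite gtr0_norm//.
transitivity (\int[pushforward leb (fun x => a + c * x : measurableTypeR R)%R]_x F x).
  by rewrite (ge0_integral_pushforward (measurable_affine a c))//= preimage_setT.
have cV0 : (0 <= c^-1)%R by rewrite invr_ge0 ltW.
rewrite -(ge0_integral_mscale leb measurableT (NngNum cV0))//.
apply: eq_measure_integral => [|mf A mA _]; first exact: measurable_affine.
exact: leb_affine_pos.
Qed.

Lemma measurable_tadd_tscale n (v : n.-tuple R) (c : R) :
  measurable_fun setT (fun t : n.-tuple R => tadd v (tscale c t)).
Proof.
apply/measurable_fun_tnthP => i; rewrite (_ : _ \o _ = fun t => tnth v i + c * tnth t i)%R.
  apply: measurable_funD => //; apply: measurable_funM => //; exact: measurable_tnth.
by apply/funext => t /=; rewrite !tnth_mktuple.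
Qed.

Lemma tadd_tscale_cons n (v : n.+1.-tuple R) (c : R) x (t : n.-tuple R) :
  tadd v (tscale c (cons_tuple x t)) =
  cons_tuple (thead v + c * x)%R (tadd [tuple of behead v] (tscale c t)).
Proof.
apply: eq_from_tnth => i; rewrite !tnth_mktuple.
case: (unliftP ord0 i) => [j|] -> /=.
  by rewrite !tnthS !tnth_mktuple (tuple_eta v) tnthS; congr (tnth _ _ + _)%R; exact/val_inj.
by rewrite !tnth0.
Qed.

(** The linear part is a scalar, so each coordinate contributes a factor [|c|^-1] and induction on
    the dimension suffices. *)
Lemma ge0_integral_lebn_affine n (v : n.-tuple R) (c : R) (F : n.-tuple R -> \bar R) :
  c != 0%R -> measurable_fun setT F -> (forall t, 0 <= F t) ->
  \int[lebn R n]_t F (tadd v (tscale c t)) = ((`|c| ^+ n)^-1)%:E * \int[lebn R n]_t F t.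
Proof.
move=> c0; elim: n v F => [|n IHn] v F mF F0.
  rewrite !ge0_integral_lebn0//; last first.
    by apply: measurableT_comp => //; exact: measurable_tadd_tscale.
  by rewrite expr0 invr1 mul1e; congr F; apply: eq_from_tnth => -[].
rewrite !ge0_integral_lebnS//; last first.
  by apply: measurableT_comp => //; exact: measurable_tadd_tscale.
under eq_integral do under eq_integral do rewrite tadd_tscale_cons.
have mFx x : measurable_fun setT (fun t => F (cons_tuple x t)).
  exact: measurable_section_cons.
under eq_integral do rewrite (IHn _ (fun t => F (cons_tuple _ t)))//.
pose G x := \int[lebn R n]_t F (cons_tuple x t).
have mG : measurable_fun [set: measurableTypeR R] G.
  apply: (@measurable_fun_fubini_tonelli_F _ _ _ _ _ (lebn R n) (fun p => F (cons_tuple p.1 p.2))) => //.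
  by apply: measurableT_comp => //; exact: measurable_cons_tuple.
have G0 x : 0 <= G x by exact: integral_ge0.
rewrite ge0_integralZl//; last 2 first.
- exact: (measurableT_comp mG (measurable_affine (thead v) c)).
- by move=> x _; exact: G0.
by rewrite (ge0_integral_leb_affine _ c0 mG)// muleA -EFinM -invfM -exprSr.
Qed.

End affine_change.

(** * Complex-valued integrals and Fubini *)

Section real_fubini.
Context d1 d2 (T1 : measurableType d1) (T2 : measurableType d2) (R : realType).
Variable m1 : {sigma_finite_measure set T1 -> \bar R}.
Variable m2 : {sigma_finite_measure set T2 -> \bar R}.
Variable F : T1 * T2 -> R.
Hypothesis iF : (m1 \x m2)%E.-integrable setT (EFin \o F).

(** On a null set of [x] the section may fail to be integrable; there the real integral takes the
    default value of [fine], hence agreement only almost everywhere. *)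
Lemma ae_fine_inner1 : ae_eq m1 setT
  (fun x => (\int[m2]_y F (x, y))%:E) (fun x => (\int[m2]_y (F (x, y))%:E)%E).
Proof.
have := ae_integrable1 iF; apply: filterS => x ix _.
rewrite /Rintegral fineK//; exact: (integrable_fin_num measurableT ix).
Qed.

Lemma ae_fine_inner2 : ae_eq m2 setT
  (fun y => (\int[m1]_x F (x, y))%:E) (fun y => (\int[m1]_x (F (x, y))%:E)%E).
Proof.
have := ae_integrable2 iF; apply: filterS => x ix _.
rewrite /Rintegral fineK//; exact: (integrable_fin_num measurableT ix).
Qed.

Lemma measurable_Rintegral_inner1 :
  measurable_fun setT (fun x => \int[m2]_y F (x, y)).
Proof. exact: measurableT_comp (measurable_fubini_F iF). Qed.

Lemma measurable_Rintegral_inner2 :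
  measurable_fun setT (fun y => \int[m1]_x F (x, y)).
Proof. exact: measurableT_comp (measurable_fubini_G iF). Qed.

Lemma Rintegral12_prod : \int[m1]_x \int[m2]_y F (x, y) = \int[(m1 \x m2)%E]_z F z.
Proof.
rewrite [RHS]/Rintegral -(integral12_prod_meas1 iF); apply: (congr1 fine).
apply: ae_eq_integral => //; last exact: ae_fine_inner1.
  exact/measurable_EFinP/measurable_Rintegral_inner1.
exact: (measurable_fubini_F iF).
Qed.

Lemma Rintegral21_prod : \int[m2]_y \int[m1]_x F (x, y) = \int[(m1 \x m2)%E]_z F z.
Proof.
rewrite [RHS]/Rintegral -(integral21_prod_meas1 iF); apply: (congr1 fine).
apply: ae_eq_integral => //; last exact: ae_fine_inner2.
  exact/measurable_EFinP/measurable_Rintegral_inner2.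
exact: (measurable_fubini_G iF).
Qed.

Lemma Rintegral_swap :
  \int[m1]_x \int[m2]_y F (x, y) = \int[m2]_y \int[m1]_x F (x, y).
Proof. by rewrite Rintegral12_prod Rintegral21_prod. Qed.

End real_fubini.

(* No integrability is assumed: both parts are measurable as extended-real functions. *)
Lemma measurable_fun_Rintegral d1 d2 (T1 : measurableType d1) (T2 : measurableType d2)
    (R : realType) (m2 : {sigma_finite_measure set T2 -> \bar R}) (F : T1 * T2 -> R) :
  measurable_fun setT F -> measurable_fun setT (fun x => \int[m2]_y F (x, y)).
Proof.
move=> mF; apply: measurableT_comp => //.
rewrite (_ : (fun x => _) = (fun x => \int[m2]_y (EFin \o F)^\+ (x, y)
     - \int[m2]_y (EFin \o F)^\- (x, y)))%E; last first.
  apply/funext => x; rewrite [LHS]integralE.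
  by congr (_ - _)%E; apply: eq_integral => y _; rewrite ?funeposE ?funenegE.
have mE : measurable_fun setT (EFin \o F) by exact/measurable_EFinP.
apply: emeasurable_funB.
  apply: (@measurable_fun_fubini_tonelli_F _ _ _ _ _ m2 ((EFin \o F)^\+)%E) => //.
  exact: measurable_funepos.
apply: (@measurable_fun_fubini_tonelli_F _ _ _ _ _ m2 ((EFin \o F)^\-)%E) => //.
exact: measurable_funeneg.
Qed.

Section complex_integral.
Context d (T : measurableType d) (R : realType).
Implicit Types (F G : T -> R[i]) (z : R[i]).
Local Notation normc := ComplexField.Normc.normc.

Definition cmeasurable F :=
  measurable_fun setT (fun x => complex.Re (F x)) /\
  measurable_fun setT (fun x => complex.Im (F x)).

Lemma ler_Re_normc z : `|complex.Re z| <= normc z.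
Proof.
by case: z => a b /=; rewrite -[leLHS]sqrtr_sqr ler_wsqrtr// lerDl sqr_ge0.
Qed.

Lemma ler_Im_normc z : `|complex.Im z| <= normc z.
Proof.
by case: z => a b /=; rewrite -[leLHS]sqrtr_sqr ler_wsqrtr// lerDr sqr_ge0.
Qed.

Lemma normc_ge0 z : 0 <= normc z. Proof. by case: z => a b; exact: sqrtr_ge0. Qed.

Lemma sqr_normc_Re_Im z : normc z ^+ 2 = complex.Re z ^+ 2 + complex.Im z ^+ 2.
Proof. by case: z => a b /=; rewrite sqr_sqrtr// addr_ge0// sqr_ge0. Qed.

Lemma normc_conj z : normc (z^*)%C = normc z.
Proof. by case: z => a b /=; rewrite sqrrN. Qed.

Lemma cmeasurableM F G : cmeasurable F -> cmeasurable G ->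
  cmeasurable (fun x => F x * G x).
Proof.
move=> [F1 F2] [G1 G2]; split.
  rewrite (_ : (fun x => _) = fun x => complex.Re (F x) * complex.Re (G x)
     - complex.Im (F x) * complex.Im (G x)).
    by apply: measurable_funB; exact: measurable_funM.
  by apply/funext => x; case: (F x) (G x) => [? ?] [].
rewrite (_ : (fun x => _) = fun x => complex.Re (F x) * complex.Im (G x)
     + complex.Im (F x) * complex.Re (G x)).
  by apply: measurable_funD; exact: measurable_funM.
by apply/funext => x; case: (F x) (G x) => [? ?] [].
Qed.

Lemma cmeasurable_conj F : cmeasurable F -> cmeasurable (fun x => (F x)^*%C).
Proof.
move=> [F1 F2]; split.
  by rewrite (_ : (fun x => _) = fun x => complex.Re (F x))//; apply/funext => x; case: (F x).
rewrite (_ : (fun x => _) = fun x => - complex.Im (F x)); first exact: measurableT_comp.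
by apply/funext => x; case: (F x).
Qed.

Lemma cmeasurable_real (g : T -> R) :
  measurable_fun setT g -> cmeasurable (fun x => (g x)%:C%C).
Proof. by split. Qed.

Lemma cmeasurable_expi (g : T -> R) :
  measurable_fun setT g -> cmeasurable (fun x => expi (g x)).
Proof.
move=> mg; split.
  rewrite (_ : (fun x => _) = fun x => cos (g x)).
    apply: measurableT_comp mg; apply: continuous_measurable_fun; exact: continuous_cos.
  by apply/funext => x; rewrite /expi/= !(mul0r, mulr0, subr0, addr0).
rewrite (_ : (fun x => _) = fun x => sin (g x)).
  apply: measurableT_comp mg; apply: continuous_measurable_fun; exact: continuous_sin.
by apply/funext => x; rewrite /expi/= !(mul0r, mulr0, mul1r, subr0, addr0, add0r).
Qed.

Lemma measurable_normc F : cmeasurable F -> measurable_fun setT (fun x => normc (F x)).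
Proof.
move=> [F1 F2].
rewrite (_ : (fun x => _) = fun x =>
  Num.sqrt (complex.Re (F x) ^+ 2 + complex.Im (F x) ^+ 2)).
  apply: (@measurableT_comp _ _ _ _ _ _ (@Num.sqrt R)).
    by apply: continuous_measurable_fun; exact: sqrt_continuous.
  by apply: measurable_funD; exact: measurable_funX.
by apply/funext => x; case: (F x).
Qed.

End complex_integral.

Lemma cmeasurable_comp d1 d2 (T1 : measurableType d1) (T2 : measurableType d2)
    (R : realType) (F : T2 -> R[i]) (g : T1 -> T2) :
  cmeasurable F -> measurable_fun setT g -> cmeasurable (fun x => F (g x)).
Proof. move=> [F1 F2] mg; split; first exact: (measurableT_comp F1 mg).
exact: (measurableT_comp F2 mg). Qed.

Section complex_integral_theory.
Context d (T : measurableType d) (R : realType).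
Variable mu : {measure set T -> \bar R}.
Implicit Types (F G : T -> R[i]) (z : R[i]).
Local Notation normc := ComplexField.Normc.normc.

Definition Cintegral F : R[i] :=
  Complex (\int[mu]_x complex.Re (F x)) (\int[mu]_x complex.Im (F x)).

Definition cintegrable F :=
  mu.-integrable setT (fun x => (complex.Re (F x))%:E) /\
  mu.-integrable setT (fun x => (complex.Im (F x))%:E).

Lemma le_cintegrable F (g : T -> R) : cmeasurable F ->
  (forall x, normc (F x) <= g x) -> mu.-integrable setT (fun x => (g x)%:E) ->
  cintegrable F.
Proof.
move=> [F1 F2] Fg ig; split.
  apply: (le_integrable measurableT _ _ ig); first exact/measurable_EFinP.
  move=> x _; rewrite !abse_EFin lee_fin (le_trans (ler_Re_normc _))//.
  exact: le_trans (Fg x) (ler_norm _).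
apply: (le_integrable measurableT _ _ ig); first exact/measurable_EFinP.
move=> x _; rewrite !abse_EFin lee_fin (le_trans (ler_Im_normc _))//.
exact: le_trans (Fg x) (ler_norm _).
Qed.

Lemma cintegrable_measurable F : cintegrable F -> cmeasurable F.
Proof. by move=> [/measurable_int/measurable_EFinP ? /measurable_int/measurable_EFinP]. Qed.

Lemma integrable_normc F : cintegrable F ->
  mu.-integrable setT (fun x => (normc (F x))%:E).
Proof.
move=> iF; have mF := cintegrable_measurable iF; case: iF => iF1 iF2.
apply: (le_integrable measurableT _ _ (integrableD measurableT (integrable_abse iF1) (integrable_abse iF2))).
  exact/measurable_EFinP/measurable_normc.
move=> x _; rewrite /= lee_fin ger0_norm ?normc_ge0// [leRHS]ger0_norm//.
case: (F x) => a b /=; rewrite -[leRHS]ger0_norm// -[leRHS]sqrtr_sqr ler_wsqrtr//.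
rewrite sqrrD !real_normK ?num_real// -addrA lerD2l lerDr.
by rewrite mulrn_wge0// mulr_ge0.
Qed.

Lemma CintegralZl F z : cintegrable F -> Cintegral (fun x => z * F x) = z * Cintegral F.
Proof.
move=> [F1 F2]; case: z => a b; rewrite /Cintegral.
rewrite (@eq_Rintegral _ _ _ mu setT
   (fun x => a * complex.Re (F x) - b * complex.Im (F x))); last first.
  by move=> x _; case: (F x).
rewrite (@eq_Rintegral _ _ _ mu setT
   (fun x => a * complex.Im (F x) + b * complex.Re (F x)) (fun x => complex.Im _)); last first.
  by move=> x _; case: (F x).
have iZ (c : R) (g : T -> R) : mu.-integrable setT (EFin \o g) ->
    mu.-integrable setT (EFin \o (fun x => c * g x)).
  by move=> ig; have := integrableZl measurableT c ig.
by rewrite RintegralB// ?RintegralD// ?RintegralZl//; exact: iZ.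
Qed.

Lemma eq_Cintegral F G : F =1 G -> Cintegral F = Cintegral G.
Proof. by move=> /funext ->. Qed.

Lemma Cintegral_real (g : T -> R) : Cintegral (fun x => (g x)%:C%C) = (\int[mu]_x g x)%:C%C.
Proof. by rewrite /Cintegral /= /Rintegral integral0. Qed.

End complex_integral_theory.

Section complex_fubini.
Context d1 d2 (T1 : measurableType d1) (T2 : measurableType d2) (R : realType).
Variable m1 : {sigma_finite_measure set T1 -> \bar R}.
Variable m2 : {sigma_finite_measure set T2 -> \bar R}.
Variable F : T1 * T2 -> R[i].

Lemma Cintegral_swap : cintegrable (m1 \x m2)%E F ->
  Cintegral m1 (fun x => Cintegral m2 (fun y => F (x, y))) =
  Cintegral m2 (fun y => Cintegral m1 (fun x => F (x, y))).
Proof.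
move=> [F1 F2]; rewrite /Cintegral/=; congr Complex.
  exact: (Rintegral_swap (F := fun z => complex.Re (F z))).
exact: (Rintegral_swap (F := fun z => complex.Im (F z))).
Qed.

Lemma Cintegral12_prod : cintegrable (m1 \x m2)%E F ->
  Cintegral m1 (fun x => Cintegral m2 (fun y => F (x, y))) = Cintegral (m1 \x m2)%E F.
Proof.
move=> [F1 F2]; rewrite /Cintegral/=; congr Complex.
  exact: (Rintegral12_prod (F := fun z => complex.Re (F z))).
exact: (Rintegral12_prod (F := fun z => complex.Im (F z))).
Qed.

Lemma cmeasurable_Cintegral : cmeasurable F ->
  cmeasurable (fun x => Cintegral m2 (fun y => F (x, y))).
Proof.
move=> [F1 F2]; split => /=.
  exact: (measurable_fun_Rintegral m2 (F := fun z => complex.Re (F z))).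
exact: (measurable_fun_Rintegral m2 (F := fun z => complex.Im (F z))).
Qed.

End complex_fubini.

(** * Change of variables *)

Section lebn_change_of_variables.
Variables (R : realType) (n : nat).
Local Notation lebn := (lebn R n).
Local Notation tup := (n.-tuple R).

Lemma integrable_lebn_affine (v : tup) (c : R) (F : tup -> R) : c != 0 ->
  lebn.-integrable setT (EFin \o F) ->
  lebn.-integrable setT (fun t => (F (tadd v (tscale c t)))%:E).
Proof.
move=> c0 /integrableP[mF Foo]; apply/integrableP; split.
  exact: (measurableT_comp mF (measurable_tadd_tscale v c)).
have := ge0_integral_lebn_affine v c0 (F := fun t => `|(F t)%:E|%E).
move=> -> //; last exact: measurableT_comp.
by rewrite lte_mul_pinfty// lee_fin invr_ge0 exprn_ge0.
Qed.

Lemma integral_lebn_affine (v : tup) (c : R) (F : tup -> R) : c != 0 ->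
  measurable_fun setT F ->
  (\int[lebn]_t (F (tadd v (tscale c t)))%:E =
  ((`|c| ^+ n)^-1)%:E * \int[lebn]_t ((EFin \o F)^\+ t) -
  ((`|c| ^+ n)^-1)%:E * \int[lebn]_t ((EFin \o F)^\- t))%E.
Proof.
move=> c0 mF; rewrite integralE.
have mE : measurable_fun setT (EFin \o F) by exact/measurable_EFinP.
rewrite -(ge0_integral_lebn_affine v c0 (F := ((EFin \o F)^\+)%E)) //; last exact: measurable_funepos.
rewrite -(ge0_integral_lebn_affine v c0 (F := ((EFin \o F)^\-)%E)) //; last exact: measurable_funeneg.
by congr (_ - _)%E; apply: eq_integral => t _; rewrite ?funeposE ?funenegE.
Qed.

(** Positive and negative parts keep their integrals separately when [|c| = 1], so the equality
    holds even when the integrals take default values. *)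
Lemma Rintegral_lebn_isom (v : tup) (c : R) (F : tup -> R) : `|c| = 1 ->
  measurable_fun setT F ->
  \int[lebn]_t F (tadd v (tscale c t)) = \int[lebn]_t F t.
Proof.
move=> c1 mF; rewrite /Rintegral integral_lebn_affine//.
  by rewrite c1 expr1n invr1 !mul1e -integralE.
by rewrite -normr_eq0 c1 oner_eq0.
Qed.

Lemma Rintegral_lebn_affine (v : tup) (c : R) (F : tup -> R) : c != 0 ->
  lebn.-integrable setT (EFin \o F) ->
  \int[lebn]_t F (tadd v (tscale c t)) = (`|c| ^+ n)^-1 * \int[lebn]_t F t.
Proof.
move=> c0 iF; have /measurable_EFinP mF := measurable_int _ iF.
rewrite /Rintegral integral_lebn_affine// -muleBr//; last first.
  apply: fin_num_adde_defl; rewrite fin_numN.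
  by apply: integrable_neg_fin_num.
by rewrite -integralE fineM//; exact: (integrable_fin_num measurableT iF).
Qed.

Lemma Cintegral_lebn_isom (v : tup) (c : R) (F : tup -> R[i]) : `|c| = 1 ->
  cmeasurable F ->
  Cintegral lebn (fun t => F (tadd v (tscale c t))) = Cintegral lebn F.
Proof.
move=> c1 [F1 F2]; rewrite /Cintegral.
rewrite (Rintegral_lebn_isom v (F := fun t => complex.Re (F t)))//.
by rewrite (Rintegral_lebn_isom v (F := fun t => complex.Im (F t))).
Qed.

Lemma Cintegral_lebn_affine (v : tup) (c : R) (F : tup -> R[i]) : c != 0 ->
  cintegrable lebn F ->
  Cintegral lebn (fun t => F (tadd v (tscale c t))) =
  ((`|c| ^+ n)^-1)%:C%C * Cintegral lebn F.
Proof.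
move=> c0 [F1 F2]; rewrite /Cintegral.
rewrite (Rintegral_lebn_affine v (F := fun t => complex.Re (F t)))//.
rewrite (Rintegral_lebn_affine v (F := fun t => complex.Im (F t)))//.
by apply/eqP; rewrite eq_complex/= !mul0r subr0 addr0 !eqxx.
Qed.

Lemma cintegrable_lebn_affine (v : tup) (c : R) (F : tup -> R[i]) : c != 0 ->
  cintegrable lebn F -> cintegrable lebn (fun t => F (tadd v (tscale c t))).
Proof.
move=> c0 [F1 F2]; split.
  exact: (integrable_lebn_affine (F := fun t => complex.Re (F t)) v c0 F1).
exact: (integrable_lebn_affine (F := fun t => complex.Im (F t)) v c0 F2).
Qed.

End lebn_change_of_variables.

(** * Vector operations on tuples *)

Section tuple_algebra.
Variables (R : realType) (n : nat).
Implicit Types (x y : n.-tuple R).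

Definition tzero : n.-tuple R := [tuple 0 | i < n].

Lemma tnth_tadd x y i : tnth (tadd x y) i = tnth x i + tnth y i.
Proof. exact: tnth_mktuple. Qed.

Lemma tnth_tscale c x i : tnth (tscale c x) i = c * tnth x i.
Proof. exact: tnth_mktuple. Qed.

Lemma tnth_tzero i : tnth tzero i = 0. Proof. exact: tnth_mktuple. Qed.

Definition tupE := (tnth_tadd, tnth_tscale, tnth_tzero).

End tuple_algebra.

Lemma measurable_tadd d (T : measurableType d) (R : realType) n (f g : T -> n.-tuple R) :
  measurable_fun setT f -> measurable_fun setT g ->
  measurable_fun setT (fun t => tadd (f t) (g t)).
Proof.
move=> /measurable_fun_tnthP mf /measurable_fun_tnthP mg; apply/measurable_fun_tnthP => i.
rewrite (_ : _ \o _ = fun t => tnth (f t) i + tnth (g t) i).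
  by apply: measurable_funD; [exact: mf|exact: mg].
by apply/funext => t /=; rewrite tupE.
Qed.

Lemma measurable_tscale d (T : measurableType d) (R : realType) n c (f : T -> n.-tuple R) :
  measurable_fun setT f -> measurable_fun setT (fun t => tscale c (f t)).
Proof.
move=> /measurable_fun_tnthP mf; apply/measurable_fun_tnthP => i.
rewrite (_ : _ \o _ = fun t => c * tnth (f t) i).
  by apply: measurable_funM => //; exact: mf.
by apply/funext => t /=; rewrite tupE.
Qed.

Lemma measurable_tdot d (T : measurableType d) (R : realType) n (f g : T -> n.-tuple R) :
  measurable_fun setT f -> measurable_fun setT g ->
  measurable_fun setT (fun t => tdot (f t) (g t)).
Proof.
move=> /measurable_fun_tnthP mf /measurable_fun_tnthP mg.
by apply: measurable_sum => i; apply: measurable_funM; [exact: mf|exact: mg].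
Qed.

(** * Continuity of translations in L1 *)

Lemma ge0_cvge0P (R : realType) (u : nat -> \bar R) : (forall j, 0 <= u j)%E ->
  u @ \oo --> 0%E <-> (forall e : R, 0 < e -> \forall j \near \oo, (u j <= e%:E)%E).
Proof.
move=> u0; split => [/fine_cvgP[ufin /cvgrPdist_le uc] e e0|ue].
  near=> j; have uf : u j \is a fin_num by near: j.
  rewrite -(fineK uf) lee_fin; have : `|0 - fine (u j)| <= e by near: j; exact: uc.
  by rewrite sub0r normrN; apply: le_trans; exact: ler_norm.
apply/fine_cvgP; split.
  by near=> j; rewrite ge0_fin_numE//; apply: le_lt_trans (ltry 1); near: j; exact: ue.
apply/cvgrPdist_le => e e0; near=> j.
rewrite sub0r normrN ger0_norm ?fine_ge0//.
rewrite -lee_fin fineK; first by near: j; exact: ue.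
by rewrite ge0_fin_numE//; apply: le_lt_trans (ltry 1); near: j; exact: ue.
Unshelve. all: by end_near. Qed.

Section L1_distance.
Local Open Scope ereal_scope.
Context d (T : measurableType d) (R : realType) (mu : {measure set T -> \bar R}).
Implicit Types f g h : T -> R.

Lemma L1_triangle f g h : measurable_fun setT f -> measurable_fun setT g ->
  measurable_fun setT h ->
  \int[mu]_x `|(f x - h x)%:E| <=
  \int[mu]_x `|(f x - g x)%:E| + \int[mu]_x `|(g x - h x)%:E|.
Proof.
move=> mf mg mh.
have mB (p q : T -> R) : measurable_fun setT p -> measurable_fun setT q ->
    measurable_fun setT (fun x => `|(p x - q x)%:E|).
  move=> mp mq; apply: measurableT_comp => //; apply/measurable_EFinP.
  exact: measurable_funB.
rewrite -ge0_integralD//; [|exact: mB|exact: mB].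
apply: ge0_le_integral => //; [exact: mB|by apply: emeasurable_funD; exact: mB|].
move=> x _; rewrite !abse_EFin -EFinD lee_fin.
by rewrite (_ : _ - h x = (f x - g x) + (g x - h x))%R ?ler_normD// addrA subrK.
Qed.

(** Supplies the dominating function below: a translate has the same L1 norm, hence lies within
    twice that norm. *)
Lemma L1_distance_le2 f g : measurable_fun setT f -> measurable_fun setT g ->
  \int[mu]_x `|(f x)%:E| = \int[mu]_x `|(g x)%:E| ->
  \int[mu]_x `|(f x - g x)%:E| <= 2%:E * \int[mu]_x `|(g x)%:E|.
Proof.
move=> mf mg fg.
rewrite [2%:E]EFinD ge0_muleDl// !mul1e -[X in _ <= X + _]fg.
have mE (p : T -> R) : measurable_fun setT p -> measurable_fun setT (fun x => `|(p x)%:E|).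
  by move=> mp; apply: measurableT_comp => //; exact/measurable_EFinP.
rewrite -ge0_integralD//; [|exact: mE|exact: mE].
apply: ge0_le_integral => //.
- by apply: mE; exact: measurable_funB.
- by apply: emeasurable_funD; exact: mE.
- by move=> x _; rewrite !abse_EFin -EFinD lee_fin ler_normB.
Qed.

End L1_distance.

Section iterated_dominated_convergence.
Local Open Scope ereal_scope.
Context d1 d2 (T1 : measurableType d1) (T2 : measurableType d2) (R : realType).
Variable m1 : {sigma_finite_measure set T1 -> \bar R}.
Variable m2 : {sigma_finite_measure set T2 -> \bar R}.

(** Dominated convergence for the outer integral. Convergence of the inner one is asked almost
    everywhere only, since sections of an integrable function are integrable only almost
    everywhere. *)
Lemma cvg0_iterated_integral (H : nat -> T1 * T2 -> \bar R) (g : T1 -> \bar R) :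
  (forall j, measurable_fun setT (H j)) -> (forall j z, 0 <= H j z) ->
  m1.-integrable setT g ->
  (forall j x, \int[m2]_y H j (x, y) <= g x) ->
  {ae m1, forall x, \int[m2]_y H j (x, y) @[j --> \oo] --> 0} ->
  \int[m1]_x \int[m2]_y H j (x, y) @[j --> \oo] --> 0.
Proof.
move=> mH H0 ig Hg H_0.
have [|||||_ _] := @dominated_convergence _ _ _ m1 setT measurableT
  (fun j x => \int[m2]_y H j (x, y)) (cst 0) g.
- by move=> j; exact: (@measurable_fun_fubini_tonelli_F _ _ _ _ _ m2 (H j)).
- exact: measurable_cst.
- by apply: filterS H_0 => x + _.
- exact: ig.
- apply: nearW => x j _; rewrite gee0_abs//; exact: integral_ge0.
by rewrite integral0.
Qed.

End iterated_dominated_convergence.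

Section L1_translation_1d.
Variable R : realType.
Local Notation leb := (@lebesgue_measure R).
Local Notation mR := (measurableTypeR R).

(** A continuous cutoff: values in [0, 1], zero outside [-B, B], and tending to 1 pointwise as [B]
    grows. *)
Let tent (B x : R) : R := Num.max (1 - `|x| / B) 0.

Let tent_ge0 B x : 0 <= tent B x. Proof. by rewrite /tent le_max lexx orbT. Qed.

Let tent_le1 B x : 0 < B -> tent B x <= 1.
Proof. by move=> B0; rewrite /tent ge_max ler01 andbT gerBl divr_ge0// ltW. Qed.

Let tent_supp B x : 0 < B -> B < `|x| -> tent B x = 0.
Proof.
move=> B0 Bx; rewrite /tent; apply/max_idPr.
by rewrite subr_le0 ler_pdivlMr// mul1r ltW.
Qed.

Let continuous_tent B : continuous (tent B).
Proof.
move=> x; apply: (@continuous_max _ _ (fun x => 1 - `|x| / B) (cst 0)); last exact: cst_continuous.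
apply: cvgB; first exact: cvg_cst.
by apply: cvgMr_tmp; exact: norm_continuous.
Qed.

Let cvg_tent x : tent n.+1%:R x @[n --> \oo] --> (1 : R).
Proof.
apply/cvgrPdist_le => e e0; near=> n.
have h : `|x| / n.+1%:R <= e.
  rewrite ler_pdivrMr// mulrC -ler_pdivrMr//.
  by apply: le_trans (_ : n%:R <= _); [near: n; exact: nbhs_infty_ger|rewrite ler_nat].
have h0 : 0 <= `|x| / n.+1%:R by rewrite divr_ge0.
rewrite ger0_norm ?subr_ge0 ?tent_le1// lerBlDr.
by rewrite -lerBlDl /tent le_max lerD2l lerN2 h.
Unshelve. all: by end_near. Qed.

(** With [M] bounding [g] and [A] bounding the shifts, the difference is dominated by 2 M on the
    interval enlarged by [A]. *)
Lemma cvg0_L1_translate_leb_cc (g : R -> R) (B : R) (a : nat -> R) :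
  continuous g -> (forall x, B < `|x| -> g x = 0) -> a @ \oo --> 0 ->
  (\int[leb]_x `|(g (a j + x)%R - g x)%:E|)%E @[j --> \oo] --> 0%E.
Proof.
move=> cg gB a0.
have [A aA] : exists A, forall j, `|a j| <= A.
  have /cvg_seq_bounded[A [_ AM]] : cvgn a by apply/cvg_ex; exists 0.
  by exists (A + 1) => j; apply: AM; rewrite ?ltrDl.
have [M gM] : exists M, forall x, `|g x| <= M.
  (* For negative [B] the support condition forces [g] to vanish everywhere. *)
  have [B0|B0] := ltP B 0.
    by exists 0 => x; rewrite gB ?normr0// (lt_le_trans B0).
  have BB : - B <= B by rewrite ge0_cp.
  have cng : {within `[- B, B], continuous (fun x => `|g x|)}.
    apply: continuous_subspaceT => x; apply: continuous_comp; first exact: cg.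
    exact: norm_continuous.
  have [c _ gc] := EVT_max BB cng.
  exists `|g c| => x; have [xB|/gB ->] := leP `|x| B; last by rewrite normr0.
  by apply: gc; rewrite in_itv/= -ler_norml.
have mg : measurable_fun [set: mR] g by exact: continuous_measurable_fun.
pose D := `[- (B + A), B + A]%classic : set mR.
have mD : measurable D by exact: measurable_itv.
have [|||||_ _] := @dominated_convergence _ _ _ leb setT measurableT
  (fun j x => `|(g (a j + x)%R - g x)%:E|)%E (cst 0%E) (fun x => (2 * M * \1_D x)%:E).
- move=> j; apply: measurableT_comp => //; apply/measurable_EFinP.
  apply: measurable_funB => //; apply: (measurableT_comp mg).
  exact: measurable_funD.
- exact: measurable_cst.
- apply: nearW => x _; apply/fine_cvgP; split; first exact: nearW.
  apply/cvgrPdist_le => e e0.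
  have : g (a j + x) @[j --> \oo] --> g x.
    have ax : a j + x @[j --> \oo] --> x.
      by have := cvgD a0 (cvg_cst x); rewrite add0r; apply.
    exact: (cvg_comp (fun j => a j + x) g ax (cg x)).
  move=> /cvgrPdist_le /(_ e e0); apply: filterS => j.
  by rewrite /= sub0r normrN normr_id distrC.
- exact: (integrableZl measurableT (2 * M) (integrable_indic_itv (- (B + A)) (B + A) true false)).
- apply: nearW => x j _; rewrite abse_id abse_EFin lee_fin indicE.
  have [xD|xD] := boolP (x \in D).
    rewrite mulr1 (le_trans (ler_normB _ _))//.
    by rewrite (_ : 2 * M = M + M) ?lerD//; ring.
  have xBA : B + A < `|x|.
    by rewrite ltNge; apply: contra xD; rewrite ler_norml inE /D/= in_itv.
  have A0 : 0 <= A by apply: le_trans (aA 0%N).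
  rewrite mulr0 !gB ?subrr ?normr0//.
  - by apply: le_lt_trans xBA; rewrite lerDl.
  - have := aA j; have := ler_normB (a j + x) (a j); rewrite addrAC subrr add0r; lra.
by rewrite integral0.
Qed.

Lemma cvg0_L1_translate_leb (f : R -> R) (a : nat -> R) :
  leb.-integrable setT (EFin \o f) -> a @ \oo --> 0 ->
  (\int[leb]_x `|(f (a j + x)%R - f x)%:E|)%E @[j --> \oo] --> 0%E.
Proof.
move=> intf a0.
have mf : measurable_fun [set: mR] f by have /measurable_EFinP := measurable_int _ intf.
have mtr (g : R -> R) c : measurable_fun [set: mR] g -> measurable_fun [set: mR] (fun x => g (c + x)).
  by move=> mg; apply: (measurableT_comp mg); exact: measurable_funD.
apply/ge0_cvge0P => [j|e e0]; first exact: integral_ge0.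
(* 5 = 2 + 1 + 2: the function and its translate are each replaced by [g0] at cost 2 [eta], and
   translating [g0] costs [eta]. *)
pose eta := e / 5; have eta0 : 0 < eta by rewrite divr_gt0.
have mtent B : measurable_fun [set: mR] (tent B) by exact: continuous_measurable_fun.
have [N fN] : exists N, (\int[leb]_x `|(f x - f x * tent N.+1%:R x)%:E| <= eta%:E)%E.
  have [|||||_ + _] := @dominated_convergence _ _ _ leb setT measurableT
    (fun N x => (f x * tent N.+1%:R x)%:E) (EFin \o f) (fun x => `|(f x)%:E|)%E.
  - by move=> N; apply/measurable_EFinP; exact: measurable_funM.
  - exact/measurable_EFinP.
  - apply: nearW => x _; apply: cvg_EFin; first exact: nearW.
    rewrite -[X in _ --> X]/(f x) -[X in _ --> X](mulr1 (f x)).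
    by apply: cvgMl_tmp; exact: cvg_tent.
  - exact: integrable_abse.
  - apply: nearW => x N _; rewrite !abse_EFin lee_fin normrM ler_piMr//.
    by rewrite ger0_norm ?tent_le1.
  move=> /ge0_cvge0P-/(_ (fun N => integral_ge0 _ (fun x _ => abse_ge0 _)) _ eta0)[N _ /(_ N (leqnn N))].
  move=> h; exists N; apply: le_trans h; rewrite le_eqVlt; apply/orP; left; apply/eqP.
  by apply: eq_integral => x _; rewrite -EFinB !abse_EFin distrC.
set B := N.+1%:R : R; have B0 : 0 < B by [].
pose E := `[- B, B]%classic : set mR.
have mE : measurable E by exact: measurable_itv.
(* Density of continuous functions is used on the bounded set [E]; outside [E] the approximant is
   uncontrolled, hence the cutoff in [g0]. *)
have [g [cg ig fg]] : exists g : R -> R, [/\ continuous g, leb.-integrable E (EFin \o g) &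
    (\int[leb]_(x in E) `|(f x - g x)%:E| <= eta%:E)%E].
  have leE : (leb E < +oo)%E.
    by rewrite /E lebesgue_measure_itv/=; case: ifP => _ //=; rewrite -EFinB ltry.
  have iE : leb.-integrable E (EFin \o f) by exact: integrableS intf.
  have [g_ [cg ig]] := approximation_continuous_integrable mE leE iE.
  move=> /ge0_cvge0P-/(_ (fun N => integral_ge0 _ (fun x _ => abse_ge0 _)) _ eta0)[k _ /(_ k (leqnn k)) h].
  by exists (g_ k).
have mg : measurable_fun [set: mR] g by exact: continuous_measurable_fun.
pose g0 x := g x * tent B x.
have mg0 : measurable_fun [set: mR] g0 by exact: measurable_funM.
have cg0 : continuous g0.
  by move=> x; apply: cvgM; [exact: cg|exact: continuous_tent].
have fg0 : (\int[leb]_x `|(f x - g0 x)%:E| <= (2 * eta)%:E)%E.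
  apply: le_trans (L1_triangle leb mf (measurable_funM mf (mtent B)) mg0) _.
  rewrite (_ : 2 * eta = eta + eta); last by ring.
  rewrite EFinD leeD// (le_trans _ fg)// [leRHS]integral_mkcond.
  apply: ge0_le_integral => //.
  - apply: measurableT_comp => //; apply/measurable_EFinP; apply: measurable_funB => //.
    exact: measurable_funM.
  - apply/(measurable_restrictT _ _).1 => //; apply: measurable_funTS.
    apply: measurableT_comp => //; apply/measurable_EFinP; exact: measurable_funB.
  move=> x _; rewrite /g0 -mulrBl patchE; case: ifPn => [_|].
    rewrite !abse_EFin lee_fin normrM ler_piMr// ger0_norm ?tent_le1//.
  move=> xE; rewrite tent_supp ?mulr0 ?abse0//.
  by rewrite ltNge; apply: contra xE; rewrite ler_norml inE /E/= in_itv.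
have fg0' j : (\int[leb]_x `|(f (a j + x)%R - g0 (a j + x)%R)%:E| <= (2 * eta)%:E)%E.
  apply: le_trans fg0; rewrite le_eqVlt; apply/orP; left; apply/eqP.
  have mfg : measurable_fun [set: mR] (fun x => `|(f x - g0 x)%:E|)%E.
    by apply: measurableT_comp => //; apply/measurable_EFinP; exact: measurable_funB.
  have := ge0_integral_leb_affine (a j) (oner_neq0 R) mfg (fun=> abse_ge0 _).
  rewrite normr1 invr1 mul1e => <-.
  by apply: eq_integral => x _; rewrite mul1r.
have g0B x : B < `|x| -> g0 x = 0 by move=> Bx; rewrite /g0 tent_supp ?mulr0.
have H : \forall j \near \oo, (\int[leb]_x `|(g0 (a j + x)%R - g0 x)%:E| <= eta%:E)%E.
  move: (cvg0_L1_translate_leb_cc cg0 g0B a0) => /ge0_cvge0P; apply => //.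
  by move=> j; exact: integral_ge0.
apply: filterS H => j Hj.
apply: le_trans (L1_triangle leb (mtr f (a j) mf) (mtr g0 (a j) mg0) mf) _.
apply: le_trans (leeD (fg0' j) (L1_triangle leb (mtr g0 (a j) mg0) mg0 mf)) _.
have fg0s : (\int[leb]_x `|(g0 x - f x)%:E| <= (2 * eta)%:E)%E.
  apply: le_trans fg0; rewrite le_eqVlt; apply/orP; left; apply/eqP.
  by apply: eq_integral => x _; rewrite !abse_EFin distrC.
apply: le_trans (leeD (lexx _) (leeD Hj fg0s)) _.
by rewrite -!EFinD lee_fin /eta; lra.
Qed.

End L1_translation_1d.

Section L1_translation.
Variable R : realType.
Local Notation leb := (@lebesgue_measure R).

Lemma tscale1 n (t : n.-tuple R) : tscale 1 t = t.
Proof. by apply: eq_from_tnth => i; rewrite tupE mul1r. Qed.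

Lemma ge0_integral_lebn_translate n (v : n.-tuple R) (F : n.-tuple R -> \bar R) :
  measurable_fun setT F -> (forall t, 0 <= F t)%E ->
  (\int[lebn R n]_t F (tadd v t) = \int[lebn R n]_t F t)%E.
Proof.
move=> mF F0; have := ge0_integral_lebn_affine v (oner_neq0 R) mF F0.
rewrite normr1 expr1n invr1 mul1e => <-.
by apply: eq_integral => t _; rewrite tscale1.
Qed.

Lemma measurable_translate n (v : n.-tuple R) (F : n.-tuple R -> R) :
  measurable_fun setT F -> measurable_fun setT (fun t => F (tadd v t)).
Proof.
by move=> mF; apply: (measurableT_comp mF); exact: measurable_tadd.
Qed.

Lemma measurable_abs_diff d (T : measurableType d) (f g : T -> R) :
  measurable_fun setT f -> measurable_fun setT g ->
  measurable_fun setT (fun x => `|(f x - g x)%:E|)%E.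
Proof.
move=> mf mg; apply: measurableT_comp => //; apply/measurable_EFinP.
exact: measurable_funB.
Qed.

(** Translation by [v j] is a shift [c j] of the first coordinate followed by a shift [e j] of the
    others. On almost every slice one of them is the one-dimensional case and the other the
    induction hypothesis; dominated convergence integrates the slices. *)
Lemma cvg0_L1_translate n (F : n.-tuple R -> R) (v : nat -> n.-tuple R) :
  (lebn R n).-integrable setT (EFin \o F) ->
  (forall i, tnth (v j) i @[j --> \oo] --> 0) ->
  (\int[lebn R n]_t `|(F (tadd (v j) t) - F t)%:E|)%E @[j --> \oo] --> 0%E.
Proof.
elim: n F v => [|n IHn] F v iF v0.
  rewrite (_ : (fun j => _) = cst 0%E); first exact: cvg_cst.
  apply/funext => j /=; apply: integral0_eq => t _.
  have -> : tadd (v j) t = t by apply: eq_from_tnth => -[].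
  by rewrite /= subrr normr0.
have mF : measurable_fun setT F by have /measurable_EFinP := measurable_int _ iF.
pose G (p : measurableTypeR R * n.-tuple R) := F (cons_tuple p.1 p.2).
have mG : measurable_fun setT G by apply: (measurableT_comp mF); exact: measurable_cons_tuple.
have iG : (leb \x lebn R n)%E.-integrable setT (EFin \o G).
  apply/integrable12ltyP; first exact/measurable_EFinP.
  move/integrableP : iF => [_]; rewrite ge0_integral_lebnS//.
  by apply: measurableT_comp => //; exact/measurable_EFinP.
have mG1 x : measurable_fun setT (fun t => G (x, t)).
  by apply: (measurableT_comp mG); exact: measurable_pair1.
have mG2 t : measurable_fun setT (fun x => G (x, t)).
  by apply: (measurableT_comp mG); exact: measurable_pair2.
pose a j := thead (v j).
pose b j : n.-tuple R := [tuple of behead (v j)].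
have vE j x t : tadd (v j) (cons_tuple x t) = cons_tuple (a j + x) (tadd (b j) t).
  by have := tadd_tscale_cons (v j) 1 x t; rewrite !tscale1 mul1r.
pose c j : n.+1.-tuple R := cons_tuple (a j) (@tzero R n).
have cE j x t : tadd (c j) (cons_tuple x t) = cons_tuple (a j + x) t.
  have := tadd_tscale_cons (c j) 1 x t; rewrite !tscale1 mul1r theadE => ->.
  congr cons_tuple; apply: eq_from_tnth => i; rewrite tupE.
  rewrite (_ : [tuple of behead (c j)] = @tzero R n); last exact/val_inj.
  by rewrite tupE add0r.
have mD u : measurable_fun setT (fun t => `|(F (tadd u t) - F t)%:E|)%E.
  by apply: measurable_abs_diff => //; exact: measurable_translate.
pose e j : n.+1.-tuple R := cons_tuple 0 (b j).
have eE j x t : tadd (e j) (cons_tuple x t) = cons_tuple x (tadd (b j) t).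
  have := tadd_tscale_cons (e j) 1 x t; rewrite !tscale1 mul1r theadE add0r => ->.
  by congr cons_tuple; congr tadd; exact/val_inj.
have veE j t : tadd (v j) t = tadd (e j) (tadd (c j) t).
  by case/tupleP: t => x t; rewrite vE (_ : [tuple of x :: t] = cons_tuple x t) ?vE ?cE ?eE//; exact/val_inj.
have ac : a @ \oo --> 0 by exact: v0.
have bc i : tnth (b j) i @[j --> \oo] --> 0.
  have := v0 (lift ord0 i); apply: cvg_trans; apply: near_eq_cvg; apply: nearW => j /=.
  by rewrite (tuple_eta (v j)) tnthS; congr tnth; exact/val_inj.
have first_0 : (\int[lebn R n.+1]_t `|(F (tadd (e j) t) - F t)%:E|)%E @[j --> \oo] --> 0%E.
  under eq_fun do rewrite ge0_integral_lebnS//.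
  under eq_fun do under eq_integral do under eq_integral do rewrite eE.
  apply: (@cvg0_iterated_integral _ _ _ _ R leb (lebn R n)
    (fun j p => `|(G (p.1, tadd (b j) p.2) - G p)%:E|)%E
    (fun x => 2%:E * \int[lebn R n]_t `|(G (x, t))%:E|)%E).
  - move=> j; apply: measurable_abs_diff => //; apply: (measurableT_comp mG).
    apply: measurable_fun_pair; first exact: measurable_fst.
    exact: (measurable_tadd (measurable_cst _) measurable_snd).
  - by move=> j z; exact: abse_ge0.
  - apply: integrableZl => //.
    exact: (integrable_fubini_F (integrable_abse iG)).
  - move=> j x; apply: L1_distance_le2 => //.
      exact: (measurable_translate _ (mG1 x)).
    rewrite (ge0_integral_lebn_translate _ (F := fun t => `|(G (x, t))%:E|%E))//.
    by apply: measurableT_comp => //; exact/measurable_EFinP.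
  - have := ae_integrable1 iG; apply: filterS => x ix.
    exact: (IHn (fun t => G (x, t)) b).
have second_0 : (\int[lebn R n.+1]_t `|(F (tadd (c j) t) - F t)%:E|)%E @[j --> \oo] --> 0%E.
  under eq_fun do rewrite ge0_integral_lebnS//.
  under eq_fun do under eq_integral do under eq_integral do rewrite cE.
  have mH j : measurable_fun setT
      (fun p : measurableTypeR R * n.-tuple R => `|(G (a j + p.1, p.2) - G p)%:E|)%E.
    apply: measurable_abs_diff => //; apply: (measurableT_comp mG).
    apply: measurable_fun_pair; last exact: measurable_snd.
    apply: measurable_funD; first exact: measurable_cst.
    exact: measurable_fst.
  (* Tonelli brings the first coordinate, on which the shift acts, to the inner integral. *)
  rewrite (_ : (fun j => _) = fun j => (\int[lebn R n]_t \int[leb]_x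
      `|(G (a j + x, t) - G (x, t))%:E|)%E); last first.
    apply/funext => j.
    exact: (@fubini_tonelli _ _ _ _ R leb (lebn R n) (fun p => `|(G (a j + p.1, p.2) - G p)%:E|%E)).
  apply: (@cvg0_iterated_integral _ _ _ _ R (lebn R n) leb
    (fun j p => `|(G (a j + p.2, p.1) - G (p.2, p.1))%:E|)%E
    (fun t => 2%:E * \int[leb]_x `|(G (x, t))%:E|)%E).
  - move=> j; exact: (measurableT_comp (mH j) (@measurable_swap _ _ _ _)).
  - by move=> j z; exact: abse_ge0.
  - apply: integrableZl => //.
    have mE : measurable_fun setT (EFin \o G) by exact/measurable_EFinP.
    apply/integrableP; split.
      apply: (@measurable_fun_fubini_tonelli_G _ _ _ _ R leb (fun p => `|(G p)%:E|%E)) => //.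
      exact: measurableT_comp.
    under eq_integral do rewrite gee0_abs ?integral_ge0//.
    exact: (integrable21ltyP _ _ mE).1.
  - move=> j t; apply: L1_distance_le2 => //.
      apply: (measurableT_comp (mG2 t)).
      exact: (measurable_funD (measurable_cst _) (@measurable_id _ (measurableTypeR R) _)).
      exact: mG2.
    have mGt : measurable_fun [set: measurableTypeR R] (fun x => `|(G (x, t))%:E|)%E.
      by apply: measurableT_comp => //; exact/measurable_EFinP.
    have := ge0_integral_leb_affine (a j) (oner_neq0 R) mGt (fun=> abse_ge0 _).
    rewrite normr1 invr1 mul1e => H; etransitivity; last exact: H.
    by apply: eq_integral => x _; rewrite /= mul1r.
  - have := ae_integrable2 iG; apply: filterS => t it.
    exact: (cvg0_L1_translate_leb (f := fun x => G (x, t)) it ac).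
have d00 : ((0 : \bar R) +? 0)%E by [].
have sum_ge0 j : (0 <= \int[lebn R n.+1]_t `|(F (tadd (e j) t) - F t)%:E| +
    \int[lebn R n.+1]_t `|(F (tadd (c j) t) - F t)%:E|)%E.
  by rewrite adde_ge0// integral_ge0.
have cD := cvgeD d00 first_0 second_0; rewrite adde0 in cD.
have sum0 := (ge0_cvge0P sum_ge0).1 (cD ltac:(typeclasses eauto)).
apply/ge0_cvge0P => [j|r r0]; first exact: integral_ge0.
apply: filterS (sum0 r r0) => j; apply: le_trans.
apply: le_trans (L1_triangle _ (measurable_translate (v j) mF) (measurable_translate (c j) mF) mF) _.
rewrite leeD2r// le_eqVlt; apply/orP; left; apply/eqP.
(* By translation invariance, the distance between the translates by [v j] and [c j] is the distance
   between [F] and its translate by [e j]. *)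
rewrite -(ge0_integral_lebn_translate (c j) (mD (e j)))//.
by apply: eq_integral => t _; rewrite veE.
Qed.

End L1_translation.

(** * Laplace and Cauchy kernels *)

Section laplace_kernel.
Variable R : realType.
Local Notation leb := (@lebesgue_measure R).
Local Notation mR := (measurableTypeR R).

(** A probability density whose Fourier transform is [cauchy]. Both kernels are nonnegative, bounded
    and integrable, which is all that is asked of windows. *)
Definition laplace (s : R) : R := expR (- `|s|) / 2.
Definition cauchy (t : R) : R := (1 + t ^+ 2)^-1.

Lemma laplace_ge0 s : 0 <= laplace s.
Proof. by rewrite /laplace divr_ge0// expR_ge0. Qed.

Lemma laplace_le s : laplace s <= 2^-1.
Proof. by rewrite /laplace ler_piMl// -expR0 ler_expR oppr_le0. Qed.

Lemma cauchy_ge0 t : 0 <= cauchy t.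
Proof. by rewrite invr_ge0 addr_ge0// sqr_ge0. Qed.

Lemma cauchy_le1 t : cauchy t <= 1.
Proof. by rewrite invf_le1 ?lerDl ?sqr_ge0// ltr_wpDr// sqr_ge0. Qed.

Lemma continuous_laplace : continuous laplace.
Proof.
move=> s; apply: cvgMr_tmp; apply: (@continuous_comp _ _ _ (fun x : R => - `|x|) expR).
  by apply: cvgN; exact: norm_continuous.
exact: continuous_expR.
Qed.

Lemma continuous_cauchy : continuous cauchy.
Proof.
move=> s; apply: cvgV; first by rewrite gt_eqF// ltr_wpDr// sqr_ge0.
by apply: cvgD; [exact: cvg_cst|exact: exprn_continuous].
Qed.

Lemma measurable_laplace : measurable_fun [set: mR] laplace.
Proof. by apply: continuous_measurable_fun; exact: continuous_laplace. Qed.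

Lemma measurable_cauchy : measurable_fun [set: mR] cauchy.
Proof. by apply: continuous_measurable_fun; exact: continuous_cauchy. Qed.

(** A primitive of exp(-s) (1 + cos(t s)). The added 1 makes the integrand nonnegative, as the
    fundamental theorem on a half-line requires; its contribution is cancelled in
    [Rintegral_laplace_cos]. *)
Let primitive (t s : R) : R :=
  expR (- s) * ((t * sin (t * s) - cos (t * s)) * cauchy t - 1).

Let is_derive_primitive (t s : R) :
  is_derive s (1 : R) (primitive t) (expR (- s) * (1 + cos (t * s))).
Proof.
have c1 : cauchy t * (1 + t ^+ 2) = 1 by rewrite mulVf// gt_eqF// ltr_wpDr// sqr_ge0.
have c2 : cauchy t = 1 - cauchy t * t ^+ 2 by rewrite -c1; ring.
rewrite /primitive; apply: is_derive_eq.
rewrite /GRing.scale/=.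
by rewrite [X in _ = _ * (_ + X)](_ : _ = cos (t * s) * (cauchy t * (1 + t ^+ 2))); [ring|rewrite c1 mulr1].
Qed.

Let continuous_cosM (t : R) : continuous (fun s : R => cos (t * s)).
Proof.
move=> s; apply: (@continuous_comp _ _ _ (fun x : R => t * x) cos); last exact: continuous_cos.
by apply: cvgMl_tmp; exact: cvg_id.
Qed.

Let cvg_primitive t : primitive t s @[s --> +oo] --> 0.
Proof.
apply/cvgr0Pnorm_le => e e0.
pose M := `|t| + 3.
have M0 : 0 < M by rewrite ltr_wpDl.
have bnd s : `|(t * sin (t * s) - cos (t * s)) * cauchy t - 1| <= M.
  have h1 : `|t * sin (t * s)| <= `|t|.
    by rewrite normrM ler_piMr// ler_norml sin_geN1 sin_le1.
  have h2 : `|cos (t * s)| <= 1 by rewrite ler_norml cos_geN1 cos_le1.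
  rewrite (le_trans (ler_normB _ _))// normr1 normrM [`|cauchy t|]ger0_norm ?cauchy_ge0//.
  have : `|t * sin (t * s) - cos (t * s)| * cauchy t <= `|t| + 1.
    rewrite (le_trans (ler_piMr _ (cauchy_le1 t)))// (le_trans (ler_normB _ _))//.
    exact: lerD.
  by rewrite /M; lra.
have := @cvgr_expR R => /cvgr0Pnorm_le /(_ (e / M) (divr_gt0 e0 M0)).
apply: filterS => s; rewrite /primitive normrM ler_pdivlMr// => es.
by rewrite (le_trans _ es)// ler_pM.
Qed.

Let half_integral t :
  (\int[leb]_(s in `[0%R, +oo[) (expR (- s) * (1 + cos (t * s)))%:E = (1 + cauchy t)%:E)%E.
Proof.
rewrite (@ge0_continuous_FTC2y _ _ (primitive t) _ 0).
- rewrite /primitive oppr0 mulr0 sin0 cos0 expR0 mulr0 sub0r mul1r -EFinB.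
  by congr EFin; ring.
- move=> s _; rewrite mulr_ge0 ?expR_ge0// -lerBlDl sub0r; exact: cos_geN1.
- apply: continuous_subspaceT => s; apply: cvgM.
    apply: (@continuous_comp _ _ _ (fun x : R => - x) expR); last exact: continuous_expR.
    exact: cvgN.
  by apply: cvgD; [exact: cvg_cst|exact: continuous_cosM].
- exact: cvg_primitive.
- by move=> s _; have [] := is_derive_primitive t s.
- apply: cvg_at_right_filter; apply: differentiable_continuous.
  by apply/derivable1_diffP; have [] := is_derive_primitive t 0.
- by move=> s _; rewrite derive1E; have [_ ->] := is_derive_primitive t s.
Qed.

Let laplace_cos_integral t :
  (\int[leb]_s (laplace s * (1 + cos (t * s)))%:E = (1 + cauchy t)%:E)%E.
Proof.
rewrite ge0_symfun_integralT.
- rewrite -set_itvcy.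
  transitivity (2%:E * \int[leb]_(s in `[0%R, +oo[) (2^-1 * (expR (- s) * (1 + cos (t * s))))%:E)%E.
    congr (_ * _)%E; apply: eq_integral => s; rewrite inE/= in_itv/= andbT => s0.
    by rewrite /laplace ger0_norm//; congr EFin; ring.
  under eq_integral do rewrite EFinM.
  rewrite ge0_integralZl//; last first.
  + apply/measurable_EFinP; apply: measurable_funTS; apply: continuous_measurable_fun => s.
    apply: cvgM.
      apply: (@continuous_comp _ _ _ (fun x : R => - x) expR); last exact: continuous_expR.
      exact: cvgN.
    by apply: cvgD; [exact: cvg_cst|exact: continuous_cosM].
  by rewrite half_integral -!EFinM mulrA divff// mul1r.
- by move=> s; rewrite mulr_ge0 ?laplace_ge0// -lerBlDl sub0r; exact: cos_geN1.
- move=> s; apply: cvgM; first exact: continuous_laplace.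
  by apply: cvgD; [exact: cvg_cst|exact: continuous_cosM].
- by move=> s; rewrite /= /laplace normrN mulrN cosN.
Qed.

Lemma integral_laplace : (\int[leb]_s (laplace s)%:E = 1)%E.
Proof.
have := laplace_cos_integral 0.
under eq_integral do rewrite mul0r cos0 (_ : 1 + 1 = 2)// mulrC EFinM.
rewrite ge0_integralZl; last 4 first.
- by [].
- by apply/measurable_EFinP; exact: measurable_laplace.
- by move=> s _; rewrite lee_fin laplace_ge0.
- by [].
rewrite /cauchy expr0n addr0 invr1 => /(congr1 (fun x => (2^-1)%:E * x)%E).
by rewrite muleA -!EFinM mulVf// mul1e.
Qed.

Lemma integrable_laplace : leb.-integrable setT (EFin \o laplace).
Proof.
apply/integrableP; split.
  by apply/measurable_EFinP; exact: measurable_laplace.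
under eq_integral do rewrite /= ger0_norm ?laplace_ge0//.
by rewrite integral_laplace ltry.
Qed.

Let integrable_laplaceM (g : R -> R) : measurable_fun [set: mR] g ->
  (forall x, `|g x| <= 1) -> leb.-integrable setT (EFin \o (fun s => laplace s * g s)).
Proof.
move=> mg g1; apply: le_integrable integrable_laplace => //.
  by apply/measurable_EFinP; apply: measurable_funM => //; exact: measurable_laplace.
by move=> s _; rewrite /= lee_fin normrM ler_piMr.
Qed.

Lemma measurable_cosM t : measurable_fun [set: mR] (fun s : R => cos (t * s)).
Proof. exact: continuous_measurable_fun. Qed.

Lemma Rintegral_laplace_cos t : \int[leb]_s (laplace s * cos (t * s)) = cauchy t.
Proof.
have ic : leb.-integrable setT (EFin \o (fun s => laplace s * cos (t * s))).
  apply: integrable_laplaceM; first exact: measurable_cosM.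
  by move=> s; rewrite ler_norml cos_geN1 cos_le1.
have : \int[leb]_s (laplace s + laplace s * cos (t * s)) = 1 + cauchy t.
  rewrite /Rintegral -[RHS]/(fine (1 + cauchy t)%:E) -laplace_cos_integral.
  by congr fine; apply: eq_integral => s _; rewrite mulrDr mulr1.
rewrite RintegralD//; last exact: integrable_laplace.
by rewrite {1}/Rintegral integral_laplace => /addrI.
Qed.

(** The integrand is odd and Lebesgue measure is invariant under reflection. *)
Lemma Rintegral_laplace_sin t : \int[leb]_s (laplace s * sin (t * s)) = 0.
Proof.
have ms : measurable_fun [set: mR] (fun s : R => sin (t * s)).
  apply: continuous_measurable_fun => s.
  apply: (@continuous_comp _ _ _ (fun x : R => t * x) sin); last exact: continuous_sin.
  by apply: cvgMl_tmp; exact: cvg_id.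
pose g s := laplace s * sin (t * s).
have ig : leb.-integrable setT (EFin \o g).
  by apply: integrable_laplaceM => // s; rewrite ler_norml sin_geN1 sin_le1.
have gN s : g (- s) = - g s by rewrite /g /laplace normrN mulrN sinN mulrN.
have mN : measurable_fun setT (-%R : mR -> mR) by exact: oppr_measurable.
have e1 : \int[leb]_s g (- s) = \int[leb]_s g s.
  rewrite /Rintegral; congr fine.
  transitivity (\int[pushforward leb (-%R : R -> mR)]_x (g x)%:E)%E; last first.
    by apply: eq_measure_integral => //= A mA _; exact: lebesgue_measureN.
  rewrite (integral_pushforward mN)//= ?preimage_setT//.
    by have := measurable_int _ ig.
  rewrite (_ : _ \o _ = fun s => (- g s)%:E); last by apply/funext => s /=; rewrite gN.
  exact: (integrableN ig).
have : \int[leb]_s g (- s) = - \int[leb]_s g s.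
  under eq_Rintegral do rewrite gN -mulN1r.
  by rewrite RintegralZl// mulN1r.
by rewrite e1 => /eqP; rewrite -subr_eq0 opprK -mulr2n mulrn_eq0/= => /eqP.
Qed.

Lemma integral_cauchy : (\int[leb]_t (cauchy t)%:E = pi%:E)%E.
Proof.
rewrite ge0_symfun_integralT.
- rewrite -set_itvcy (@ge0_continuous_FTC2y _ _ (@atan R) _ (pi / 2)).
  + by rewrite atan0 -EFinB subr0 -EFinM mulrC divfK.
  + by move=> t _; exact: cauchy_ge0.
  + by apply: continuous_subspaceT; exact: continuous_cauchy.
  + exact: cvgy_atan.
  + by move=> t _; exact: derivable_atan.
  + by apply: cvg_at_right_filter; exact: continuous_atan.
  + by move=> t _; rewrite derive1_atan.
- exact: cauchy_ge0.
- exact: continuous_cauchy.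
- by move=> t; rewrite /= /cauchy sqrrN.
Qed.

End laplace_kernel.

Section expi_theory.
Variable R : realType.
Local Notation normc := ComplexField.Normc.normc.

Lemma expiE (x : R) : expi x = Complex (cos x) (sin x).
Proof.
by rewrite /expi; apply/eqP; rewrite eq_complex/= !(mul0r, mulr0, mul1r, subr0, addr0, add0r) !eqxx.
Qed.

Lemma expiD (x y : R) : expi (x + y) = expi x * expi y.
Proof.
rewrite !expiE; apply/eqP; rewrite eq_complex/= cosD sinD eqxx/=.
by rewrite addrC [cos x * _]mulrC [sin y * _]mulrC.
Qed.

Lemma normc_expi (x : R) : normc (expi x) = 1.
Proof. by rewrite expiE /= cos2Dsin2 sqrtr1. Qed.

Lemma normc_real (x : R) : 0 <= x -> normc x%:C%C = x.
Proof. by move=> x0 /=; rewrite expr0n addr0 sqrtr_sqr ger0_norm. Qed.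

End expi_theory.

(** * Functions that are products over the coordinates *)

Section tuple_products.
Variable R : realType.
Local Notation leb := (@lebesgue_measure R).
Local Notation mR := (measurableTypeR R).

Definition tprod n (phi : R -> R) (t : n.-tuple R) : R := \prod_(i < n) phi (tnth t i).

Lemma measurable_tprod n (phi : R -> R) : measurable_fun [set: mR] phi ->
  measurable_fun setT (@tprod n phi).
Proof.
move=> mphi; apply: measurable_prod => i _.
exact: (measurableT_comp mphi (@measurable_tnth _ _ n i)).
Qed.

Lemma tprod_ge0 n (phi : R -> R) (t : n.-tuple R) : (forall x, 0 <= phi x) -> 0 <= tprod phi t.
Proof. by move=> phi0; exact: prodr_ge0. Qed.

Lemma tprod_cons n (phi : R -> R) x (t : n.-tuple R) :
  tprod phi (cons_tuple x t) = phi x * tprod phi t.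
Proof.
rewrite /tprod big_ord_recl tnth0; congr (_ * _).
by apply: eq_bigr => i _; rewrite tnthS.
Qed.

Lemma tdot_cons n (v : n.+1.-tuple R) x (t : n.-tuple R) :
  tdot v (cons_tuple x t) = thead v * x + tdot [tuple of behead v] t.
Proof.
rewrite /tdot big_ord_recl tnth0; congr (_ + _).
by apply: eq_bigr => i _; rewrite tnthS (tuple_eta v) tnthS; congr (tnth _ _ * _); exact/val_inj.
Qed.

Lemma integral_tprod n (phi : R -> R) (J : R) : measurable_fun [set: mR] phi ->
  (forall x, 0 <= phi x) -> (\int[leb]_x (phi x)%:E = J%:E)%E ->
  (\int[lebn R n]_t (tprod phi t)%:E = (J ^+ n)%:E)%E.
Proof.
move=> mphi phi0 phiJ.
have mE m : measurable_fun setT (fun t : m.-tuple R => (tprod phi t)%:E).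
  by apply/measurable_EFinP; exact: measurable_tprod.
elim: n => [|n IHn].
  by rewrite ge0_integral_lebn0// /tprod big_ord0.
rewrite ge0_integral_lebnS//; last by move=> t; rewrite lee_fin tprod_ge0.
transitivity (\int[leb]_x ((J ^+ n)%:E * (phi x)%:E))%E.
  apply: eq_integral => x _; under eq_integral do rewrite tprod_cons EFinM.
  rewrite ge0_integralZl; last 4 first.
  - by [].
  - exact: mE.
  - by move=> t _; rewrite lee_fin tprod_ge0.
  - by rewrite lee_fin.
  by rewrite IHn muleC.
rewrite ge0_integralZl; last 4 first.
- by [].
- exact/measurable_EFinP.
- by move=> x _; rewrite lee_fin.
- rewrite lee_fin exprn_ge0// -lee_fin -phiJ; apply: integral_ge0 => x _.
  by rewrite lee_fin.
by rewrite phiJ -EFinM -exprSr.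
Qed.

Lemma integrable_tprod n (phi : R -> R) (J : R) : measurable_fun [set: mR] phi ->
  (forall x, 0 <= phi x) -> (\int[leb]_x (phi x)%:E = J%:E)%E ->
  (lebn R n).-integrable setT (EFin \o @tprod n phi).
Proof.
move=> mphi phi0 phiJ; apply/integrableP; split.
  by apply/measurable_EFinP; exact: measurable_tprod.
under eq_integral do rewrite /= ger0_norm ?tprod_ge0//.
by rewrite (integral_tprod n mphi phi0 phiJ) ltry.
Qed.

Lemma integrable_cons n (F : n.+1.-tuple R -> R) :
  (lebn R n.+1).-integrable setT (EFin \o F) ->
  (leb \x lebn R n)%E.-integrable setT (fun p => (F (cons_tuple p.1 p.2))%:E).
Proof.
move=> iF; have mF : measurable_fun setT F by have /measurable_EFinP := measurable_int _ iF.
apply/integrable12ltyP.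
  by apply/measurable_EFinP; apply: (measurableT_comp mF); exact: measurable_cons_tuple.
move/integrableP : iF => [_]; rewrite ge0_integral_lebnS//.
by apply: measurableT_comp => //; exact/measurable_EFinP.
Qed.

Lemma Rintegral_lebnS n (F : n.+1.-tuple R -> R) :
  (lebn R n.+1).-integrable setT (EFin \o F) ->
  \int[lebn R n.+1]_t F t = \int[leb]_x \int[lebn R n]_t F (cons_tuple x t).
Proof.
move=> iF; have iG := integrable_cons iF.
rewrite [RHS](Rintegral12_prod (F := fun p : mR * n.-tuple R => F (cons_tuple p.1 p.2)) iG).
rewrite /Rintegral /= /leb_cons; congr fine.
rewrite (integral_pushforward (@measurable_cons_tuple R n)) ?preimage_setT//.
exact: (measurable_int _ iF).
Qed.

Lemma Cintegral_lebnS n (F : n.+1.-tuple R -> R[i]) : cintegrable (lebn R n.+1) F ->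
  Cintegral (lebn R n.+1) F =
  Cintegral leb (fun x => Cintegral (lebn R n) (fun t => F (cons_tuple x t))).
Proof.
move=> [F1 F2]; rewrite /Cintegral/=; congr Complex.
  exact: (Rintegral_lebnS (F := fun t => complex.Re (F t))).
exact: (Rintegral_lebnS (F := fun t => complex.Im (F t))).
Qed.

Lemma Cintegral_lebn0 (F : 0.-tuple R -> R[i]) : cmeasurable F ->
  Cintegral (lebn R 0) F = F [tuple].
Proof.
move=> [F1 F2]; rewrite /Cintegral /Rintegral !ge0_integral_lebn0 /=; last 2 first.
- exact/measurable_EFinP.
- exact/measurable_EFinP.
by case: (F _).
Qed.

End tuple_products.

Section laplace_fourier.
Variable R : realType.
Local Notation leb := (@lebesgue_measure R).
Local Notation mR := (measurableTypeR R).
Local Notation normc := ComplexField.Normc.normc.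

Let integrable_lap n : (lebn R n).-integrable setT (EFin \o tprod (@laplace R)).
Proof.
exact: (integrable_tprod n (measurable_laplace (R:=R)) (@laplace_ge0 R) (integral_laplace R)).
Qed.

Lemma cintegrable_laplace_expi n (t : n.-tuple R) :
  cintegrable (lebn R n) (fun s => (tprod (@laplace R) s)%:C%C * expi (- tdot t s)).
Proof.
apply: (le_cintegrable _ _ (integrable_lap n)).
  apply: cmeasurableM.
    by apply: cmeasurable_real; apply: measurable_tprod; exact: measurable_laplace.
  apply: cmeasurable_expi; apply: measurableT_comp => //.
  by apply: measurable_tdot => //; exact: measurable_cst.
move=> s; rewrite ComplexField.Normc.normcM normc_expi mulr1 normc_real//.
by apply: tprod_ge0 => x; exact: laplace_ge0.
Qed.

Lemma Cintegral_laplace_expi1 (t : R) :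
  Cintegral leb (fun s => (laplace s)%:C%C * expi (- (t * s))) = (cauchy t)%:C%C.
Proof.
rewrite /Cintegral -[RHS]/(Complex (cauchy t) 0); congr Complex.
  rewrite -[RHS]Rintegral_laplace_cos; apply: eq_Rintegral => s _.
  by rewrite expiE/= mul0r subr0 cosN.
transitivity (\int[leb]_s (-1 * (laplace s * sin (t * s)))).
  by apply: eq_Rintegral => s _; rewrite expiE/= mul0r addr0 sinN; ring.
rewrite RintegralZl// ?Rintegral_laplace_sin ?mulr0//.
apply: le_integrable (integrable_laplace R) => //.
  apply/measurable_EFinP; apply: measurable_funM; first exact: measurable_laplace.
  apply: continuous_measurable_fun => s.
  apply: (@continuous_comp _ _ _ (fun x : R => t * x) sin); last exact: continuous_sin.
  by apply: cvgMl_tmp; exact: cvg_id.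
by move=> s _; rewrite /= lee_fin normrM ler_piMr// ler_norml sin_geN1 sin_le1.
Qed.

Lemma Cintegral_laplace_expi n (t : n.-tuple R) :
  Cintegral (lebn R n) (fun s => (tprod (@laplace R) s)%:C%C * expi (- tdot t s)) =
  (tprod (@cauchy R) t)%:C%C.
Proof.
elim: n t => [|n IHn] t.
  rewrite Cintegral_lebn0; last exact: (cintegrable_measurable (cintegrable_laplace_expi t)).
  by rewrite /tprod /tdot !big_ord0 oppr0 expiE cos0 sin0 mul1r.
rewrite Cintegral_lebnS; last exact: cintegrable_laplace_expi.
transitivity (Cintegral leb (fun x => (tprod (@cauchy R) [tuple of behead t])%:C%C *
   ((laplace x)%:C%C * expi (- (thead t * x))))).
  apply: eq_Cintegral => x; rewrite mulrC -IHn -CintegralZl; last exact: cintegrable_laplace_expi.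
  apply: eq_Cintegral => s; rewrite tprod_cons tdot_cons opprD expiD rmorphM /=.
  by rewrite -!mulrA; congr (_ * _); rewrite mulrCA.
rewrite CintegralZl.
  rewrite Cintegral_laplace_expi1 -rmorphM/= mulrC.
  by rewrite [in RHS](tuple_eta t) -tprod_cons; congr ((tprod _ _)%:C)%C; exact/val_inj.
apply: (le_cintegrable _ _ (integrable_laplace R)).
  apply: cmeasurableM.
    by apply: cmeasurable_real; exact: measurable_laplace.
  apply: cmeasurable_expi; apply: continuous_measurable_fun => x.
  by apply: cvgN; apply: cvgMl_tmp; exact: cvg_id.
move=> s; rewrite ComplexField.Normc.normcM normc_expi mulr1 normc_real//.
exact: laplace_ge0.
Qed.

End laplace_fourier.

(** * Bounds for complex integrals *)

Section complex_integral_bounds.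
Context d (T : measurableType d) (R : realType) (mu : {measure set T -> \bar R}).
Local Notation normc := ComplexField.Normc.normc.

Lemma ler_normc_ReIm (z : R[i]) : normc z <= `|complex.Re z| + `|complex.Im z|.
Proof.
case: z => a b /=; rewrite -[leRHS]ger0_norm ?addr_ge0// -[leRHS]sqrtr_sqr ler_wsqrtr//.
rewrite sqrrD !real_normK ?num_real// -addrA lerD2l lerDr.
by rewrite mulrn_wge0// mulr_ge0.
Qed.

Lemma lee_abs_fine (x : \bar R) : (`|fine x|%:E <= `|x|)%E.
Proof. by case: x => [r| |] //=; rewrite ?normr0 ?lee_fin ?leey. Qed.

Lemma lee_abs_Rintegral (g : T -> R) : measurable_fun setT g ->
  (`|\int[mu]_x g x|%:E <= \int[mu]_x `|g x|%:E)%E.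
Proof.
move=> mg; apply: le_trans (lee_abs_fine _) _.
by apply: le_trans (le_abse_integral mu measurableT _) _ => //; exact/measurable_EFinP.
Qed.

(* The constant 2 is not optimal, but only finiteness of the bound matters. *)
Lemma lee_normc_Cintegral (F : T -> R[i]) : cmeasurable F ->
  ((normc (Cintegral mu F))%:E <= 2%:E * \int[mu]_x (normc (F x))%:E)%E.
Proof.
move=> mF; have [F1 F2] := mF.
have mN : measurable_fun setT (fun x => (normc (F x))%:E).
  by apply/measurable_EFinP; exact: measurable_normc.
rewrite [2%:E]EFinD ge0_muleDl// !mul1e.
apply: (@le_trans _ _ (`|\int[mu]_x complex.Re (F x)| + `|\int[mu]_x complex.Im (F x)|)%:E).
  by rewrite lee_fin; exact: ler_normc_ReIm.
rewrite EFinD leeD//.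
  apply: le_trans (lee_abs_Rintegral F1) _; apply: ge0_le_integral => //.
    by apply/measurable_EFinP; exact: measurableT_comp.
  by move=> x _; rewrite lee_fin ler_Re_normc.
apply: le_trans (lee_abs_Rintegral F2) _; apply: ge0_le_integral => //.
  by apply/measurable_EFinP; exact: measurableT_comp.
by move=> x _; rewrite lee_fin ler_Im_normc.
Qed.

Lemma ler_norm_Rintegral_dom (g h : T -> R) : measurable_fun setT g ->
  mu.-integrable setT (EFin \o h) -> (forall x, `|g x| <= h x) ->
  `|\int[mu]_x g x| <= \int[mu]_x h x.
Proof.
move=> mg ih gh.
have ig : mu.-integrable setT (EFin \o g).
  apply: le_integrable ih => //; first exact/measurable_EFinP.
  by move=> x _; rewrite /= lee_fin (le_trans (gh x))// ler_norm.
apply: le_trans (le_normr_Rintegral measurableT ig) _.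
apply: le_Rintegral => //; first exact: (integrable_abse ig).
Qed.

Lemma ae_eq_Cintegral (F G : T -> R[i]) : cmeasurable F -> cmeasurable G ->
  {ae mu, forall x, F x = G x} -> Cintegral mu F = Cintegral mu G.
Proof.
move=> [F1 F2] [G1 G2] FG; rewrite /Cintegral /Rintegral; congr Complex; congr fine;
  apply: ae_eq_integral => //; (try exact/measurable_EFinP);
  by apply: filterS FG => x -> _.
Qed.

End complex_integral_bounds.

Section complex_fubini_products.
Context d1 d2 (T1 : measurableType d1) (T2 : measurableType d2) (R : realType).
Variable m1 : {sigma_finite_measure set T1 -> \bar R}.
Variable m2 : {sigma_finite_measure set T2 -> \bar R}.
Local Notation normc := ComplexField.Normc.normc.

Lemma cintegrable_prod (F : T1 * T2 -> R[i]) : cmeasurable F ->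
  (\int[m1]_x \int[m2]_y (normc (F (x, y)))%:E < +oo)%E ->
  cintegrable (m1 \x m2)%E F.
Proof.
move=> mF Foo; apply: (le_cintegrable (g := fun z => normc (F z))) => //.
apply/integrable12ltyP; first by apply/measurable_EFinP; exact: measurable_normc.
apply: le_lt_trans Foo; rewrite le_eqVlt; apply/orP; left; apply/eqP.
apply: eq_integral => x _; apply: eq_integral => y _.
by rewrite abse_EFin ger0_norm ?normc_ge0.
Qed.

Lemma ae_cintegrable2 (F : T1 * T2 -> R[i]) : cintegrable (m1 \x m2)%E F ->
  {ae m2, forall y, cintegrable m1 (fun x => F (x, y))}.
Proof.
move=> [F1 F2]; have := ae_integrable2 F1; have := ae_integrable2 F2.
by apply: filterS2.
Qed.

(** This is the shape of the double integrals swapped in [smooth_y] and [smooth_q]: two integrable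
    factors in separate variables and a phase that couples them. *)
Lemma cintegrable_tensor (f : T1 -> R[i]) (g : T2 -> R[i]) (u : T1 * T2 -> R[i]) :
  cintegrable m1 f -> cintegrable m2 g -> cmeasurable u ->
  (forall z, normc (u z) <= 1) ->
  cintegrable (m1 \x m2)%E (fun z => f z.1 * g z.2 * u z).
Proof.
move=> cf cg mu u1.
have mf := cintegrable_measurable cf; have mg := cintegrable_measurable cg.
have mF : cmeasurable (fun z : T1 * T2 => f z.1 * g z.2 * u z).
  apply: cmeasurableM => //; apply: cmeasurableM.
    exact: (cmeasurable_comp mf measurable_fst).
  exact: (cmeasurable_comp mg measurable_snd).
apply: cintegrable_prod => //.
have If := integrable_normc cf; have Ig := integrable_normc cg.
apply: (@le_lt_trans _ _ (\int[m1]_x ((normc (f x))%:E * \int[m2]_y (normc (g y))%:E))%E).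
  apply: ge0_le_integral => //.
  - by move=> x _; apply: integral_ge0 => y _; rewrite lee_fin normc_ge0.
  - apply: (@measurable_fun_fubini_tonelli_F _ _ _ _ _ m2
      (fun z => (normc (f z.1 * g z.2 * u z))%:E)).
      by apply/measurable_EFinP; exact: measurable_normc.
    by move=> z; rewrite lee_fin normc_ge0.
  - by apply: emeasurable_funM => //; apply/measurable_EFinP; exact: measurable_normc.
  - move=> x _; rewrite -ge0_integralZl; last 4 first.
    + by [].
    + by apply/measurable_EFinP; exact: measurable_normc.
    + by move=> y _; rewrite lee_fin normc_ge0.
    + by rewrite lee_fin normc_ge0.
    apply: ge0_le_integral => //.
    + by move=> y _; rewrite lee_fin normc_ge0.
    + apply/measurable_EFinP.
      exact: (measurableT_comp (measurable_normc mF) (measurable_pair1 x)).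
    + apply/measurable_EFinP; apply: measurable_funM => //; exact: measurable_normc.
    + move=> y _; rewrite -EFinM lee_fin !ComplexField.Normc.normcM ler_piMr//.
      by rewrite mulr_ge0// normc_ge0.
have Ig0 : (0 <= \int[m2]_y (normc (g y))%:E)%E.
  by apply: integral_ge0 => y _; rewrite lee_fin normc_ge0.
rewrite ge0_integralZr; last 4 first.
- by [].
- by apply/measurable_EFinP; exact: measurable_normc.
- by move=> x _; rewrite lee_fin normc_ge0.
- exact: Ig0.
rewrite -(fineK (integrable_fin_num measurableT If)).
by rewrite -(fineK (integrable_fin_num measurableT Ig)) -EFinM ltry.
Qed.

End complex_fubini_products.

(** * Wigner functions and their reflected products *)

Section wigner_kernel.
Variables (R : realType) (n : nat) (k : R).
Local Notation X := (n.-tuple R).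
Local Notation L := (lebn R n).
Local Notation normc := ComplexField.Normc.normc.

Definition tneg (y : X) : X := tscale (-1) y.

Lemma tnth_tneg y i : tnth (tneg y) i = - tnth y i.
Proof. by rewrite tnth_tscale mulN1r. Qed.

Lemma tdotNr (q s : X) : tdot q (tneg s) = - tdot q s.
Proof. by rewrite /tdot -sumrN; apply: eq_bigr => i _; rewrite tnth_tneg mulrN. Qed.

Lemma tdotNl (q s : X) : tdot (tneg q) s = - tdot q s.
Proof. by rewrite /tdot -sumrN; apply: eq_bigr => i _; rewrite tnth_tneg mulNr. Qed.

Lemma tdotDr (q s t : X) : tdot q (tadd s t) = tdot q s + tdot q t.
Proof. by rewrite /tdot -big_split; apply: eq_bigr => i _; rewrite tnth_tadd mulrDr. Qed.

Lemma tdotC (q s : X) : tdot q s = tdot s q.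
Proof. by apply: eq_bigr => i _; rewrite mulrC. Qed.

Lemma tdotDl (q s t : X) : tdot (tadd s t) q = tdot s q + tdot t q.
Proof. by rewrite tdotC tdotDr !(tdotC q). Qed.

Lemma tdotZr c (q s : X) : tdot q (tscale c s) = c * tdot q s.
Proof. by rewrite /tdot mulr_sumr; apply: eq_bigr => i _; rewrite tnth_tscale mulrCA. Qed.

Lemma tdotZl c (q s : X) : tdot (tscale c s) q = c * tdot s q.
Proof. by rewrite tdotC tdotZr tdotC. Qed.

Definition autocorr (f : X -> R[i]) (y s : X) : R[i] :=
  f (tadd y s) * (f (tadd y (tneg s)))^*%C.

(* [wig k f y q] is the Wigner function up to the factor [(pi * hbar) ^ n], where
   [k = 4 / hbar], after the substitution [tau = 2 s]. *)
Definition wig (f : X -> R[i]) (y q : X) : R[i] :=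
  Cintegral L (fun s => autocorr f y s * expi (- (k / 2 * tdot q s))).

Definition wigr (f : X -> R[i]) (z : X * X) : R := complex.Re (wig f z.1 z.2).

Section fixed_f.
Variable f : X -> R[i].
Hypothesis mf : cmeasurable f.
Hypothesis f2 : L.-integrable setT (fun t => (normc (f t) ^+ 2)%:E).

Definition sqnorm : R := \int[L]_t (normc (f t) ^+ 2).

Lemma measurable_autocorr d (T : measurableType d) (u v : T -> X) :
  measurable_fun setT u -> measurable_fun setT v ->
  cmeasurable (fun t => autocorr f (u t) (v t)).
Proof.
move=> mu mv; apply: cmeasurableM.
  by apply: (cmeasurable_comp mf); exact: measurable_tadd.
apply: cmeasurable_conj; apply: (cmeasurable_comp mf).
by apply: measurable_tadd => //; exact: measurable_tscale.
Qed.

(** The arithmetic-geometric bound on [autocorr]; its integral in [s] equals [sqnorm f] for every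
    [y], which makes the estimates uniform. *)
Let bound y s := (normc (f (tadd y s)) ^+ 2 + normc (f (tadd y (tneg s))) ^+ 2) / 2.

Let autocorr_bound y s : normc (autocorr f y s) <= bound y s.
Proof.
rewrite /autocorr ComplexField.Normc.normcM normc_conj /bound.
set a := normc _; set b := normc _.
by rewrite ler_pdivlMr//; have := sqr_ge0 (a - b); rewrite sqrrB; lra.
Qed.

Let int_shift (c : R) y : c != 0 ->
  L.-integrable setT (fun s => (normc (f (tadd y (tscale c s))) ^+ 2)%:E).
Proof.
by move=> c0; exact: (integrable_lebn_affine (F := fun t => normc (f t) ^+ 2) y c0 f2).
Qed.

Let int_shift1 y : L.-integrable setT (fun s => (normc (f (tadd y s)) ^+ 2)%:E).
Proof.
have := int_shift y (oner_neq0 R); congr (integrable _ _ _).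
by apply/funext => s; rewrite tscale1.
Qed.

Let int_shiftN y : L.-integrable setT (fun s => (normc (f (tadd y (tneg s))) ^+ 2)%:E).
Proof. by apply: int_shift; rewrite oppr_eq0 oner_neq0. Qed.

Lemma Rintegral_shift (c : R) y : `|c| = 1 ->
  \int[L]_s (normc (f (tadd y (tscale c s))) ^+ 2) = sqnorm.
Proof.
move=> c1; rewrite (Rintegral_lebn_isom y (F := fun t => normc (f t) ^+ 2))//.
by apply: measurable_funX; exact: measurable_normc.
Qed.

Let int_bound y : L.-integrable setT (EFin \o bound y).
Proof.
have := integrableD measurableT (int_shift1 y) (int_shiftN y).
move=> /(integrableZr measurableT 2^-1); exact.
Qed.

Let Rintegral_bound y : \int[L]_s bound y s = sqnorm.
Proof.
rewrite /bound RintegralZr//; last exact: (integrableD measurableT (int_shift1 y) (int_shiftN y)).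
rewrite RintegralD; [|by []|exact: int_shift1|exact: int_shiftN].
rewrite (Rintegral_shift y (c := -1)) ?normrN1//.
have := @Rintegral_shift 1 y (normr1 _).
under eq_Rintegral do rewrite tscale1.
by move=> ->; field.
Qed.

Lemma cintegrable_autocorr y : cintegrable L (autocorr f y).
Proof.
apply: (le_cintegrable _ (autocorr_bound y) (int_bound y)).
by apply: measurable_autocorr => //; exact: measurable_cst.
Qed.

Lemma measurable_phase d (T : measurableType d) (c : R) (u v : T -> X) :
  measurable_fun setT u -> measurable_fun setT v ->
  cmeasurable (fun t => expi (- (c * tdot (u t) (v t)))).
Proof.
move=> mu mv; apply: cmeasurable_expi; apply: measurableT_comp => //.
by apply: measurable_funM => //; exact: measurable_tdot.
Qed.

Lemma cintegrable_wig y q :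
  cintegrable L (fun s => autocorr f y s * expi (- (k / 2 * tdot q s))).
Proof.
apply: (le_cintegrable (g := bound y) _ _ (int_bound y)).
  apply: cmeasurableM; first by apply: measurable_autocorr => //; exact: measurable_cst.
  by apply: measurable_phase => //; exact: measurable_cst.
by move=> s; rewrite ComplexField.Normc.normcM normc_expi mulr1.
Qed.

Lemma wigr_bound z : `|wigr f z| <= sqnorm.
Proof.
rewrite -(Rintegral_bound z.1); apply: ler_norm_Rintegral_dom.
- by have [] := cintegrable_measurable (cintegrable_wig z.1 z.2).
- exact: int_bound.
- move=> s; apply: le_trans (ler_Re_normc _) _.
  by rewrite ComplexField.Normc.normcM normc_expi mulr1.
Qed.

Lemma tnegK (y : X) : tneg (tneg y) = y.
Proof. by apply: eq_from_tnth => i; rewrite !tnth_tneg opprK. Qed.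

Lemma expiN (x : R) : expi (- x) = (expi x)^*%C.
Proof. by rewrite !expiE cosN sinN. Qed.

Lemma Im0_real (z : R[i]) : complex.Im z = 0 -> z = (complex.Re z)%:C%C.
Proof. by case: z => a b /= ->. Qed.

(* The integrand at [- s] is the conjugate of the integrand at [s]. *)
Lemma wig_real y q : wig f y q = (wigr f (y, q))%:C%C.
Proof.
rewrite /wigr/=; set w := wig f y q.
apply: Im0_real.
pose F s := autocorr f y s * expi (- (k / 2 * tdot q s)).
have FN s : F (tneg s) = (F s)^*%C.
  rewrite /F /autocorr tnegK tdotNr mulrN expiN.
  by rewrite [RHS]rmorphM [X in _ = X * _]rmorphM /= conjcK; congr (_ * _); rewrite mulrC.
have mI : measurable_fun setT (fun s => complex.Im (F s)).
  by have [] := cintegrable_measurable (cintegrable_wig y q).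
have : \int[L]_s complex.Im (F (tadd (@tzero R n) (tneg s))) = complex.Im w.
  by apply: (Rintegral_lebn_isom _ (F := fun s => complex.Im (F s))); rewrite ?normrN1.
have -> : \int[L]_s complex.Im (F (tadd (@tzero R n) (tneg s))) = - complex.Im w.
  rewrite -mulN1r -RintegralZl//; last by have [] := cintegrable_wig y q.
  apply: eq_Rintegral => s _; rewrite (_ : tadd _ _ = tneg s).
    by rewrite FN -/(F s); case: (F s) => a b /=; rewrite mulN1r.
  by apply: eq_from_tnth => i; rewrite !tupE add0r.
move=> /eqP; rewrite eq_sym -subr_eq0 opprK -mulr2n mulrn_eq0/= => /eqP //.
Qed.

Lemma measurable_wigr : measurable_fun setT (wigr f).
Proof.
pose F (z : (X * X) * X) := autocorr f z.1.1 z.2 * expi (- (k / 2 * tdot z.1.2 z.2)).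
have mF : cmeasurable F.
  apply: cmeasurableM.
    apply: measurable_autocorr; last exact: measurable_snd.
    exact: (measurableT_comp measurable_fst measurable_fst).
  apply: measurable_phase; last exact: measurable_snd.
  exact: (measurableT_comp measurable_snd measurable_fst).
by have [] := cmeasurable_Cintegral L mF.
Qed.

(** The reflected product at centre 0. The other centres are reached by changing [f] into
    [displaced]. *)
Definition hfun (z : X * X) : R := wigr f z * wigr f (tneg z.1, tneg z.2).

Lemma measurable_hfun : measurable_fun setT hfun.
Proof.
apply: measurable_funM; first exact: measurable_wigr.
apply: (measurableT_comp measurable_wigr); apply: measurable_fun_pair.
  by apply: measurable_tscale; exact: measurable_fst.
by apply: measurable_tscale; exact: measurable_snd.
Qed.

Lemma hfun_bound z : `|hfun z| <= sqnorm ^+ 2.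
Proof. by rewrite normrM expr2 ler_pM// wigr_bound. Qed.

(** The inverse Fourier transform of [hfun] in momentum, as [hfun_Fourier] shows: a product of two
    transforms becomes a convolution. The centred variables b + a and a - b display its symmetry. *)
Definition Kfun (y b : X) : R[i] :=
  ((2 ^+ n)%:C)%C * Cintegral L (fun a => autocorr f y (tadd b a) *
     autocorr f (tneg y) (tadd a (tneg b))).

(** The factors are f(y+b+a), f(a-y-b) and the conjugates of f(y-b-a) and f(b-y-a). Exchanging [y]
    and [b] fixes the first two and swaps the others; self-duality rests on this. *)
Lemma KfunC y b : Kfun y b = Kfun b y.
Proof.
rewrite /Kfun; congr (_ * _); apply: eq_Cintegral => a.
rewrite /autocorr.
have e1 : tadd y (tadd b a) = tadd b (tadd y a).
  by apply: eq_from_tnth => i; rewrite !tupE; ring.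
have e2 : tadd (tneg y) (tadd a (tneg b)) = tadd (tneg b) (tadd a (tneg y)).
  by apply: eq_from_tnth => i; rewrite !tupE; ring.
have e3 : tadd y (tneg (tadd b a)) = tadd (tneg b) (tneg (tadd a (tneg y))).
  by apply: eq_from_tnth => i; rewrite !tupE; ring.
have e4 : tadd (tneg y) (tneg (tadd a (tneg b))) = tadd b (tneg (tadd y a)).
  by apply: eq_from_tnth => i; rewrite !tupE; ring.
by rewrite e1 e2 e3 e4; ring.
Qed.

Lemma measurable_Kfun d (T : measurableType d) (u v : T -> X) :
  measurable_fun setT u -> measurable_fun setT v ->
  cmeasurable (fun t => Kfun (u t) (v t)).
Proof.
move=> mu mv; apply: cmeasurableM; first by apply: cmeasurable_real; exact: measurable_cst.
pose F (z : T * X) := autocorr f (u z.1) (tadd (v z.1) z.2) *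
     autocorr f (tneg (u z.1)) (tadd z.2 (tneg (v z.1))).
have mu1 := measurableT_comp mu (@measurable_fst _ _ T X).
have mv1 := measurableT_comp mv (@measurable_fst _ _ T X).
apply: (cmeasurable_Cintegral L (F := F)); apply: cmeasurableM; apply: measurable_autocorr => //.
- by apply: measurable_tadd => //; exact: measurable_snd.
- exact: measurable_tscale.
- by apply: measurable_tadd; [exact: measurable_snd|exact: measurable_tscale].
Qed.

(** The integrand of [Kfun] after the substitution s = a + b, so that a - b = s - 2 b. In these
    variables the double integral of the modulus factors into two L1 norms, with Jacobian 2^-n. *)
Let Psi y (z : X * X) := autocorr f y z.1 * autocorr f (tneg y) (tadd z.1 (tscale (-2) z.2)).

Let measurable_Psi y : cmeasurable (Psi y).
Proof.
apply: cmeasurableM; apply: measurable_autocorr; try exact: measurable_cst.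
  exact: measurable_fst.
by apply: measurable_tadd; [exact: measurable_fst|apply: measurable_tscale; exact: measurable_snd].
Qed.

Let normA y := fine (\int[L]_s (normc (autocorr f y s))%:E).

Let normA_le y : normA y <= sqnorm.
Proof.
rewrite -[leRHS](Rintegral_bound y); apply: le_Rintegral => //.
exact: (integrable_normc (cintegrable_autocorr y)).
Qed.

Let normA_fin y : (\int[L]_s (normc (autocorr f y s))%:E = (normA y)%:E)%E.
Proof.
by rewrite fineK//; apply: (integrable_fin_num measurableT); exact: (integrable_normc (cintegrable_autocorr y)).
Qed.

Let measurable_normA y : measurable_fun setT (fun s => (normc (autocorr f y s))%:E).
Proof.
by apply/measurable_EFinP; apply: measurable_normc; apply: measurable_autocorr.
Qed.

Let integral_normPsi y : (\int[L]_s \int[L]_b (normc (Psi y (s, b)))%:E =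
  (normA y * ((2 ^+ n)^-1 * normA (tneg y)))%:E)%E.
Proof.
have inner s : (\int[L]_b (normc (Psi y (s, b)))%:E =
    (normc (autocorr f y s))%:E * ((2 ^+ n)^-1 * normA (tneg y))%:E)%E.
  under eq_integral do rewrite /Psi /= ComplexField.Normc.normcM EFinM.
  rewrite ge0_integralZl; last 4 first.
  - by [].
  - apply/measurable_EFinP; apply: measurable_normc; apply: measurable_autocorr.
      exact: measurable_cst.
    exact: measurable_tadd_tscale.
  - by move=> b _; rewrite lee_fin normc_ge0.
  - by rewrite lee_fin normc_ge0.
  congr (_ * _)%E.
  have c0 : (-2 : R) != 0 by rewrite oppr_eq0 pnatr_eq0.
  rewrite (ge0_integral_lebn_affine s c0 (measurable_normA (tneg y))).
    by rewrite normrN (ger0_norm (ler0n _ _)) normA_fin -EFinM.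
  by move=> t; rewrite lee_fin normc_ge0.
under eq_integral do rewrite inner.
have N0 z : 0 <= normA z.
  by rewrite fine_ge0//; apply: integral_ge0 => s _; rewrite lee_fin normc_ge0.
rewrite ge0_integralZr; last 4 first.
- by [].
- exact: measurable_normA.
- by move=> s _; rewrite lee_fin normc_ge0.
- by rewrite lee_fin mulr_ge0// invr_ge0 exprn_ge0.
by rewrite normA_fin -EFinM.
Qed.

Let cintegrable_Psi y : cintegrable (L \x L)%E (Psi y).
Proof. by apply: cintegrable_prod => //; rewrite integral_normPsi ltry. Qed.

Let Kfun_Psi y b : Kfun y b = ((2 ^+ n)%:C)%C * Cintegral L (fun s => Psi y (s, b)).
Proof.
rewrite /Kfun; congr (_ * _).
rewrite -[RHS](Cintegral_lebn_isom b (c := 1)) ?normr1//; last first.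
  exact: (cmeasurable_comp (measurable_Psi y) (measurable_pair2 b)).
apply: eq_Cintegral => a; rewrite /Psi/= tscale1; congr (_ * autocorr f _ _).
by apply: eq_from_tnth => i; rewrite !tupE; ring.
Qed.

(** Uniformity in [y] matters: in [regularized_duality] a weight depending on [y] alone then makes
    the double integral finite. *)
Lemma Kfun_bound y :
  (\int[L]_b (normc (Kfun y b))%:E <= (2 * sqnorm ^+ 2)%:E)%E.
Proof.
have mPn : measurable_fun setT (fun z => (normc (Psi y z))%:E).
  by apply/measurable_EFinP; exact: measurable_normc.
have mG : measurable_fun setT (fun b => \int[L]_s (normc (Psi y (s, b)))%:E)%E.
  apply: (@measurable_fun_fubini_tonelli_G _ _ _ _ _ L (fun z => (normc (Psi y z))%:E)) => //.
  by move=> z; rewrite lee_fin normc_ge0.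
apply: (@le_trans _ _ (\int[L]_b ((2 ^+ n * 2)%:E * \int[L]_s (normc (Psi y (s, b)))%:E))%E).
  apply: ge0_le_integral => //.
  - by move=> b _; rewrite lee_fin normc_ge0.
  - by apply/measurable_EFinP; apply: measurable_normc; apply: measurable_Kfun.
  - exact: measurable_funeM.
  - move=> b _; rewrite Kfun_Psi ComplexField.Normc.normcM normc_real ?exprn_ge0// EFinM.
    rewrite EFinM -muleA; apply: lee_wpmul2l; first by rewrite lee_fin exprn_ge0.
    apply: lee_normc_Cintegral.
    exact: (cmeasurable_comp (measurable_Psi y) (measurable_pair2 b)).
rewrite ge0_integralZl; last 4 first.
- by [].
- exact: mG.
- by move=> b _; apply: integral_ge0 => s _; rewrite lee_fin normc_ge0.
- by rewrite lee_fin mulr_ge0// exprn_ge0.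
have <- := @fubini_tonelli _ _ _ _ _ L L (fun z => (normc (Psi y z))%:E).
- rewrite integral_normPsi -EFinM lee_fin.
  have c0 : (2 ^+ n : R) != 0 by rewrite expf_neq0.
  rewrite [leLHS](_ : _ = 2 * (normA y * normA (tneg y))); last first.
    by move: (2 ^+ n) c0 => c c0; field.
  have N0 z : 0 <= normA z.
    by rewrite fine_ge0//; apply: integral_ge0 => s _; rewrite lee_fin normc_ge0.
  by rewrite ler_pM2l// expr2 ler_pM.
- exact: mPn.
- by move=> z; rewrite lee_fin normc_ge0.
Qed.

Lemma cintegrable_Kfun y : cintegrable L (Kfun y).
Proof.
have mK : cmeasurable (Kfun y) by apply: measurable_Kfun => //; exact: measurable_cst.
apply: (le_cintegrable mK (g := fun b => normc (Kfun y b))) => //.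
apply/integrableP; split; first by apply/measurable_EFinP; exact: measurable_normc.
under eq_integral do rewrite abse_EFin ger0_norm ?normc_ge0//.
exact: le_lt_trans (Kfun_bound y) (ltry _).
Qed.

(** The product of the two Wigner integrals is one double integral in s and t = s - 2 b; the
    Jacobian 2^-n cancels the prefactor of [Kfun]. *)
Lemma hfun_Fourier y q :
  Cintegral L (fun b => Kfun y b * expi (- (k * tdot q b))) = (hfun (y, q))%:C%C.
Proof.
rewrite /hfun rmorphM/= -!wig_real.
pose F1 s := autocorr f y s * expi (- (k / 2 * tdot q s)).
pose F2 s := autocorr f (tneg y) s * expi (- (k / 2 * tdot (tneg q) s)).
have i1 : cintegrable L F1 by exact: cintegrable_wig.
have i2 : cintegrable L F2 by exact: cintegrable_wig.
have c0 : (-2 : R) != 0 by rewrite oppr_eq0 pnatr_eq0.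
pose G (z : X * X) := ((2 ^+ n)%:C)%C * (F1 z.1 * F2 (tadd z.1 (tscale (-2) z.2))).
have GE z : G z = ((2 ^+ n)%:C)%C * (Psi y z * expi (- (k * tdot q z.2))).
  rewrite /G /F1 /F2 /Psi; congr (_ * _).
  (* With t = s - 2 b, -(k/2) q.s + (k/2) q.t = -k q.b. *)
  rewrite (_ : - (k * tdot q z.2) = - (k / 2 * tdot q z.1) +
     - (k / 2 * tdot (tneg q) (tadd z.1 (tscale (-2) z.2)))).
    by rewrite expiD; ring.
  by rewrite tdotNl tdotDr tdotZr; field.
have mE : cmeasurable (fun z : X * X => expi (- (k * tdot q z.2))).
  by apply: measurable_phase; [exact: measurable_cst|exact: measurable_snd].
have mG : cmeasurable G.
  rewrite (funext GE); apply: cmeasurableM; first by apply: cmeasurable_real; exact: measurable_cst.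
  exact: cmeasurableM.
have iG : cintegrable (L \x L)%E G.
  apply: (le_cintegrable mG (g := fun z => 2 ^+ n * normc (Psi y z))).
    move=> z; rewrite GE !ComplexField.Normc.normcM normc_expi mulr1.
    by rewrite normc_real ?exprn_ge0.
  exact: (integrableZl measurableT (2 ^+ n) (integrable_normc (cintegrable_Psi y))).
transitivity (Cintegral L (fun s => Cintegral L (fun b => G (s, b)))); last first.
  transitivity (Cintegral L (fun s => wig f (tneg y) (tneg q) * F1 s)); last first.
    by rewrite CintegralZl// mulrC.
  apply: eq_Cintegral => s.
  transitivity (((2 ^+ n)%:C)%C * F1 s * Cintegral L (fun b => F2 (tadd s (tscale (-2) b)))).
    rewrite -CintegralZl; last exact: cintegrable_lebn_affine.
    by apply: eq_Cintegral => b; rewrite /G mulrA.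
  rewrite Cintegral_lebn_affine// normrN (ger0_norm (ler0n _ 2)).
  have cc : ((2 ^+ n)%:C)%C * ((2 ^+ n)^-1)%:C%C = 1 :> R[i].
    by rewrite -rmorphM/= divff// expf_neq0.
  rewrite -/(wig f (tneg y) (tneg q)) -[RHS]mul1r -cc.
  by move: (F1 s) (wig _ _ _) => u v; ring.
rewrite (Cintegral_swap (F := G))//.
apply: ae_eq_Cintegral.
- apply: cmeasurableM; first by apply: measurable_Kfun => //; exact: measurable_cst.
  by apply: measurable_phase => //; exact: measurable_cst.
- exact: (cmeasurable_Cintegral L (F := fun z => G (z.2, z.1)) (cmeasurable_comp mG (@measurable_swap _ _ _ _))).
(* The phase is pulled out of the inner integral where the section of [Psi] is integrable, that is
   for almost every [b]. *)
have := ae_cintegrable2 (cintegrable_Psi y); apply: filterS => b ib.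
rewrite Kfun_Psi -mulrA [_ * expi _]mulrC -CintegralZl//.
rewrite -CintegralZl; last first.
  apply: (le_cintegrable _ _ (integrable_normc ib)).
    apply: cmeasurableM; first by split; exact: measurable_cst.
    exact: (cintegrable_measurable ib).
  by move=> s; rewrite ComplexField.Normc.normcM normc_expi mul1r.
by apply: eq_Cintegral => s; rewrite GE/=; congr (_ * _); rewrite mulrC.
Qed.

End fixed_f.
End wigner_kernel.

(** * Self-duality of the reflected products *)

Section regularization.
Variables (R : realType) (n : nat) (k : R).
Hypothesis k0 : 0 < k.
Local Notation X := (n.-tuple R).
Local Notation L := (lebn R n).
Local Notation normc := ComplexField.Normc.normc.
Local Notation Lp := (@tprod R n (@laplace R)).
Local Notation Cp := (@tprod R n (@cauchy R)).
Variable f : X -> R[i].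
Hypothesis mf : cmeasurable f.
Hypothesis f2 : L.-integrable setT (fun t => (normc (f t) ^+ 2)%:E).

Lemma Lp_ge0 s : 0 <= Lp s. Proof. by apply: tprod_ge0; exact: laplace_ge0. Qed.
Lemma Cp_ge0 s : 0 <= Cp s. Proof. by apply: tprod_ge0; exact: cauchy_ge0. Qed.
Lemma Cp_le1 s : Cp s <= 1.
Proof. by apply: prodr_ile1 => i _; rewrite cauchy_ge0 cauchy_le1. Qed.

Lemma measurable_Lp : measurable_fun setT Lp.
Proof. by apply: measurable_tprod; exact: measurable_laplace. Qed.
Lemma measurable_Cp : measurable_fun setT Cp.
Proof. by apply: measurable_tprod; exact: measurable_cauchy. Qed.

Lemma integrable_Lp : L.-integrable setT (EFin \o Lp).
Proof.
exact: (integrable_tprod n (measurable_laplace (R:=R)) (@laplace_ge0 R) (integral_laplace R)).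
Qed.
Lemma integrable_Cp : L.-integrable setT (EFin \o Cp).
Proof.
exact: (integrable_tprod n (measurable_cauchy (R:=R)) (@cauchy_ge0 R) (integral_cauchy R)).
Qed.

Lemma cintegrable_real (g : X -> R) : L.-integrable setT (EFin \o g) ->
  cintegrable L (fun x => (g x)%:C%C).
Proof. by move=> ig; split => //=; exact: integrable0. Qed.

Let cintegrable_phase (F : X -> R[i]) (g : X -> R) : cintegrable L F ->
  measurable_fun setT g -> cintegrable L (fun x => F x * expi (g x)).
Proof.
move=> iF mg; apply: (le_cintegrable _ _ (integrable_normc iF)).
  apply: cmeasurableM; first exact: (cintegrable_measurable iF).
  exact: cmeasurable_expi.
by move=> x; rewrite ComplexField.Normc.normcM normc_expi mulr1.
Qed.

Let measurable_dot (q : X) : measurable_fun setT (fun t : X => tdot q t).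
Proof. by apply: measurable_tdot => //; exact: measurable_cst. Qed.

(** The Cauchy window is the transform of the Laplace kernel, so windowing [Kfun f b] before
    transforming it averages [hfun] in momentum around [om], at scale e / k. *)
Let smooth_y (e : R) (b om : X) :
  Cintegral L (fun y => Kfun f b y * (Cp (tscale e y))%:C%C * expi (- (k * tdot om y))) =
  Cintegral L (fun s => (Lp s * hfun k f (b, tadd om (tscale (e / k) s)))%:C%C).
Proof.
have iK := cintegrable_Kfun mf f2 b.
pose u (z : X * X) := expi (- (k * tdot (tadd om (tscale (e / k) z.2)) z.1)).
have uE y s : u (y, s) = expi (- tdot (tscale e y) s) * expi (- (k * tdot om y)).
  rewrite /u -expiD; congr expi => /=; rewrite tdotDl !tdotZl (tdotC s).
  by field; rewrite gt_eqF.
pose G (z : X * X) := Kfun f b z.1 * (Lp z.2)%:C%C * u z.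
have mu : cmeasurable u.
  apply: measurable_phase; last exact: measurable_fst.
  apply: measurable_tadd; first exact: measurable_cst.
  by apply: measurable_tscale; exact: measurable_snd.
have iG : cintegrable (L \x L)%E G.
  have u1 z : normc (u z) <= 1 by rewrite normc_expi.
  exact: (cintegrable_tensor iK (cintegrable_real integrable_Lp) mu u1).
transitivity (Cintegral L (fun y => Cintegral L (fun s => G (y, s)))).
  apply: eq_Cintegral => y; rewrite -Cintegral_laplace_expi mulrAC -CintegralZl.
    by apply: eq_Cintegral => s; rewrite /G/= uE; ring.
  exact: (cintegrable_laplace_expi (tscale e y)).
rewrite Cintegral_swap//; apply: eq_Cintegral => s.
rewrite rmorphM/= -(hfun_Fourier k mf f2) -CintegralZl.
  by apply: eq_Cintegral => y; rewrite /G/= /u/=; ring.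
apply: cintegrable_phase => //.
by apply: measurableT_comp => //; exact: measurable_funM.
Qed.

(** A Cauchy bump of width e / k around [v]: the transform of the momentum window, whence its
    normalization. *)
Let gker (e : R) (v b : X) : R := 2 ^+ n * (e ^+ n)^-1 * Cp (tscale (k / e) (tadd b (tneg v))).

Let fourier_laplace (e : R) (v b : X) : 0 < e ->
  Cintegral L (fun q => (2 ^+ n * Lp (tscale e q))%:C%C *
    expi (- (k * tdot q (tadd b (tneg v))))) = (gker e v b)%:C%C.
Proof.
move=> e0; set t := tscale (k / e) (tadd b (tneg v)).
pose F s := ((2 ^+ n)%:C)%C * ((Lp s)%:C%C * expi (- tdot t s)).
have iF : cintegrable L F.
  have iL := cintegrable_laplace_expi t.
  apply: (le_cintegrable _ _ (integrableZl measurableT (2 ^+ n) (integrable_normc iL))).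
    apply: cmeasurableM; first by apply: cmeasurable_real; exact: measurable_cst.
    exact: (cintegrable_measurable iL).
  by move=> s; rewrite ComplexField.Normc.normcM normc_real ?exprn_ge0.
transitivity (Cintegral L (fun q => F (tadd (@tzero R n) (tscale e q)))).
  apply: eq_Cintegral => q.
  have -> : tadd (@tzero R n) (tscale e q) = tscale e q.
    by apply: eq_from_tnth => i; rewrite !tupE add0r.
  rewrite /F mulrA -rmorphM/=; congr (_ * expi _).
  by rewrite /t tdotZl tdotZr (tdotC _ q); field; rewrite gt_eqF.
rewrite Cintegral_lebn_affine ?gt_eqF// CintegralZl; last exact: cintegrable_laplace_expi.
rewrite Cintegral_laplace_expi gtr0_norm// -!rmorphM/= /gker -/t; congr (_%:C)%C.
by rewrite mulrCA mulrA.
Qed.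

Lemma integrable_Lpe e : 0 < e -> L.-integrable setT (fun y => (Lp (tscale e y))%:E).
Proof.
move=> e0; have e0' : e != 0 by rewrite gt_eqF.
have := integrable_lebn_affine (@tzero R n) e0' integrable_Lp.
congr (integrable _ _ _); apply/funext => q /=; congr (Lp _)%:E.
by apply: eq_from_tnth => i; rewrite !tupE add0r.
Qed.

(** Inverting the transform of [Kfun f y] under a Laplace window gives back [Kfun f y] smeared
    around [v], by Fubini alone. *)
Let smooth_q (e : R) (v y : X) : 0 < e ->
  Cintegral L (fun q => (hfun k f (y, q))%:C%C * (2 ^+ n * Lp (tscale e q))%:C%C *
     expi (k * tdot q v)) =
  Cintegral L (fun b => Kfun f y b * (gker e v b)%:C%C).
Proof.
move=> e0; have iK := cintegrable_Kfun mf f2 y.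
have iL : cintegrable L (fun q => (2 ^+ n * Lp (tscale e q))%:C%C).
  exact: (cintegrable_real (g := fun q => 2 ^+ n * Lp (tscale e q))
    (integrableZl measurableT (2 ^+ n) (integrable_Lpe e0))).
pose u (z : X * X) := expi (- (k * tdot z.1 (tadd z.2 (tneg v)))).
have uE q b : u (q, b) = expi (k * tdot q v) * expi (- (k * tdot q b)).
  by rewrite /u -expiD; congr expi; rewrite /= tdotDr tdotNr; ring.
have mu : cmeasurable u.
  apply: measurable_phase; first exact: measurable_fst.
  by apply: measurable_tadd; [exact: measurable_snd|exact: measurable_cst].
pose G (z : X * X) := (2 ^+ n * Lp (tscale e z.1))%:C%C * Kfun f y z.2 * u z.
have iG : cintegrable (L \x L)%E G.
  have u1 z : normc (u z) <= 1 by rewrite normc_expi.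
  exact: (cintegrable_tensor iL iK mu u1).
transitivity (Cintegral L (fun q => Cintegral L (fun b => G (q, b)))).
  apply: eq_Cintegral => q.
  rewrite -mulrA mulrC -(hfun_Fourier k mf f2) -CintegralZl.
    by apply: eq_Cintegral => b; rewrite /G/= uE; ring.
  apply: cintegrable_phase => //.
  by apply: measurableT_comp => //; exact: measurable_funM.
rewrite Cintegral_swap//; apply: eq_Cintegral => b.
rewrite -fourier_laplace// -CintegralZl.
  by apply: eq_Cintegral => q; rewrite /G/= /u/=; ring.
apply: cintegrable_phase => //.
apply: measurableT_comp => //; apply: measurable_funM => //.
by under eq_fun do rewrite tdotC; exact: measurable_dot.
Qed.

Let gker_ge0 e v b : 0 < e -> 0 <= gker e v b.
Proof. by move=> e0; rewrite /gker !mulr_ge0 ?Cp_ge0 ?exprn_ge0// invr_ge0 exprn_ge0// ltW. Qed.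

Let gker_le e v b : 0 < e -> gker e v b <= 2 ^+ n * (e ^+ n)^-1.
Proof.
move=> e0; rewrite /gker ler_piMr ?Cp_le1//.
by rewrite mulr_ge0 ?exprn_ge0// invr_ge0 exprn_ge0// ltW.
Qed.

Let measurable_gker e v : measurable_fun setT (gker e v).
Proof.
apply: measurable_funM; first exact: measurable_cst.
apply: (measurableT_comp measurable_Cp); apply: measurable_tscale.
by apply: measurable_tadd => //; exact: measurable_cst.
Qed.

Lemma integrable_Cpe e : 0 < e -> L.-integrable setT (fun y => (Cp (tscale e y))%:E).
Proof.
move=> e0; have e0' : e != 0 by rewrite gt_eqF.
have := integrable_lebn_affine (@tzero R n) e0' integrable_Cp.
congr (integrable _ _ _); apply/funext => q /=; congr (Cp _)%:E.
by apply: eq_from_tnth => i; rewrite !tupE add0r.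
Qed.

(** The factor 2^n compensates [laplace 0 = 1/2], so that the window is 1 at the origin and tends to
    1 everywhere as [e] tends to 0. *)
Definition window (e : R) (z : X * X) : R :=
  2 ^+ n * Lp (tscale e z.2) * Cp (tscale e z.1).

(** The momentum integral is replaced by one of [Kfun f y] against a bump at [v]; after exchanging
    the arguments of [Kfun], the position integral is again a momentum transform, taken at [om]. The
    result is an average of [hfun] near [(v, om)]. *)
Lemma regularized_duality (e : R) (v om : X) : 0 < e ->
  Cintegral L (fun y => Cintegral L (fun q => (hfun k f (y, q) * window e (y, q))%:C%C *
    expi (k * (tdot q v - tdot om y)))) =
  (((2 / k) ^+ n)%:C)%C * Cintegral L (fun b => Cintegral L (fun s =>
    (Cp b * Lp s * hfun k f (tadd v (tscale (e / k) b), tadd om (tscale (e / k) s)))%:C%C)).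
Proof.
move=> e0.
pose ph (y : X) := expi (- (k * tdot om y)).
have mph : cmeasurable ph by apply: measurable_phase => //; exact: measurable_cst.
pose G (z : X * X) := (Cp (tscale e z.1))%:C%C * ph z.1 * (Kfun f z.1 z.2 * (gker e v z.2)%:C%C).
have mG : cmeasurable G.
  apply: cmeasurableM; apply: cmeasurableM.
  - apply: cmeasurable_real; apply: (measurableT_comp measurable_Cp).
    by apply: measurable_tscale; exact: measurable_fst.
  - exact: (cmeasurable_comp mph measurable_fst).
  - exact: measurable_Kfun.
  - apply: cmeasurable_real; exact: (measurableT_comp (measurable_gker e v) measurable_snd).
pose M := 2 ^+ n * (e ^+ n)^-1.
have M0 : 0 <= M by rewrite mulr_ge0 ?exprn_ge0// invr_ge0 exprn_ge0// ltW.
have mK1 y : measurable_fun setT (fun b => (normc (Kfun f y b))%:E).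
  apply/measurable_EFinP; apply: measurable_normc.
  by apply: measurable_Kfun => //; exact: measurable_cst.
have iG : cintegrable (L \x L)%E G.
  apply: cintegrable_prod => //.
  (* The bump is at most [M], [Kfun] has L1 norm bounded uniformly in [y], and the Cauchy window is
     integrable in [y]. *)
  apply: (@le_lt_trans _ _ (\int[L]_y ((Cp (tscale e y))%:E * (M * (2 * sqnorm f ^+ 2))%:E))%E).
    apply: ge0_le_integral => //.
    - by move=> y _; apply: integral_ge0 => b _; rewrite lee_fin normc_ge0.
    - apply: (@measurable_fun_fubini_tonelli_F _ _ _ _ _ L (fun z => (normc (G z))%:E)).
        by apply/measurable_EFinP; exact: measurable_normc.
      by move=> z; rewrite lee_fin normc_ge0.
    - apply: emeasurable_funM; last exact: measurable_cst.
      exact: (measurable_int _ (integrable_Cpe e0)).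
    - move=> y _.
      apply: (@le_trans _ _ (\int[L]_b ((Cp (tscale e y) * M)%:E * (normc (Kfun f y b))%:E))%E).
        apply: ge0_le_integral => //.
        + by move=> b _; rewrite lee_fin normc_ge0.
        + apply/measurable_EFinP.
          exact: (measurableT_comp (measurable_normc mG) (measurable_pair1 y)).
        + by apply: emeasurable_funM => //; exact: measurable_cst.
        + move=> b _; rewrite -EFinM lee_fin.
          have -> : G (y, b) = (Cp (tscale e y))%:C%C * ph y * (Kfun f y b * (gker e v b)%:C%C) by [].
          rewrite ComplexField.Normc.normcM [normc (_ * ph y)]ComplexField.Normc.normcM.
          rewrite [normc (Kfun f y b * _)]ComplexField.Normc.normcM /ph normc_expi mulr1.
          rewrite (normc_real (Cp_ge0 _)) (normc_real (gker_ge0 v b e0)) -mulrA.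
          apply: ler_wpM2l; first exact: Cp_ge0.
          by rewrite mulrC; apply: ler_wpM2r; [exact: normc_ge0|exact: gker_le].
      rewrite ge0_integralZl; last 4 first.
      + by [].
      + exact: mK1.
      + by move=> b _; rewrite lee_fin normc_ge0.
      + by rewrite lee_fin mulr_ge0// Cp_ge0.
      rewrite EFinM -muleA [in leRHS]EFinM.
      apply: lee_wpmul2l; first by rewrite lee_fin Cp_ge0.
      apply: lee_wpmul2l; first by rewrite lee_fin.
      exact: Kfun_bound.
  rewrite ge0_integralZr; last 4 first.
  - by [].
  - exact: (measurable_int _ (integrable_Cpe e0)).
  - by move=> y _; rewrite lee_fin Cp_ge0.
  - by rewrite lee_fin mulr_ge0// mulr_ge0// sqr_ge0.
  by rewrite -(fineK (integrable_fin_num measurableT (integrable_Cpe e0))) -EFinM ltry.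
transitivity (Cintegral L (fun y => Cintegral L (fun b => G (y, b)))).
  apply: eq_Cintegral => y.
  have iKg : cintegrable L (fun b => Kfun f y b * (gker e v b)%:C%C).
    have iK := cintegrable_Kfun mf f2 y.
    apply: (le_cintegrable _ _ (integrableZl measurableT M (integrable_normc iK))).
      apply: cmeasurableM; first exact: (cintegrable_measurable iK).
      exact: cmeasurable_real.
    move=> b; rewrite ComplexField.Normc.normcM (normc_real (gker_ge0 v b e0)) mulrC.
    by apply: ler_wpM2r; [exact: normc_ge0|exact: gker_le].
  rewrite /G/= CintegralZl// -smooth_q// -CintegralZl.
    apply: eq_Cintegral => q; rewrite /window/= !rmorphM/= /ph.
    rewrite (_ : k * (tdot q v - tdot om y) = k * tdot q v + - (k * tdot om y)); last by ring.
    by rewrite expiD; ring.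
  have iLq : cintegrable L (fun q => (hfun k f (y, q))%:C%C * (2 ^+ n * Lp (tscale e q))%:C%C).
    apply: (le_cintegrable (g := fun q => sqnorm f ^+ 2 * 2 ^+ n * Lp (tscale e q))).
    - apply: cmeasurableM.
        apply: cmeasurable_real.
        exact: (measurableT_comp (measurable_hfun k mf) (measurable_pair1 y)).
      apply: cmeasurable_real; apply: measurable_funM; first exact: measurable_cst.
      by apply/measurable_EFinP; exact: (measurable_int _ (integrable_Lpe e0)).
    - move=> q.
      have c0 : 0 <= 2 ^+ n * Lp (tscale e q) by rewrite mulr_ge0 ?exprn_ge0 ?Lp_ge0.
      rewrite ComplexField.Normc.normcM (normc_real c0) -mulrA; apply: ler_wpM2r => //.
      apply: le_trans (hfun_bound k mf f2 (y, q)).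
      by rewrite /= expr0n addr0 sqrtr_sqr.
    - exact: (integrableZl measurableT _ (integrable_Lpe e0)).
  apply: cintegrable_phase => //; apply: measurable_funM; first exact: measurable_cst.
  by under eq_fun do rewrite tdotC; exact: measurable_dot.
rewrite Cintegral_swap//.
pose Phi (b : X) := Cintegral L (fun s => (Lp s * hfun k f (b, tadd om (tscale (e / k) s)))%:C%C).
have inner b : Cintegral L (fun y => G (y, b)) = (gker e v b)%:C%C * Phi b.
  rewrite /Phi -smooth_y -CintegralZl.
    (* The symmetry of [Kfun] turns the position [y] into the dual variable of a momentum. *)
    apply: eq_Cintegral => y; rewrite /G/= KfunC /ph; ring.
  apply: cintegrable_phase; last by apply: measurableT_comp => //; exact: measurable_funM.
  have iK := cintegrable_Kfun mf f2 b.
  apply: (le_cintegrable _ _ (integrable_normc iK)).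
    apply: cmeasurableM; first exact: (cintegrable_measurable iK).
    apply: cmeasurable_real; by apply/measurable_EFinP; exact: (measurable_int _ (integrable_Cpe e0)).
  move=> y; rewrite ComplexField.Normc.normcM normc_real ?Cp_ge0//.
  by rewrite ler_piMr ?normc_ge0// Cp_le1.
have iLs b : cintegrable L (fun s => (Lp s * hfun k f (b, tadd om (tscale (e / k) s)))%:C%C).
  apply: cintegrable_real.
  apply: (le_integrable measurableT _ _ (integrableZl measurableT (sqnorm f ^+ 2) integrable_Lp)).
    apply/measurable_EFinP; apply: measurable_funM; first exact: measurable_Lp.
    apply: (measurableT_comp (measurable_hfun k mf)); apply: measurable_fun_pair.
      exact: measurable_cst.
    exact: measurable_tadd_tscale.
  move=> s _; rewrite /= lee_fin normrM mulrC.
  have c0 : 0 <= sqnorm f ^+ 2 * Lp s by rewrite mulr_ge0 ?sqr_ge0 ?Lp_ge0.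
  rewrite (ger0_norm c0).
  by rewrite [`|Lp s|]ger0_norm ?Lp_ge0//; apply: ler_wpM2r; [exact: Lp_ge0|exact: hfun_bound].
have PhiM b : normc (Phi b) <= 2 * sqnorm f ^+ 2.
  have := lee_normc_Cintegral L (cintegrable_measurable (iLs b)).
  rewrite -lee_fin => /le_trans; apply.
  rewrite EFinM; apply: lee_wpmul2l => //.
  apply: (@le_trans _ _ (\int[L]_s ((sqnorm f ^+ 2)%:E * (Lp s)%:E))%E).
    apply: ge0_le_integral => //.
    - by move=> s _; rewrite lee_fin normc_ge0.
    - by apply/measurable_EFinP; apply: measurable_normc; exact: (cintegrable_measurable (iLs b)).
    - apply: emeasurable_funM; first exact: measurable_cst.
      exact: (measurable_int _ integrable_Lp).
    - move=> s _; rewrite -EFinM lee_fin /= expr0n addr0 sqrtr_sqr normrM mulrC.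
      by rewrite [`|Lp s|]ger0_norm ?Lp_ge0//; apply: ler_wpM2r; [exact: Lp_ge0|exact: hfun_bound].
  rewrite ge0_integralZl; last 4 first.
  - by [].
  - exact: (measurable_int _ integrable_Lp).
  - by move=> s _; rewrite lee_fin Lp_ge0.
  - by rewrite lee_fin sqr_ge0.
  rewrite (integral_tprod n (measurable_laplace (R:=R)) (@laplace_ge0 R) (integral_laplace R)).
  by rewrite expr1n mule1.
have mPhi : cmeasurable Phi.
  pose H (z : X * X) := (Lp z.2 * hfun k f (z.1, tadd om (tscale (e / k) z.2)))%:C%C.
  apply: (cmeasurable_Cintegral L (F := H)); apply: cmeasurable_real; apply: measurable_funM.
    exact: (measurableT_comp measurable_Lp measurable_snd).
  apply: (measurableT_comp (measurable_hfun k mf)); apply: measurable_fun_pair.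
    exact: measurable_fst.
  apply: measurable_tadd; first exact: measurable_cst.
  by apply: measurable_tscale; exact: measurable_snd.
pose F2 b := (Cp b)%:C%C * Phi (tadd v (tscale (e / k) b)).
have iF2 : cintegrable L F2.
  apply: (le_cintegrable _ _ (integrableZr measurableT (2 * sqnorm f ^+ 2) integrable_Cp)).
    apply: cmeasurableM; first by apply: cmeasurable_real; exact: measurable_Cp.
    exact: (cmeasurable_comp mPhi (measurable_tadd_tscale v (e / k))).
  move=> b; rewrite ComplexField.Normc.normcM normc_real ?Cp_ge0//.
  by rewrite ler_wpM2l ?Cp_ge0.
have ke0 : k / e != 0 by rewrite mulf_neq0 ?invr_neq0 ?gt_eqF.
have kne : k != 0 by rewrite gt_eqF.
have ene : e != 0 by rewrite gt_eqF.
(* Rescaling b to (k / e) (b - v) normalizes the bump; its Jacobian (e / k)^n changes [M] = (2 /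
   e)^n into (2 / k)^n. *)
transitivity (Cintegral L (fun b => M%:C%C * F2 (tadd (tscale (- (k / e)) v) (tscale (k / e) b)))).
  apply: eq_Cintegral => b; rewrite inner /F2 mulrA -rmorphM/= /gker -/M.
  congr ((M * Cp _)%:C%C * Phi _); apply: eq_from_tnth => i; rewrite !tupE.
    by field.
  by field; rewrite kne ene.
rewrite CintegralZl; last exact: cintegrable_lebn_affine.
rewrite Cintegral_lebn_affine// mulrA -rmorphM/=; congr (_%:C%C * _).
  rewrite gtr0_norm ?divr_gt0// /M !expr_div_n.
  by move: (2 ^+ n) (e ^+ n) (k ^+ n) (expf_neq0 n ene) (expf_neq0 n kne) => a b c b0 c0; field; rewrite b0 c0.
apply: eq_Cintegral => b; rewrite /F2 /Phi -CintegralZl; last exact: iLs.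
by apply: eq_Cintegral => s; rewrite -rmorphM/= mulrA.
Qed.

End regularization.

(** * Joint continuity of the Wigner function *)

Section wigner_continuity.
Variables (R : realType) (n : nat) (k : R).
Local Notation X := (n.-tuple R).
Local Notation L := (lebn R n).
Local Notation normc := ComplexField.Normc.normc.
Variable f : X -> R[i].
Hypothesis mf : cmeasurable f.
Hypothesis f2 : L.-integrable setT (fun t => (normc (f t) ^+ 2)%:E).

(* Reduces translation continuity in L2 to translation continuity in L1 of the
   signed square. *)
Lemma sqr_diff_le (a b : R) : (a - b) ^+ 2 <= 2 * `|a * `|a| - b * `|b| |.
Proof.
have [a0|/ltW a0] := leP 0 a; have [b0|/ltW b0] := leP 0 b;
  rewrite ?(ger0_norm a0) ?(ger0_norm b0) ?(ler0_norm a0) ?(ler0_norm b0).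
- rewrite (_ : a * a - b * b = (a - b) * (a + b)); last by ring.
  rewrite normrM (ger0_norm (addr_ge0 a0 b0)) -(real_normK (num_real (a - b))) expr2.
  have h : `|a - b| <= a + b by rewrite ler_norml; apply/andP; split; lra.
  have := normr_ge0 (a - b); set u := `|a - b| in h *; nra.
- rewrite (_ : a * a - b * - b = a ^+ 2 + b ^+ 2); last by ring.
  rewrite (ger0_norm (addr_ge0 (sqr_ge0 a) (sqr_ge0 b))) -subr_ge0.
  by rewrite (_ : _ - _ = (a + b) ^+ 2) ?sqr_ge0//; ring.
- rewrite (_ : a * - a - b * b = - (a ^+ 2 + b ^+ 2)); last by ring.
  rewrite normrN (ger0_norm (addr_ge0 (sqr_ge0 a) (sqr_ge0 b))) -subr_ge0.
  by rewrite (_ : _ - _ = (a + b) ^+ 2) ?sqr_ge0//; ring.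
- rewrite (_ : a * - a - b * - b = (a - b) * (- a - b)); last by ring.
  have ab0 : 0 <= - a - b by lra.
  rewrite normrM (ger0_norm ab0) -(real_normK (num_real (a - b))) expr2.
  have h : `|a - b| <= - a - b by rewrite ler_norml; apply/andP; split; lra.
  have := normr_ge0 (a - b); set u := `|a - b| in h *; nra.
Qed.

Let g (p : R[i] -> R) t := p (f t) * `|p (f t)|.

Let integrable_g (p : R[i] -> R) : measurable_fun setT (fun t => p (f t)) ->
  (forall z, `|p z| <= normc z) -> L.-integrable setT (EFin \o g p).
Proof.
move=> mp pn; apply: le_integrable f2 => //.
  apply/measurable_EFinP; apply: measurable_funM => //.
  exact: measurableT_comp.
move=> t _; rewrite /= lee_fin normrM normr_id expr2 [leRHS]ger0_norm ?mulr_ge0 ?normc_ge0//.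
by rewrite ler_pM.
Qed.

Lemma cvg0_L2_translate (v : nat -> X) : (forall i, tnth (v j) i @[j --> \oo] --> 0) ->
  (\int[L]_t (normc (f (tadd (v j) t) - f t) ^+ 2)%:E)%E @[j --> \oo] --> 0%E.
Proof.
move=> v0; have [m1 m2] := mf.
have i1 := integrable_g m1 (@ler_Re_normc R).
have i2 := integrable_g m2 (@ler_Im_normc R).
have mg1 : measurable_fun setT (g (@complex.Re R)) by have /measurable_EFinP := measurable_int _ i1.
have mg2 : measurable_fun setT (g (@complex.Im R)) by have /measurable_EFinP := measurable_int _ i2.
have pos (p : X -> R) j : (0 <= \int[L]_t `|(p (tadd (v j) t) - p t)%:E|)%E by exact: integral_ge0.
have /(ge0_cvge0P (pos _)).1 c1 := cvg0_L1_translate i1 v0.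
have /(ge0_cvge0P (pos _)).1 c2 := cvg0_L1_translate i2 v0.
apply/ge0_cvge0P => [j|e e0]; first by apply: integral_ge0 => t _; rewrite lee_fin sqr_ge0.
have e4 : 0 < e / 4 by rewrite divr_gt0.
near=> j.
have mD (p : X -> R) : measurable_fun setT p ->
    measurable_fun setT (fun t => 2%:E * `|(p (tadd (v j) t) - p t)%:E|)%E.
  move=> mp; apply: measurable_funeM; apply: measurable_abs_diff => //.
  exact: measurable_translate.
apply: (@le_trans _ _ (\int[L]_t (2%:E * `|(g (@complex.Re R) (tadd (v j) t) - g (@complex.Re R) t)%:E| +
   2%:E * `|(g (@complex.Im R) (tadd (v j) t) - g (@complex.Im R) t)%:E|))%E).
  apply: ge0_le_integral => //.
  - by move=> t _; rewrite lee_fin sqr_ge0.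
  - apply/measurable_EFinP; under eq_fun do rewrite sqr_normc_Re_Im.
    apply: measurable_funD; apply: measurable_funX.
      rewrite (_ : (fun x => _) = fun x => complex.Re (f (tadd (v j) x)) - complex.Re (f x)).
        by apply: measurable_funB => //; exact: (measurable_translate (v j) m1).
      by apply/funext => x; case: (f _) (f x) => [? ?] [? ?].
    rewrite (_ : (fun x => _) = fun x => complex.Im (f (tadd (v j) x)) - complex.Im (f x)).
      by apply: measurable_funB => //; exact: (measurable_translate (v j) m2).
    by apply/funext => x; case: (f _) (f x) => [? ?] [? ?].
  - by apply: emeasurable_funD; exact: mD.
  - move=> t _; rewrite !abse_EFin -!EFinM -EFinD lee_fin sqr_normc_Re_Im /g.
    case: (f (tadd (v j) t)) (f t) => [a b] [c d] /=.
    by rewrite lerD// sqr_diff_le.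
rewrite ge0_integralD; last 5 first.
- by [].
- by move=> t _; rewrite mule_ge0.
- exact: mD.
- by move=> t _; rewrite mule_ge0.
- exact: mD.
rewrite !ge0_integralZl//; last 2 first.
- by apply: measurable_abs_diff => //; exact: measurable_translate.
- by apply: measurable_abs_diff => //; exact: measurable_translate.
have h1 : (\int[L]_t `|(g (@complex.Re R) (tadd (v j) t) - g (@complex.Re R) t)%:E| <= (e / 4)%:E)%E.
  by near: j; exact: c1.
have h2 : (\int[L]_t `|(g (@complex.Im R) (tadd (v j) t) - g (@complex.Im R) t)%:E| <= (e / 4)%:E)%E.
  by near: j; exact: c2.
apply: le_trans (leeD (lee_wpmul2l _ h1) (lee_wpmul2l _ h2)) _ => //.
by rewrite -!EFinM -EFinD lee_fin; lra.
Unshelve. all: by end_near. Qed.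

Section convergent_sequences.
Variables (x_ p_ : nat -> X) (x p : X).
Hypothesis xc : forall i, tnth (x_ j) i @[j --> \oo] --> tnth x i.
Hypothesis pc : forall i, tnth (p_ j) i @[j --> \oo] --> tnth p i.

Let dv j := tadd (x_ j) (tneg x).

Let dv0 i : tnth (dv j) i @[j --> \oo] --> 0.
Proof.
under eq_fun do rewrite /dv tnth_tadd tnth_tneg.
rewrite -(subrr (tnth x i)); apply: cvgB; [exact: xc|exact: cvg_cst].
Qed.

Let phi j t := normc (f (tadd (dv j) t) - f t) ^+ 2.

Let mphi j : measurable_fun setT (fun t => (phi j t)%:E).
Proof.
have [m1 m2] := mf.
apply/measurable_EFinP; rewrite /phi; under eq_fun do rewrite sqr_normc_Re_Im.
apply: measurable_funD; apply: measurable_funX.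
  rewrite (_ : (fun x => _) = fun x => complex.Re (f (tadd (dv j) x)) - complex.Re (f x)).
    by apply: measurable_funB => //; exact: (measurable_translate (dv j) m1).
  by apply/funext => t; case: (f _) (f t) => [? ?] [? ?].
rewrite (_ : (fun x => _) = fun x => complex.Im (f (tadd (dv j) x)) - complex.Im (f x)).
  by apply: measurable_funB => //; exact: (measurable_translate (dv j) m2).
by apply/funext => t; case: (f _) (f t) => [? ?] [? ?].
Qed.

Let phi0 j t : (0 <= (phi j t)%:E)%E. Proof. by rewrite lee_fin sqr_ge0. Qed.

Let D j := (\int[L]_t (phi j t)%:E)%E.

Let D_shift (c : R) j : `|c| = 1 ->
  (\int[L]_s (phi j (tadd x (tscale c s)))%:E)%E = D j.
Proof.
move=> c1; have c0 : c != 0 by rewrite -normr_eq0 c1 oner_eq0.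
rewrite (ge0_integral_lebn_affine x c0 (mphi j) (phi0 j)).
by rewrite c1 expr1n invr1 mul1e.
Qed.

Let N : R := sqnorm f.

Let int_shift (c : R) y : `|c| = 1 ->
  (\int[L]_s (normc (f (tadd y (tscale c s))) ^+ 2)%:E)%E = N%:E.
Proof.
move=> c1; have c0 : c != 0 by rewrite -normr_eq0 c1 oner_eq0.
have m2 : measurable_fun setT (fun t => (normc (f t) ^+ 2)%:E) := measurable_int _ f2.
rewrite (ge0_integral_lebn_affine y c0 m2) => [|t]; last by rewrite lee_fin sqr_ge0.
rewrite c1 expr1n invr1 mul1e /N /sqnorm fineK//.
exact: (integrable_fin_num measurableT f2).
Qed.

Let N0 : 0 <= N. Proof. by apply: Rintegral_ge0 => t _; rewrite sqr_ge0. Qed.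

Let dA j s := normc (autocorr f (x_ j) s - autocorr f x s).

(** A weighted arithmetic-geometric inequality with free parameter [l] plays the role of
    Cauchy-Schwarz: the small weight goes to the bounded norms and the large one to the vanishing L2
    distances. *)
Let dA_le (l : R) j s : 0 < l -> dA j s <=
  l / 2 * (normc (f (tadd (x_ j) (tscale (-1) s))) ^+ 2 + normc (f (tadd x (tscale 1 s))) ^+ 2) +
  (2 * l)^-1 * (phi j (tadd x (tscale 1 s)) + phi j (tadd x (tscale (-1) s))).
Proof.
move=> l0; rewrite /dA /autocorr /phi -/(tneg s) tscale1.
have -> : tadd (dv j) (tadd x s) = tadd (x_ j) s.
  by apply: eq_from_tnth => i; rewrite !tupE; ring.
have -> : tadd (dv j) (tadd x (tneg s)) = tadd (x_ j) (tneg s).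
  by apply: eq_from_tnth => i; rewrite !tupE; ring.
set a := f (tadd (x_ j) s); set b := f (tadd (x_ j) (tneg s)).
set a' := f (tadd x s); set b' := f (tadd x (tneg s)).
have -> : a * b^*%C - a' * b'^*%C = (a - a') * b^*%C + a' * (b - b')^*%C.
  by rewrite rmorphB/=; ring.
apply: le_trans (le_normcD _ _) _.
rewrite !ComplexField.Normc.normcM !normc_conj.
have amgm (u w : R) : u * w <= l / 2 * w ^+ 2 + (2 * l)^-1 * u ^+ 2.
  rewrite -subr_ge0 (_ : _ - _ = (2 * l)^-1 * (u - l * w) ^+ 2).
    by rewrite mulr_ge0 ?sqr_ge0// invr_ge0 mulr_ge0// ltW.
  by field; rewrite gt_eqF.
have := amgm (normc (a - a')) (normc b).
have := amgm (normc (b - b')) (normc a').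
by rewrite [normc a' * _]mulrC; lra.
Qed.

Let mdA j : measurable_fun setT (fun s => (dA j s)%:E).
Proof.
have [m1 m2] := cintegrable_measurable (cintegrable_autocorr mf f2 (x_ j)).
have [m3 m4] := cintegrable_measurable (cintegrable_autocorr mf f2 x).
apply/measurable_EFinP; apply: (measurable_normc (F := fun s => _ - _)); split.
  rewrite (_ : (fun x => _) = fun s => complex.Re (autocorr f (x_ j) s) - complex.Re (autocorr f x s)).
    exact: measurable_funB.
  by apply/funext => t; case: (autocorr f (x_ j) t) (autocorr f x t) => [? ?] [? ?].
rewrite (_ : (fun x => _) = fun s => complex.Im (autocorr f (x_ j) s) - complex.Im (autocorr f x s)).
  exact: measurable_funB.
by apply/funext => t; case: (autocorr f (x_ j) t) (autocorr f x t) => [? ?] [? ?].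
Qed.

Let cvg0_dA : (\int[L]_s (dA j s)%:E)%E @[j --> \oo] --> 0%E.
Proof.
apply/ge0_cvge0P => [j|e e0]; first by apply: integral_ge0 => t _; rewrite lee_fin normc_ge0.
(* The norms then contribute l N <= e / 2, and distances below l e / 2 contribute at most e / 2. The
   added 1 keeps the denominator positive when [N] is 0. *)
pose l := e / (2 * N + 1).
have l0 : 0 < l by rewrite divr_gt0// ltr_wpDl// mulr_ge0.
have lN : l * N <= e / 2.
  rewrite /l mulrAC ler_pdivrMr ?ltr_wpDl ?mulr_ge0//.
  by rewrite mulrDr (_ : e / 2 * (2 * N) = e * N) ?lerDl ?mulr1 ?divr_ge0 ?ltW//; field.
have D0 j : (0 <= D j)%E by exact: integral_ge0.
have Dc : D @ \oo --> 0%E by exact: cvg0_L2_translate dv0.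
have le0 : 0 < l * e / 2 by rewrite divr_gt0// mulr_gt0.
have := (ge0_cvge0P D0).1 Dc _ le0; apply: filterS => j Dj.
have mn (c : R) y : measurable_fun setT (fun s => (normc (f (tadd y (tscale c s))) ^+ 2)%:E).
  have m2 : measurable_fun setT (fun t => (normc (f t) ^+ 2)%:E) := measurable_int _ f2.
  exact: (measurableT_comp m2 (measurable_tadd_tscale y c)).
have mp (c : R) : measurable_fun setT (fun s => (phi j (tadd x (tscale c s)))%:E).
  exact: (measurableT_comp (mphi j) (measurable_tadd_tscale x c)).
have n0 y s : (0 <= (normc (f (tadd y s)) ^+ 2)%:E)%E by rewrite lee_fin sqr_ge0.
have l20 : 0 <= l / 2 by rewrite divr_ge0// ltW.
have l2V0 : 0 <= (2 * l)^-1 by rewrite invr_ge0 mulr_ge0// ltW.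
apply: (@le_trans _ _ (\int[L]_s (((l / 2)%:E * ((normc (f (tadd (x_ j) (tscale (-1) s))) ^+ 2)%:E +
   (normc (f (tadd x (tscale 1 s))) ^+ 2)%:E)) +
  ((2 * l)^-1)%:E * ((phi j (tadd x (tscale 1 s)))%:E + (phi j (tadd x (tscale (-1) s)))%:E)))%E).
  apply: ge0_le_integral => //.
  - by move=> s _; rewrite lee_fin normc_ge0.
  - by apply: emeasurable_funD; apply: measurable_funeM; apply: emeasurable_funD.
  - by move=> s _; have := dA_le j s l0; rewrite -lee_fin.
rewrite ge0_integralD; last 5 first.
- by [].
- by move=> s _; rewrite mule_ge0 ?lee_fin// addr_ge0 ?sqr_ge0.
- by apply: measurable_funeM; apply: emeasurable_funD.
- by move=> s _; rewrite mule_ge0 ?lee_fin// addr_ge0 ?sqr_ge0.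
- by apply: measurable_funeM; apply: emeasurable_funD.
rewrite ge0_integralZl; last 4 first.
- by [].
- exact: emeasurable_funD.
- by move=> s _; rewrite adde_ge0.
- by rewrite lee_fin.
rewrite ge0_integralZl; last 4 first.
- by [].
- exact: emeasurable_funD.
- by move=> s _; rewrite adde_ge0.
- by rewrite lee_fin.
rewrite ge0_integralD// ge0_integralD//.
rewrite !int_shift ?normrN ?normr1// !D_shift ?normrN ?normr1//.
apply: (@le_trans _ _ ((l / 2)%:E * (N%:E + N%:E) + ((2 * l)^-1)%:E * ((l * e / 2)%:E + (l * e / 2)%:E))%E).
  apply: leeD => //; apply: lee_wpmul2l; first by rewrite lee_fin.
  exact: leeD.
rewrite -[leLHS]/((l / 2 * (N + N) + (2 * l)^-1 * (l * e / 2 + l * e / 2))%:E) lee_fin.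
rewrite (_ : l / 2 * (N + N) = l * N); last by field.
rewrite (_ : _ * (l * e / 2 + _) = e / 2); last by field; rewrite gt_eqF.
by lra.
Qed.

Let wigr_p_cvg : wigr k f (x, p_ j) @[j --> \oo] --> wigr k f (x, p).
Proof.
have iA := integrable_normc (cintegrable_autocorr mf f2 x).
have [|||||_ _] := @dominated_convergence _ _ _ L setT measurableT
  (fun j s => (complex.Re (autocorr f x s * expi (- (k / 2 * tdot (p_ j) s))))%:E)
  (fun s => (complex.Re (autocorr f x s * expi (- (k / 2 * tdot p s))))%:E)
  (fun s => (normc (autocorr f x s))%:E).
- move=> j; apply/measurable_EFinP.
  by have [] := cintegrable_measurable (cintegrable_wig k mf f2 x (p_ j)).
- apply/measurable_EFinP.
  by have [] := cintegrable_measurable (cintegrable_wig k mf f2 x p).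
- apply: nearW => s _; apply: cvg_EFin; first exact: nearW.
  have dc : tdot (p_ j) s @[j --> \oo] --> tdot p s.
    rewrite /tdot; apply: cvg_big; first exact: add_continuous.
    by move=> i _; apply: cvgMr_tmp; exact: pc.
  have {}dc : - (k / 2 * tdot (p_ j) s) @[j --> \oo] --> - (k / 2 * tdot p s).
    by apply: cvgN; apply: cvgMl_tmp.
  have cc := cvg_comp _ cos dc (@continuous_cos R _).
  have cs := cvg_comp _ sin dc (@continuous_sin R _).
  case: (autocorr f x s) => a b.
  under eq_fun do rewrite expiE /=.
  rewrite expiE /=.
  by apply: cvgB; apply: cvgMl_tmp.
- exact: iA.
- apply: nearW => s j _; rewrite abse_EFin lee_fin.
  apply: le_trans (ler_Re_normc _) _.
  by rewrite ComplexField.Normc.normcM normc_expi mulr1.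
have [i1 _] := cintegrable_wig k mf f2 x p.
rewrite -(fineK (integrable_fin_num measurableT i1)) => cv.
exact: ((fine_cvgP _ _).1 cv).2.
Qed.

(** A change of position costs at most the L1 distance of the autocorrelations, whatever the
    momentum; the change of momentum at fixed position is dominated convergence. *)
Lemma wigr_cvg : wigr k f (x_ j, p_ j) @[j --> \oo] --> wigr k f (x, p).
Proof.
have key j : (`|wigr k f (x_ j, p_ j) - wigr k f (x, p_ j)|%:E <= \int[L]_s (dA j s)%:E)%E.
  have [i1 _] := cintegrable_wig k mf f2 (x_ j) (p_ j).
  have [i2 _] := cintegrable_wig k mf f2 x (p_ j).
  have [m1 _] := cintegrable_measurable (cintegrable_wig k mf f2 (x_ j) (p_ j)).
  have [m2 _] := cintegrable_measurable (cintegrable_wig k mf f2 x (p_ j)).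
  have mB := measurable_funB m1 m2.
  rewrite /wigr /wig /Cintegral -[complex.Re (Complex _ _)]/(Rintegral _ _ _).
  rewrite -[complex.Re (Complex _ _)]/(Rintegral _ _ _) -RintegralB//.
  apply: le_trans (lee_abs_Rintegral L mB) _.
  apply: ge0_le_integral => //.
  - by apply/measurable_EFinP; exact: measurableT_comp.
  - move=> s _; rewrite lee_fin.
    rewrite [X in `|X|](_ : _ = complex.Re ((autocorr f (x_ j) s - autocorr f x s) * expi (- (k / 2 * tdot (p_ j) s)))).
      apply: le_trans (ler_Re_normc _) _.
      by rewrite ComplexField.Normc.normcM normc_expi mulr1.
    rewrite -[LHS]/(complex.Re (_ * _) - complex.Re (_ * _)).
    by case: (autocorr f (x_ j) s) (autocorr f x s) (expi _) => [a b] [c d] [u w] /=; ring.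
apply/cvgrPdist_le => e e0.
have e2 : 0 < e / 2 by rewrite divr_gt0.
have d0 j : (0 <= \int[L]_s (dA j s)%:E)%E by apply: integral_ge0 => t _; rewrite lee_fin normc_ge0.
have c1 := (ge0_cvge0P d0).1 cvg0_dA _ e2.
have /cvgrPdist_le/(_ _ e2) c2 := wigr_p_cvg.
near=> j.
have h1 : `|wigr k f (x_ j, p_ j) - wigr k f (x, p_ j)| <= e / 2.
  by rewrite -lee_fin; apply: le_trans (key j) _; near: j; exact: c1.
have h2 : `|wigr k f (x, p) - wigr k f (x, p_ j)| <= e / 2 by near: j; exact: c2.
rewrite (_ : _ - _ = (wigr k f (x, p) - wigr k f (x, p_ j)) - (wigr k f (x_ j, p_ j) - wigr k f (x, p_ j))); last by ring.
by apply: le_trans (ler_normB _ _) _; lra.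
Unshelve. all: by end_near. Qed.

End convergent_sequences.
End wigner_continuity.

Section limit_lemmas.
Context d (T : measurableType d) (R : realType) (mu : {measure set T -> \bar R}).

Lemma limn_einf_le (u : nat -> \bar R) (C : \bar R) :
  (forall j, u j <= C)%E -> (limn_einf u <= C)%E.
Proof.
move=> uC; rewrite limn_einf_lim; apply: lime_le; first exact: is_cvg_einfs.
apply: nearW => j; apply: le_trans (uC j); apply: ereal_inf_lbound.
by exists j => /=.
Qed.

Lemma fatou_bound (u : nat -> T -> R) (g : T -> R) (C : R) :
  (forall j, measurable_fun setT (u j)) -> (forall j x, 0 <= u j x) ->
  (forall x, u j x @[j --> \oo] --> g x) ->
  (forall j, \int[mu]_x (u j x)%:E <= C%:E)%E -> (\int[mu]_x (g x)%:E <= C%:E)%E.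
Proof.
move=> mu_ u0 ug uC.
have mE j : measurable_fun setT (fun x => (u j x)%:E) by exact/measurable_EFinP.
have f0 j x (_ : setT x) : (0 <= (u j x)%:E)%E by rewrite lee_fin.
have H := fatou mu measurableT mE f0.
rewrite (_ : (\int[mu]_x (g x)%:E)%E = (\int[mu]_x limn_einf (fun j => (u j x)%:E))%E).
  by apply: le_trans H _; exact: limn_einf_le.
apply: eq_integral => x _.
have cx : (u j x)%:E @[j --> \oo] --> (g x)%:E by apply: cvg_EFin; [exact: nearW|exact: ug].
rewrite is_cvg_limn_einfE; first by apply/esym/cvg_lim.
by apply/cvg_ex; eexists; exact: cx.
Qed.

Lemma Rdominated_cvg (u : nat -> T -> R) (g h : T -> R) :
  (forall j, measurable_fun setT (u j)) -> measurable_fun setT g ->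
  (forall x, u j x @[j --> \oo] --> g x) ->
  mu.-integrable setT (EFin \o h) -> (forall j x, `|u j x| <= h x) ->
  \int[mu]_x u j x @[j --> \oo] --> \int[mu]_x g x.
Proof.
move=> mu_ mg ug ih uh.
have [|||||ig _] := @dominated_convergence _ _ _ mu setT measurableT
  (fun j x => (u j x)%:E) (EFin \o g) (EFin \o h).
- by move=> j; exact/measurable_EFinP.
- exact/measurable_EFinP.
- by apply: nearW => x _; apply: cvg_EFin; [exact: nearW|exact: ug].
- exact: ih.
- by apply: nearW => x j _; rewrite /= lee_fin.
rewrite -(fineK (integrable_fin_num measurableT ig)) => cv.
exact: ((fine_cvgP _ _).1 cv).2.
Qed.

End limit_lemmas.

Lemma integrable_tensor d1 d2 (T1 : measurableType d1) (T2 : measurableType d2) (R : realType)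
    (m1 : {sigma_finite_measure set T1 -> \bar R})
    (m2 : {sigma_finite_measure set T2 -> \bar R}) (f : T1 -> R) (g : T2 -> R) :
  m1.-integrable setT (EFin \o f) -> m2.-integrable setT (EFin \o g) ->
  (m1 \x m2)%E.-integrable setT (fun z => (f z.1 * g z.2)%:E).
Proof.
move=> If Ig.
have cf : cintegrable m1 (fun x => (f x)%:C%C) by split => //=; exact: integrable0.
have cg : cintegrable m2 (fun x => (g x)%:C%C) by split => //=; exact: integrable0.
have c1 : cmeasurable (fun _ : T1 * T2 => 1 : R[i]) by split; exact: measurable_cst.
have b1 (z : T1 * T2) : ComplexField.Normc.normc (1 : R[i]) <= 1.
  by rewrite ComplexField.Normc.normc1.
have [+ _] := cintegrable_tensor cf cg c1 b1.
congr (integrable _ _ _); apply/funext => z.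
by rewrite /= !(mul0r, mulr0, subr0, addr0, mulr1).
Qed.

(** * Removal of the window *)

Section self_duality.
Variables (R : realType) (n : nat) (k : R).
Hypothesis k0 : 0 < k.
Local Notation X := (n.-tuple R).
Local Notation L := (lebn R n).
Local Notation LL := (L \x L)%E.
Local Notation normc := ComplexField.Normc.normc.
Local Notation Lp := (@tprod R n (@laplace R)).
Local Notation Cp := (@tprod R n (@cauchy R)).
Local Notation window := (@window R n).
Variable f : X -> R[i].
Hypothesis mf : cmeasurable f.
Hypothesis f2 : L.-integrable setT (fun t => (normc (f t) ^+ 2)%:E).
Local Notation h := (hfun k f).

Let eps (j : nat) : R := j.+1%:R^-1.
Let eps0 j : 0 < eps j. Proof. by rewrite invr_gt0. Qed.
Let eps_cvg : eps @ \oo --> 0. Proof. exact: cvg_harmonic. Qed.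

Let window_ge0 e z : 0 <= window e z.
Proof. by rewrite /window !mulr_ge0 ?exprn_ge0// ?Lp_ge0 ?Cp_ge0. Qed.

Let window_le1 e z : window e z <= 1.
Proof.
rewrite /window -[leRHS]mulr1 ler_pM ?Cp_le1 ?Cp_ge0 ?mulr_ge0 ?exprn_ge0 ?Lp_ge0//.
rewrite /tprod -[X in _ ^+ X]card_ord -prodr_const -big_split /=.
apply: prodr_ile1 => i _; rewrite mulr_ge0 ?laplace_ge0//=.
by rewrite -ler_pdivlMl// mulr1; exact: laplace_le.
Qed.

Let tprod_cvg (phi : R -> R) (t : X) : continuous phi ->
  tprod phi (tscale (eps j) t) @[j --> \oo] --> phi 0 ^+ n.
Proof.
move=> cphi; rewrite -[X in _ ^+ X]card_ord -prodr_const.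
apply: cvg_big; first exact: mul_continuous.
move=> i _; under eq_fun do rewrite tnth_tscale.
have c0 : eps j * tnth t i @[j --> \oo] --> 0.
  by rewrite -(mul0r (tnth t i)); apply: cvgMr_tmp.
exact: (cvg_comp _ phi c0 (cphi 0)).
Qed.

Let window_cvg z : window (eps j) z @[j --> \oo] --> (1 : R).
Proof.
have e : 2 ^+ n * laplace 0 ^+ n * cauchy 0 ^+ n = 1 :> R.
  rewrite -!exprMn (_ : _ * _ = 1) ?expr1n// /laplace /cauchy normr0 oppr0 expR0 expr0n /=.
  by rewrite addr0 invr1 mulr1 mul1r divff.
rewrite -e; apply: cvgM; last by apply: tprod_cvg; exact: continuous_cauchy.
by apply: cvgMl_tmp; apply: tprod_cvg; exact: continuous_laplace.
Qed.

Let measurable_window e : measurable_fun setT (window e).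
Proof.
apply: measurable_funM.
  apply: measurable_funM; first exact: measurable_cst.
  apply: (measurableT_comp (@measurable_Lp R n)); apply: measurable_tscale.
  exact: measurable_snd.
apply: (measurableT_comp (@measurable_Cp R n)); apply: measurable_tscale.
exact: measurable_fst.
Qed.

Let integrable_window e : 0 < e -> LL.-integrable setT (EFin \o window e).
Proof.
move=> e0.
have i1 : L.-integrable setT (EFin \o (fun y => Cp (tscale e y))) by exact: integrable_Cpe.
have i2 : L.-integrable setT (EFin \o (fun q => 2 ^+ n * Lp (tscale e q))).
  exact: (integrableZl measurableT (2 ^+ n) (integrable_Lpe n e0)).
have := integrable_tensor i1 i2; congr (integrable _ _ _).
by apply/funext => z; rewrite /window/= mulrC.
Qed.

Let ker : LL.-integrable setT (EFin \o (fun z => Cp z.1 * Lp z.2)).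
Proof. exact: (integrable_tensor (integrable_Cp R n) (integrable_Lp R n)). Qed.

Let mh := measurable_hfun k mf.
Let hb := hfun_bound k mf f2.

Let avg (e : R) (v om : X) := \int[LL]_z
  (Cp z.1 * Lp z.2 * h (tadd v (tscale (e / k) z.1), tadd om (tscale (e / k) z.2))).

Let mavg e v om : measurable_fun setT (fun z : X * X =>
  Cp z.1 * Lp z.2 * h (tadd v (tscale (e / k) z.1), tadd om (tscale (e / k) z.2))).
Proof.
apply: measurable_funM.
  apply: measurable_funM.
    exact: (measurableT_comp (@measurable_Cp R n) measurable_fst).
  exact: (measurableT_comp (@measurable_Lp R n) measurable_snd).
apply: (measurableT_comp mh); apply: measurable_fun_pair.
  exact: (measurableT_comp (measurable_tadd_tscale v (e / k)) measurable_fst).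
exact: (measurableT_comp (measurable_tadd_tscale om (e / k)) measurable_snd).
Qed.

Let avg_dom e v om z :
  `|Cp z.1 * Lp z.2 * h (tadd v (tscale (e / k) z.1), tadd om (tscale (e / k) z.2))|
  <= sqnorm f ^+ 2 * (Cp z.1 * Lp z.2).
Proof.
rewrite normrM mulrC (ger0_norm (mulr_ge0 (Cp_ge0 _) (Lp_ge0 _))).
by rewrite ler_wpM2r ?mulr_ge0 ?Cp_ge0 ?Lp_ge0//; exact: hb.
Qed.

Let ker_dom : LL.-integrable setT (EFin \o (fun z => sqnorm f ^+ 2 * (Cp z.1 * Lp z.2))).
Proof. exact: (integrableZl measurableT (sqnorm f ^+ 2) ker). Qed.

Let iavg e v om : LL.-integrable setT (EFin \o (fun z : X * X =>
  Cp z.1 * Lp z.2 * h (tadd v (tscale (e / k) z.1), tadd om (tscale (e / k) z.2)))).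
Proof.
apply: (le_integrable measurableT _ _ ker_dom); first exact/measurable_EFinP.
by move=> z _; rewrite /= lee_fin; apply: le_trans (avg_dom _ _ _ _) (ler_norm _).
Qed.

Let int_ker : \int[LL]_z (Cp z.1 * Lp z.2) = pi ^+ n.
Proof.
rewrite -(Rintegral12_prod (F := fun z => Cp z.1 * Lp z.2))//=.
have eL : \int[L]_s Lp s = 1.
  rewrite /Rintegral (integral_tprod n (measurable_laplace (R:=R)) (@laplace_ge0 R) (integral_laplace R)).
  by rewrite /= expr1n.
have eC : \int[L]_s Cp s = pi ^+ n.
  by rewrite /Rintegral (integral_tprod n (measurable_cauchy (R:=R)) (@cauchy_ge0 R) (integral_cauchy R)).
rewrite -eC; apply: eq_Rintegral => b _.
by rewrite RintegralZl ?eL ?mulr1//; exact: integrable_Lp.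
Qed.

Let integrand_meas e v om : measurable_fun setT (fun z : X * X =>
  h z * window e z * cos (k * (tdot z.2 v - tdot om z.1))).
Proof.
apply: measurable_funM; first exact: measurable_funM.
apply: (@measurableT_comp _ _ _ _ _ _ (@cos R)).
  by apply: continuous_measurable_fun; exact: continuous_cos.
apply: measurable_funM; first exact: measurable_cst.
apply: measurable_funB; apply: measurable_tdot; by [exact: measurable_fst|exact: measurable_snd|exact: measurable_cst].
Qed.

Let real_duality e v om : 0 < e ->
  \int[LL]_z (h z * window e z * cos (k * (tdot z.2 v - tdot om z.1))) =
  (2 / k) ^+ n * avg e v om.
Proof.
move=> e0.
pose G (z : X * X) := (h z * window e z)%:C%C * expi (k * (tdot z.2 v - tdot om z.1)).
have mE : cmeasurable (fun z : X * X => expi (k * (tdot z.2 v - tdot om z.1))).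
  apply: cmeasurable_expi; apply: measurable_funM; first exact: measurable_cst.
  apply: measurable_funB; apply: measurable_tdot; by [exact: measurable_fst|exact: measurable_snd|exact: measurable_cst].
have iG : cintegrable LL G.
  apply: (le_cintegrable _ _ (integrableZl measurableT (sqnorm f ^+ 2) (integrable_window e0))).
    by apply: cmeasurableM => //; apply: cmeasurable_real; exact: measurable_funM.
  move=> z; rewrite ComplexField.Normc.normcM normc_expi mulr1 /= expr0n addr0 sqrtr_sqr normrM.
  by rewrite (ger0_norm (window_ge0 _ _)) ler_wpM2r.
have := regularized_duality k0 mf f2 v om e0.
rewrite [LHS](Cintegral12_prod (F := G))//.
pose H (z : X * X) := (Cp z.1 * Lp z.2 * h (tadd v (tscale (e / k) z.1), tadd om (tscale (e / k) z.2)))%:C%C.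
rewrite [X in _ = _ * X](Cintegral12_prod (F := H)); last first.
  by split => //=; [exact: iavg|exact: integrable0].
rewrite (Cintegral_real LL (fun z => Cp z.1 * Lp z.2 * h (tadd v (tscale (e / k) z.1), tadd om (tscale (e / k) z.2)))).
rewrite -rmorphM => GE.
transitivity (complex.Re (Cintegral LL G)); last by rewrite GE.
by apply: eq_Rintegral => z _; rewrite /G expiE /= mul0r subr0.
Qed.

(** The averaging kernel concentrates at [(v, om)], where [h] is continuous, and its mass is pi^n:
    each Cauchy factor has mass pi, each Laplace factor mass 1. *)
Let avg_cvg v om : avg (eps j) v om @[j --> \oo] --> pi ^+ n * h (v, om).
Proof.
rewrite -int_ker -RintegralZr//.
apply: (Rdominated_cvg _ _ _ ker_dom) => //.
- apply: measurable_funM; last exact: measurable_cst.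
  by have /measurable_EFinP := measurable_int _ ker.
- move=> z; apply: cvgMl_tmp.
  have sc (a b : X) i : tnth (tadd a (tscale (eps j / k) b)) i @[j --> \oo] --> tnth a i.
    under eq_fun do rewrite !tupE.
    have e0 : eps j / k @[j --> \oo] --> 0 by rewrite -(mul0r k^-1); apply: cvgMr_tmp.
    have {}e0 : eps j / k * tnth b i @[j --> \oo] --> 0.
      by rewrite -(mul0r (tnth b i)); apply: cvgMr_tmp.
    by have := cvgD (cvg_cst (tnth a i)) e0; rewrite addr0; apply.
  have c1 := wigr_cvg (k := k) mf f2 (sc v z.1) (sc om z.2).
  have scN (a b : X) i : tnth (tneg (tadd a (tscale (eps j / k) b))) i @[j --> \oo] --> tnth (tneg a) i.
    by under eq_fun do rewrite tnth_tneg; rewrite tnth_tneg; apply: cvgN; exact: sc.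
  have c2 := wigr_cvg (k := k) mf f2 (scN v z.1) (scN om z.2).
  exact: (cvgM c1 c2).
Qed.

Hypothesis hneg : (\int[LL]_z (Num.max (- h z) 0)%:E < +oo)%E.

Let hm z := Num.max (- h z) 0.
Let hp z := Num.max (h z) 0.

Let hm0 z : 0 <= hm z. Proof. by rewrite le_max lexx orbT. Qed.
Let hp0 z : 0 <= hp z. Proof. by rewrite le_max lexx orbT. Qed.

Let hE z : h z = hp z - hm z.
Proof. by rewrite /hp /hm /Num.max; case: ltP => ?; case: ltP => ?; lra. Qed.

Let mhm : measurable_fun setT hm.
Proof.
by apply: measurable_maxr; [exact: measurableT_comp|exact: measurable_cst].
Qed.

Let mhp : measurable_fun setT hp.
Proof. by apply: measurable_maxr => //; exact: measurable_cst. Qed.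

Let ihm : LL.-integrable setT (EFin \o hm).
Proof.
apply/integrableP; split; first exact/measurable_EFinP.
by under eq_integral do rewrite /= ger0_norm//.
Qed.

(** At v = om = 0 the windowed duality bounds the integral of [h] times the window independently of
    the window. Adding the finite negative part bounds the windowed positive part, and Fatou removes
    the window. *)
Let ihp : LL.-integrable setT (EFin \o hp).
Proof.
apply/integrableP; split; first exact/measurable_EFinP.
under eq_integral do rewrite /= ger0_norm//.
pose C := (2 / k) ^+ n * (sqnorm f ^+ 2 * pi ^+ n) + \int[LL]_z hm z.
apply: le_lt_trans (ltry C).
apply: (fatou_bound (u := fun j z => hp z * window (eps j) z)).
- by move=> j; exact: measurable_funM.
- by move=> j z; rewrite mulr_ge0.
- by move=> z; have := cvgMl_tmp (a := hp z) (window_cvg z); rewrite mulr1; apply.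
move=> j.
have iwh (g : X * X -> R) : measurable_fun setT g -> (forall z, `|g z| <= sqnorm f ^+ 2) ->
    LL.-integrable setT (EFin \o (fun z => g z * window (eps j) z)).
  move=> mg gb; apply: (le_integrable measurableT _ _
    (integrableZl measurableT (sqnorm f ^+ 2) (integrable_window (eps0 j)))).
    by apply/measurable_EFinP; exact: measurable_funM.
  move=> z _; rewrite /= lee_fin normrM.
  apply: le_trans (ler_norm _); rewrite (ger0_norm (window_ge0 _ _)).
  by rewrite ler_wpM2r.
have hmb z : `|hm z| <= sqnorm f ^+ 2.
  rewrite ger0_norm// /hm ge_max sqr_ge0 andbT.
  by apply: le_trans (hb z); rewrite -normrN ler_norm.
have hpb z : `|hp z| <= sqnorm f ^+ 2.
  rewrite ger0_norm// /hp ge_max sqr_ge0 andbT.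
  by apply: le_trans (hb z); rewrite ler_norm.
rewrite -(fineK (integrable_fin_num measurableT (iwh hp mhp hpb))) lee_fin.
rewrite -[leLHS]/(\int[LL]_z (hp z * window (eps j) z)).
have -> : \int[LL]_z (hp z * window (eps j) z) =
    \int[LL]_z (h z * window (eps j) z) + \int[LL]_z (hm z * window (eps j) z).
  rewrite -RintegralD//; [|exact: iwh|exact: iwh].
  by apply: eq_Rintegral => z _; rewrite -mulrDl hE subrK.
rewrite /C; apply: lerD.
  have := real_duality (@tzero R n) (@tzero R n) (eps0 j).
  have -> : \int[LL]_z (h z * window (eps j) z *
      cos (k * (tdot z.2 (@tzero R n) - tdot (@tzero R n) z.1))) =
      \int[LL]_z (h z * window (eps j) z).
    apply: eq_Rintegral => z _.
    rewrite (_ : tdot z.2 _ - tdot _ z.1 = 0) ?mulr0 ?cos0 ?mulr1//.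
    by rewrite /tdot !big1 ?subrr// => i _; rewrite tnth_tzero ?mul0r ?mulr0.
  move=> ->; apply: ler_wpM2l; first by rewrite exprn_ge0// divr_ge0// ltW.
  apply: le_trans (ler_norm _) _.
  rewrite -int_ker -RintegralZl//.
  exact: (ler_norm_Rintegral_dom (mavg _ _ _) ker_dom (avg_dom _ _ _)).
apply: le_Rintegral => //; first exact: iwh.
by move=> z _; rewrite ler_piMr.
Qed.

Lemma integrable_hfun : LL.-integrable setT (EFin \o h).
Proof.
have := integrableB measurableT ihp ihm; congr (integrable _ _ _).
by apply/funext => z; rewrite /= hE.
Qed.

(** Limit of the real part of the windowed identity: dominated convergence applies on the left
    because [h] is now integrable, and the right side concentrates. The constant inverts (2 / k)^n
    pi^n. *)
Lemma hfun_self_dual v om : h (v, om) = (k / (2 * pi)) ^+ n *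
  \int[LL]_z (h z * cos (k * (tdot z.2 v - tdot om z.1))).
Proof.
have c1 : \int[LL]_z (h z * window (eps j) z * cos (k * (tdot z.2 v - tdot om z.1)))
    @[j --> \oo] --> \int[LL]_z (h z * cos (k * (tdot z.2 v - tdot om z.1))).
  apply: (Rdominated_cvg _ _ _ (integrable_abse integrable_hfun)) => //.
  - apply: measurable_funM => //.
    apply: (@measurableT_comp _ _ _ _ _ _ (@cos R)).
      by apply: continuous_measurable_fun; exact: continuous_cos.
    apply: measurable_funM; first exact: measurable_cst.
    apply: measurable_funB; apply: measurable_tdot; by [exact: measurable_fst|exact: measurable_snd|exact: measurable_cst].
  - move=> z; apply: cvgMr_tmp.
    by have := cvgMl_tmp (a := h z) (window_cvg z); rewrite mulr1; apply.
  - move=> j z; set c := cos _.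
    have c1 : `|c| <= 1 by rewrite ler_norml cos_geN1 cos_le1.
    have w1 : `|window (eps j) z| <= 1 by rewrite ger0_norm.
    rewrite -mulrA normrM; apply: ler_piMr => //.
    by rewrite normrM; apply: mulr_ile1.
have c2 : (2 / k) ^+ n * avg (eps j) v om @[j --> \oo] --> (2 / k) ^+ n * (pi ^+ n * h (v, om)).
  exact: cvgMl_tmp.
have : \int[LL]_z (h z * cos (k * (tdot z.2 v - tdot om z.1))) =
    (2 / k) ^+ n * (pi ^+ n * h (v, om)).
  have e : (fun j => \int[LL]_z (h z * window (eps j) z * cos (k * (tdot z.2 v - tdot om z.1)))) =
      (fun j => (2 / k) ^+ n * avg (eps j) v om) by apply/funext => j; exact: real_duality.
  rewrite e in c1; exact: (cvg_unique _ c1 c2).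
have p0 : pi != 0 :> R by rewrite gt_eqF// pi_gt0.
have kn0 : k != 0 by rewrite gt_eqF.
have e1 (p : R) : p != 0 -> k / (2 * p) * (2 / k) * p = 1.
  by move=> pn0; field; rewrite kn0 pn0.
by move=> ->; rewrite mulrA -exprMn mulrA -exprMn e1// expr1n mul1r.
Qed.

End self_duality.

(** * Propagation of zeros *)

Section phase_space.
Variables (R : realType) (n : nat).
Local Notation X := (n.-tuple R).
Local Notation L := (lebn R n).
Local Notation LL := (L \x L)%E.
Implicit Types z m : X * X.

Definition zadd m z : X * X := (tadd m.1 z.1, tadd m.2 z.2).
Definition zscale (c : R) z : X * X := (tscale c z.1, tscale c z.2).

Lemma ge0_integral_zisom m (c : R) (G : X * X -> \bar R) : `|c| = 1 ->
  measurable_fun setT G -> (forall z, 0 <= G z)%E ->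
  (\int[LL]_z G (zadd m (zscale c z)) = \int[LL]_z G z)%E.
Proof.
move=> c1 mG G0; have c0 : c != 0 by rewrite -normr_eq0 c1 oner_eq0.
have mz : measurable_fun setT (fun z => zadd m (zscale c z)).
  apply: measurable_fun_pair.
    exact: (measurableT_comp (measurable_tadd_tscale m.1 c) measurable_fst).
  exact: (measurableT_comp (measurable_tadd_tscale m.2 c) measurable_snd).
rewrite !fubini_tonelli1//; last exact: (measurableT_comp mG mz).
rewrite /fubini_F.
have inner x : (\int[L]_y G (zadd m (zscale c (x, y))) =
    \int[L]_y G (tadd m.1 (tscale c x), y))%E.
  have mGx : measurable_fun setT (fun y => G (tadd m.1 (tscale c x), y)).
    exact: (measurableT_comp mG (measurable_pair1 _)).
  have := ge0_integral_lebn_affine m.2 c0 mGx (fun=> G0 _).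
  by rewrite c1 expr1n invr1 mul1e.
under eq_integral do rewrite inner.
have mF : measurable_fun setT (fun x => \int[L]_y G (x, y))%E.
  exact: (@measurable_fun_fubini_tonelli_F _ _ _ _ _ L G).
have := ge0_integral_lebn_affine m.1 c0 mF (fun=> integral_ge0 _ (fun _ _ => G0 _)).
by rewrite c1 expr1n invr1 mul1e.
Qed.

End phase_space.

(** * Phase-space translations *)

Section covariance.
Variables (R : realType) (n : nat) (k : R).
Local Notation X := (n.-tuple R).
Local Notation L := (lebn R n).
Local Notation normc := ComplexField.Normc.normc.
Variables (f : X -> R[i]) (m : X * X).
Hypothesis mf : cmeasurable f.
Hypothesis f2 : L.-integrable setT (fun t => (normc (f t) ^+ 2)%:E).

(** The phase-space displacement that moves [m] to the origin, with k / 4 = 1 / hbar. The phase is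
    doubled in the autocorrelation, which gives the k / 2 of [wig]. *)
Definition displaced (s : X) : R[i] :=
  f (tadd m.1 s) * expi (- (k / 4 * tdot m.2 s)).

Lemma cmeasurable_displaced : cmeasurable displaced.
Proof.
apply: cmeasurableM.
  by apply: (cmeasurable_comp mf); apply: measurable_tadd => //; exact: measurable_cst.
by apply: measurable_phase => //; exact: measurable_cst.
Qed.

Lemma integrable_displaced : L.-integrable setT (fun t => (normc (displaced t) ^+ 2)%:E).
Proof.
have := integrable_lebn_affine (F := fun t => normc (f t) ^+ 2) m.1 (oner_neq0 R) f2.
congr (integrable _ _ _); apply/funext => t.
by rewrite /displaced ComplexField.Normc.normcM normc_expi mulr1 tscale1.
Qed.

Lemma wigr_displaced z : wigr k displaced z = wigr k f (zadd m z).
Proof.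
rewrite /wigr /wig; congr (complex.Re _); apply: eq_Cintegral => s /=.
rewrite /autocorr /displaced.
have -> : tadd m.1 (tadd z.1 s) = tadd (tadd m.1 z.1) s.
  by apply: eq_from_tnth => i; rewrite !tupE addrA.
have -> : tadd m.1 (tadd z.1 (tneg s)) = tadd (tadd m.1 z.1) (tneg s).
  by apply: eq_from_tnth => i; rewrite !tupE addrA.
have conjM (a b : R[i]) : (a * b)^*%C = a^*%C * b^*%C by exact: rmorphM.
rewrite conjM -expiN.
rewrite [X in _ = _ * expi X](_ : _ = - (k / 4 * tdot m.2 (tadd z.1 s)) +
   - - (k / 4 * tdot m.2 (tadd z.1 (tneg s))) + - (k / 2 * tdot z.2 s)).
  by rewrite !expiD; ring.
by rewrite tdotDl !tdotDr tdotNr; field.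
Qed.

Lemma hfun_displaced z : hfun k displaced z =
  wigr k f (zadd m z) * wigr k f (zadd m (zscale (-1) z)).
Proof. by rewrite /hfun !wigr_displaced. Qed.

End covariance.

Section negativity.
Variables (R : realType) (n : nat) (k : R).
Hypothesis k0 : 0 < k.
Local Notation X := (n.+1.-tuple R).
Local Notation L := (lebn R n.+1).
Local Notation LL := (L \x L)%E.
Local Notation normc := ComplexField.Normc.normc.
Variables (f : X -> R[i]).
Hypothesis mf : cmeasurable f.
Hypothesis f2 : L.-integrable setT (fun t => (normc (f t) ^+ 2)%:E).
Local Notation w := (wigr k f).
Let C : R := (k / (2 * pi)) ^+ n.+1.

(** The measure of the negativity set enters only through a majorant [G] of its indicator, whose
    integral [I] is explicit in the applications. *)
Variables (G : X * X -> R) (I : R).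
Hypothesis mG : measurable_fun setT G.
Hypothesis G0 : forall z, 0 <= G z.
Hypothesis GI : (\int[LL]_z (G z)%:E)%E = I%:E.
Hypothesis wG : forall z, w z < 0 -> 1 <= G z.
Hypothesis CI : 4 * C * I < 1.

Let h m := hfun k (displaced k f m).
Let hE m z : h m z = w (zadd m z) * w (zadd m (zscale (-1) z)) := hfun_displaced k f m z.

Let mdf m := cmeasurable_displaced k m mf.
Let idf m := integrable_displaced k m f2.
Let mh m : measurable_fun setT (h m) := measurable_hfun k (mdf m).

Let C0 : 0 < C.
Proof. by rewrite exprn_gt0// divr_gt0// mulr_gt0// pi_gt0. Qed.

(** A negative product has a negative factor, so at least one of m + z and m - z lies where [G] is
    at least 1. *)
Let hminus_le m S z : (forall z, `|h m z| <= S) ->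
  Num.max (- h m z) 0 <= S * (G (zadd m (zscale 1 z)) + G (zadd m (zscale (-1) z))).
Proof.
move=> hS; have S0 : 0 <= S by apply: le_trans (hS z).
have z1 : zscale 1 z = z by case: z => a b; rewrite /zscale/= !tscale1.
rewrite ge_max mulr_ge0 ?addr_ge0// andbT z1.
have [hz|hz] := leP 0 (h m z).
  by apply: (@le_trans _ _ 0); rewrite ?oppr_le0// mulr_ge0 ?addr_ge0.
apply: le_trans (_ : S <= _).
  by apply: le_trans (hS z); rewrite -normrN ler_norm.
rewrite ler_peMr//.
have [wz|wz] := ltP (w (zadd m z)) 0; first by rewrite (le_trans (wG wz))// lerDl.
have [wz'|wz'] := ltP (w (zadd m (zscale (-1) z))) 0.
  by rewrite (le_trans (wG wz'))// lerDr.
by move: hz; rewrite hE ltNge mulr_ge0.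
Qed.

Let int_hminus m S : (forall z, `|h m z| <= S) ->
  (\int[LL]_z (Num.max (- h m z) 0)%:E <= (2 * S * I)%:E)%E.
Proof.
move=> hS; have S0 : 0 <= S by apply: le_trans (hS (tzero _ _, tzero _ _)).
have mGz c : measurable_fun setT (fun z => (G (zadd m (zscale c z)))%:E).
  apply/measurable_EFinP; apply: (measurableT_comp mG); apply: measurable_fun_pair.
    exact: (measurableT_comp (measurable_tadd_tscale m.1 c) measurable_fst).
  exact: (measurableT_comp (measurable_tadd_tscale m.2 c) measurable_snd).
have Ge0 z : (0 <= (G z)%:E)%E by rewrite lee_fin.
have mGe : measurable_fun setT (EFin \o G) by exact/measurable_EFinP.
apply: (@le_trans _ _ (\int[LL]_z (S%:E * ((G (zadd m (zscale 1 z)))%:E + (G (zadd m (zscale (-1) z)))%:E)))%E).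
  apply: ge0_le_integral => //.
  - by move=> z _; rewrite lee_fin le_max lexx orbT.
  - apply/measurable_EFinP; apply: measurable_maxr; last exact: measurable_cst.
    exact: (measurableT_comp _ (mh m)).
  - by apply: measurable_funeM; exact: emeasurable_funD.
  - by move=> z _; have := hminus_le z hS; rewrite -lee_fin.
rewrite ge0_integralZl; last 4 first.
- by [].
- exact: emeasurable_funD.
- by move=> z _; rewrite adde_ge0.
- by rewrite lee_fin.
rewrite ge0_integralD//.
rewrite (ge0_integral_zisom m (G := EFin \o G)) ?normr1//.
rewrite (ge0_integral_zisom m (G := EFin \o G)) ?normrN ?normr1//.
rewrite [X in (_ * (X + X))%E]GI -EFinD -EFinM lee_fin.
by rewrite (_ : S * (I + I) = 2 * S * I)//; ring.
Qed.

Let hneg_fin m : (\int[LL]_z (Num.max (- h m z) 0)%:E < +oo)%E.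
Proof. exact: le_lt_trans (int_hminus (hfun_bound k (mdf m) (idf m))) (ltry _). Qed.

Let ih m : LL.-integrable setT (EFin \o h m) := integrable_hfun k0 (mdf m) (idf m) (hneg_fin m).
Let dual m v om := hfun_self_dual k0 (mdf m) (idf m) (hneg_fin m) v om.

Let z00 : X * X := (tzero R n.+1, tzero R n.+1).

Let zadd0 m : zadd m z00 = m.
Proof.
by case: m => a b; rewrite /zadd/=; congr pair; apply: eq_from_tnth => i; rewrite !tupE addr0.
Qed.

Let zscale0 c : zscale c z00 = z00.
Proof. by rewrite /zscale/=; congr pair; apply: eq_from_tnth => i; rewrite !tupE mulr0. Qed.

(** Self-duality at the origin, where the reflected product is a square and the cosine is 1. *)
Let int_h m : w m ^+ 2 = C * \int[LL]_z h m z.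
Proof.
have := dual m (tzero _ _) (tzero _ _).
rewrite -/(h m) hE zscale0 !zadd0 -expr2 => ->; congr (_ * _).
apply: eq_Rintegral => z _.
rewrite (_ : tdot z.2 _ - tdot _ z.1 = 0) ?mulr0 ?cos0 ?mulr1//.
by rewrite /tdot !big1 ?subrr// => i _; rewrite tnth_tzero ?mul0r ?mulr0.
Qed.

Let sup_h m z : `|h m z| <= C * \int[LL]_z `|h m z|.
Proof.
case: z => v om; rewrite /h dual normrM (gtr0_norm C0) ler_pM2l// -/(h m).
have mc : measurable_fun setT (fun z : X * X => cos (k * (tdot z.2 v - tdot om z.1))).
  apply: (@measurableT_comp _ _ _ _ _ _ (@cos R)).
    by apply: continuous_measurable_fun; exact: continuous_cos.
  apply: measurable_funM; first exact: measurable_cst.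
  apply: measurable_funB; apply: measurable_tdot; by [exact: measurable_fst|exact: measurable_snd|exact: measurable_cst].
apply: (ler_norm_Rintegral_dom _ (integrable_abse (ih m))); first exact: measurable_funM.
by move=> z; rewrite normrM ler_piMr// ler_norml cos_geN1 cos_le1.
Qed.

(* If [w m = 0] then [h m] has integral zero, so that its L1 norm is twice the integral
   of its negative part, which is controlled by the L1 norm itself. *)
Lemma zero_propagation m z : w m = 0 -> w (zadd m z) * w (zadd m (zscale (-1) z)) = 0.
Proof.
move=> wm; rewrite -hE; set S := C * \int[LL]_z `|h m z|.
have Ih : \int[LL]_z h m z = 0.
  by have /esym/eqP := int_h m; rewrite wm expr0n mulf_eq0 gt_eqF//= => /eqP.
have im : LL.-integrable setT (EFin \o (fun z => Num.max (- h m z) 0)).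
  apply/integrableP; split.
    apply/measurable_EFinP; apply: measurable_maxr; last exact: measurable_cst.
    exact: (measurableT_comp _ (mh m)).
  under eq_integral do rewrite /= ger0_norm ?le_max ?lexx ?orbT//.
  exact: hneg_fin.
(* Since |h| = h + 2 h^- and [h m] has integral 0, the norm is twice the integral of h^-, itself at
   most 2 S I. With [S] equal to [C] times the norm, this is where the constant 4 C I comes from. *)
have abs_le : \int[LL]_z `|h m z| <= 4 * S * I.
  have -> : \int[LL]_z `|h m z| = \int[LL]_z h m z + 2 * \int[LL]_z (Num.max (- h m z) 0).
    rewrite -RintegralZl// -RintegralD//; last exact: (integrableZl measurableT 2 im).
    apply: eq_Rintegral => y _; rewrite /Num.max.
    by have [hy|hy] := ltP (- h m y) 0; [rewrite gtr0_norm ?oppr_lt0// -1?oppr_lt0//|rewrite ler0_norm -1?oppr_ge0//]; lra.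
  rewrite Ih add0r (_ : 4 * S * I = 2 * (2 * S * I)); last by ring.
  rewrite ler_pM2l// -lee_fin /Rintegral fineK; last exact: (integrable_fin_num measurableT im).
  exact: int_hminus (sup_h m).
have A0 : 0 <= \int[LL]_z `|h m z| by apply: Rintegral_ge0.
have A00 : \int[LL]_z `|h m z| = 0.
  apply/eqP; rewrite eq_le A0 andbT.
  have : (1 - 4 * C * I) * \int[LL]_z `|h m z| <= 0.
    by rewrite mulrBl mul1r subr_le0 (_ : 4 * C * I * _ = 4 * S * I)// /S; ring.
  by rewrite pmulr_rle0// subr_gt0.
by apply/eqP; have := sup_h m z; rewrite A00 mulr0 normr_le0.
Qed.

Variables (m0 : X * X) (z0 : X * X) (R0 : R).
Hypothesis wm0 : w m0 < 0.
Hypothesis R00 : 0 < R0.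
Hypothesis wball : forall z i, w z < 0 ->
  `|tnth z.1 i - tnth z0.1 i| < R0 /\ `|tnth z.2 i - tnth z0.2 i| < R0.

Section line.
Variable q : X * X.
Let dir : X * X := zadd q (zscale (-1) m0).
Let line t : X * X := zadd m0 (zscale t dir).
Let phi t := w (line t).

Let line_refl a y : zadd (line a) (zscale y dir) = line (a + y) /\
  zadd (line a) (zscale (-1) (zscale y dir)) = line (a - y).
Proof.
by split; rewrite /line /zadd /zscale/=; congr pair; apply: eq_from_tnth => i; rewrite !tupE; ring.
Qed.

Let phi_refl a y : phi a = 0 -> phi (a + y) * phi (a - y) = 0.
Proof.
move=> pa; have := zero_propagation (zscale y dir) pa.
by have [-> ->] := line_refl a y.
Qed.

Let phi_cvg (u : nat -> R) t : u @ \oo --> t -> phi (u j) @[j --> \oo] --> phi t.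
Proof.
move=> ut; apply: (wigr_cvg (k := k) mf f2) => i;
  under eq_fun do rewrite !tupE; rewrite !tupE;
  apply: cvgD; [exact: cvg_cst|exact: cvgMr_tmp|exact: cvg_cst|exact: cvgMr_tmp].
Qed.

Let phi_cont : continuous phi.
Proof. by move=> t; apply/(@cvg_nbhsP _ R^o) => u; exact: phi_cvg. Qed.

Let phi0 : phi 0 < 0.
Proof.
rewrite /phi (_ : line 0 = m0)//; rewrite /line /zadd /zscale; case: (m0) => a b /=.
by congr pair; apply: eq_from_tnth => i; rewrite !tupE mul0r addr0.
Qed.

Let phi1 : phi 1 = w q.
Proof.
rewrite /phi (_ : line 1 = q)//; rewrite /line /dir /zadd /zscale; case: (q) => a b /=.
by congr pair; apply: eq_from_tnth => i; rewrite !tupE; ring.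
Qed.

Lemma wigr_nonpos : w q <= 0.
Proof.
rewrite leNgt; apply/negP => wq.
pose Z : set R := [set t | 0 <= t /\ phi t = 0].
have [c c01 pc] : exists2 c, c \in `[0, 1]%R & phi c = 0.
  apply: IVT => //; first exact: continuous_subspaceT.
  by rewrite phi1 min_l ?max_r ?(ltW phi0) ?(ltW wq)// ltW// (lt_trans phi0 wq).
have Zc : Z c by split => //; move: c01; rewrite in_itv/= => /andP[].
have Zlb : has_lbound Z by exists 0 => t [].
have Zinf : has_inf Z by split => //; exists c.
pose a := inf Z.
have a0 : 0 <= a by apply: lb_le_inf; [exists c|move=> t []].
(* The zeros form a closed set, so the infimum is itself a zero. *)
have pa : phi a = 0.
  apply/eqP; apply: contrapT => /negP pa.
  have : \forall t \near a, phi t != 0.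
    have := @phi_cont a; move/cvgrPdist_lt => /(_ `|phi a|); rewrite normr_gt0 => /(_ pa).
    apply: filterS => t; apply: contraTneq => ->.
    by rewrite subr0 ltxx.
  move=> [d /= d0 dP].
  have [t Zt ta] := inf_adherent d0 Zinf.
  have at_ : a <= t by exact: ge_inf.
  have := dP t; rewrite /= distrC ger0_norm ?subr_ge0// ltrBlDl => /(_ ta).
  by case: Zt => _ ->; rewrite eqxx.
have ap : 0 < a.
  rewrite lt_neqAle a0 andbT; apply/eqP => e.
  by have := phi0; rewrite [X in phi X]e pa ltxx.
have nz t : 0 <= t -> t < a -> phi t != 0.
  move=> t0 ta; apply/eqP => pt; have : a <= t by apply: ge_inf => //.
  by rewrite leNgt ta.
(* Zeros spread by doubling. For u in ]a, 2a], reflection in [a] sends u into [0, a[, which has no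
   zero. For u > 2a, u / 2 is already a zero and reflection in it sends u to 0, where [phi] is
   negative. *)
have Zall j u : a <= u -> u <= 2 ^+ j * a -> phi u = 0.
  elim: j u => [|j IHj] u au uj.
    by rewrite (_ : u = a)//; apply/eqP; rewrite eq_le au andbT -[leRHS]mul1r.
  have [u2|u2] := leP u (2 * a).
    have [->//|une] := eqVneq u a.
    have := phi_refl (u - a) pa; rewrite addrC subrK => /eqP.
    rewrite mulf_eq0 => /orP[/eqP//|/eqP pn].
    have lua : a < u by rewrite lt_neqAle eq_sym une.
    have := nz (a - (u - a)); rewrite pn eqxx => H.
    have : false by apply: H; rewrite ?gtrBl ?subr_gt0// subr_ge0 lerBlDr -mulr2n -mulr_natl.
    by [].
  have pu2 : phi (u / 2) = 0.
    apply: IHj; first by rewrite ler_pdivlMr// mulrC ltW.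
    by rewrite ler_pdivrMr// mulrC mulrA -exprS.
  have := phi_refl (u / 2) pu2; rewrite subrr -splitr => /eqP.
  by rewrite mulf_eq0 (lt_eqF phi0) orbF => /eqP.
have [j j1] : exists j, 1 <= 2 ^+ j * a.
  exists (Num.truncn a^-1).+1; rewrite -ler_pdivrMr// div1r.
  apply: le_trans (ltW (truncnS_gt _)) _; rewrite -natrX ler_nat.
  exact/ltnW/ltn_expl.
have ca : a <= 1.
  apply: (@le_trans _ _ c); first exact: ge_inf.
  by move: c01; rewrite in_itv/= => /andP[].
by move: wq; rewrite -phi1 (Zall j 1)// ltxx.
Qed.

End line.

(* Take [m] in the negativity set close to a supporting hyperplane [x_0 = s]: then [h m >= 0]
   lives in a thin slab, so its Fourier transform stays positive far along the conjugate
   momentum axis, where it should vanish. *)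
Lemma negativity_contradiction : False.
Proof.
pose E : set R := [set tnth z.1 ord0 | z in [set z | w z < 0]].
have En : E !=set0 by exists (tnth m0.1 ord0), m0.
have Eub : has_ubound E.
  exists (tnth z0.1 ord0 + R0) => _ [z wz <-].
  by have [+ _] := wball ord0 wz; rewrite ltr_distl => /andP[_ /ltW].
have Es : has_sup E by [].
(* Momenta in the negativity set are within [R0] of that of [z0], so adding 2 [R0] to a momentum
   leaves the set; this makes [h m] vanish at [(0, om)]. *)
pose t : R := 2 * R0.
have t0 : 0 < t by rewrite mulr_gt0.
have [d /= d0 dP] : \forall u \near (0 : R), 2^-1 < cos u.
  have := @continuous_cos R 0; rewrite /continuous_at cos0 => /cvgrPdist_lt /(_ 2^-1).
  rewrite invr_gt0 => /(_ (ltr0Sn _ _)); apply: filterS => u.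
  by rewrite ltr_distl => /andP[_]; lra.
(* On a slab of half-width [dl] the phase stays below d / 2, where the cosine exceeds 1/2. *)
pose dl := d / (2 * (k * t)).
have kt0 : 0 < k * t by exact: mulr_gt0.
have dl0 : 0 < dl by rewrite divr_gt0// mulr_gt0.
have [_ [m wm <-] ms] := sup_adherent dl0 Es.
have hm0 z : 0 <= h m z.
  by rewrite hE -mulrNN mulr_ge0// oppr_ge0 wigr_nonpos.
(* Both m + z and m - z are in the negativity set, so neither first coordinate exceeds the supremum,
   from which [m] is less than [dl] away. *)
have slab z : h m z != 0 -> `|tnth z.1 ord0| < dl.
  rewrite hE mulf_eq0 negb_or => /andP[w1 w2].
  have {}w1 : w (zadd m z) < 0 by rewrite lt_neqAle w1 wigr_nonpos.
  have {}w2 : w (zadd m (zscale (-1) z)) < 0 by rewrite lt_neqAle w2 wigr_nonpos.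
  have /= e1 : tnth (zadd m z).1 ord0 <= sup E by apply: ub_le_sup => //; exists (zadd m z).
  have /= e2 : tnth (zadd m (zscale (-1) z)).1 ord0 <= sup E.
    by apply: ub_le_sup => //; exists (zadd m (zscale (-1) z)).
  move: e1 e2; rewrite !tupE => e1 e2.
  by rewrite ltr_norml; apply/andP; split; lra.
pose om : X := [tuple if i == ord0 then t else 0 | i < n.+1].
have omdot (y : X) : tdot om y = t * tnth y ord0.
  rewrite /tdot big_ord_recl tnth_mktuple eqxx big1 ?addr0// => i _.
  by rewrite tnth_mktuple mul0r.
have far : h m (tzero R n.+1, om) = 0.
  rewrite hE; set zz := zadd m _.
  suff -> : w zz = 0 by rewrite mul0r.
  apply/eqP; rewrite eq_le wigr_nonpos/= leNgt; apply/negP => wz.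
  have [_ /=] := wball ord0 wz; have [_ /=] := wball ord0 wm.
  rewrite tnth_tadd tnth_mktuple eqxx !ltr_distl /t => /andP[a1 a2] /andP[a3 a4].
  by move: a1 a2 a3 a4; lra.
have := dual m (tzero _ _) om; rewrite -/(h m) far => /esym/eqP.
rewrite mulf_eq0 gt_eqF//= => /eqP Ic.
have Ipos : 0 < \int[LL]_z h m z.
  have : 0 < w m ^+ 2 by rewrite exprn_even_gt0//= lt_eqF.
  by rewrite int_h pmulr_rgt0.
(* The right side is 0 by duality at [(0, om)], while the slab makes it at least half of a positive
   integral. *)
have : 2^-1 * \int[LL]_z h m z <=
   \int[LL]_z (h m z * cos (k * (tdot z.2 (tzero R n.+1) - tdot om z.1))).
  rewrite -RintegralZl//; apply: le_Rintegral => //.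
  - exact: (integrableZl measurableT 2^-1 (ih m)).
  - apply: (le_integrable measurableT _ _ (ih m)).
      apply/measurable_EFinP; apply: measurable_funM => //.
      apply: (@measurableT_comp _ _ _ _ _ _ (@cos R)).
        by apply: continuous_measurable_fun; exact: continuous_cos.
      apply: measurable_funM; first exact: measurable_cst.
      apply: measurable_funB; apply: measurable_tdot; by [exact: measurable_fst|exact: measurable_snd|exact: measurable_cst].
    by move=> z _; rewrite /= lee_fin normrM ler_piMr// ler_norml cos_geN1 cos_le1.
  - move=> z _; have [->|hz] := eqVneq (h m z) 0; first by rewrite mulr0 mul0r.
    rewrite mulrC ler_wpM2l//; apply: ltW; apply: dP.
    rewrite /= sub0r normrN omdot.
    have -> : tdot z.2 (tzero R n.+1) = 0.
      by rewrite /tdot big1// => i _; rewrite tnth_tzero mulr0.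
    rewrite sub0r mulrN normrN mulrA normrM (gtr0_norm kt0).
    apply: lt_trans (_ : k * t * dl < _); first by rewrite ltr_pM2l// slab.
    have -> : k * t * dl = d / 2.
      by rewrite /dl; move: (k * t) kt0 => c c0; field; rewrite gt_eqF.
    by move: d0; lra.
by rewrite Ic; apply/negP; rewrite -ltNge mulr_gt0// invr_gt0.
Qed.

End negativity.

(** * The radius of the negativity set *)

Section wigner_link.
Variables (R : realType) (n : nat).
Local Notation X := (n.-tuple R).
Local Notation L := (lebn R n).
Local Notation normc := ComplexField.Normc.normc.

Lemma intRn_Rintegral (F : X -> R) : L.-integrable setT (EFin \o F) ->
  intRn F = \int[L]_t F t.
Proof.
move=> iF; have mF : measurable_fun setT F by have /measurable_EFinP := measurable_int _ iF.
rewrite /intRn !nnintRn_lebn; last 4 first.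
- apply/measurable_EFinP; apply: measurable_maxr; last exact: measurable_cst.
  exact: measurableT_comp.
- by move=> t; rewrite lee_fin le_max lexx orbT.
- by apply/measurable_EFinP; apply: measurable_maxr => //; exact: measurable_cst.
- by move=> t; rewrite lee_fin le_max lexx orbT.
rewrite /Rintegral [in RHS]integralE [RHS]fineB; last 2 first.
- by apply: integrable_pos_fin_num.
- by apply: integrable_neg_fin_num.
congr (fine _ - fine _); apply: eq_integral => t _.
  by rewrite funeposE/= -EFin_max.
by rewrite funenegE/= -EFin_max.
Qed.

Lemma cintRn_Cintegral (F : X -> R[i]) : cintegrable L F -> cintRn F = Cintegral L F.
Proof.
move=> [F1 F2]; rewrite /cintRn.
rewrite (intRn_Rintegral (F := fun t => complex.Re (F t)))//.
rewrite (intRn_Rintegral (F := fun t => complex.Im (F t)))//.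
by apply/eqP; rewrite eq_complex/= !(mul0r, mulr0, mul1r, subr0, addr0, add0r) !eqxx.
Qed.

Lemma L2Rn_integrable (f : X -> R[i]) : L2Rn f ->
  cmeasurable f /\ L.-integrable setT (fun t => (normc (f t) ^+ 2)%:E).
Proof.
move=> [m1 [m2 fin2]]; have mf : cmeasurable f by [].
split => //; apply/integrableP; split.
  by apply/measurable_EFinP; apply: measurable_funX; exact: measurable_normc.
move: fin2; rewrite nnintRn_lebn; last 2 first.
- by apply/measurable_EFinP; apply: measurable_funD; exact: measurable_funX.
- by move=> t; rewrite lee_fin addr_ge0// sqr_ge0.
apply: le_lt_trans; rewrite le_eqVlt; apply/orP; left; apply/eqP.
apply: eq_integral => t _.
by rewrite abse_EFin ger0_norm ?sqr_ge0// sqr_normc_Re_Im.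
Qed.

Lemma Wigner_wigr (hbar : R) (f : X -> R[i]) (z : X * X) : 0 < hbar -> L2Rn f ->
  Wigner hbar f z = (((pi * hbar) ^+ n)^-1 * wigr (4 / hbar) f z)%:C%C.
Proof.
move=> hb0 /L2Rn_integrable[mf f2]; case: z => x p; rewrite /Wigner.
set k := 4 / hbar.
pose Phi s := autocorr f x s * expi (- (k / 2 * tdot p s)).
have iPhi : cintegrable L Phi by exact: cintegrable_wig.
have h0 : (2^-1 : R) != 0 by rewrite invr_neq0.
have hb : hbar != 0 by rewrite gt_eqF.
have e : (fun tau => f (tadd x (tscale 2^-1 tau)) * (f (tadd x (tscale (- 2^-1) tau)))^*%C *
    expi (- (tdot p tau / hbar))) = fun tau => Phi (tadd (tzero R n) (tscale 2^-1 tau)).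
  apply/funext => tau; rewrite /Phi /autocorr.
  have -> : tadd (tzero R n) (tscale 2^-1 tau) = tscale 2^-1 tau.
    by apply: eq_from_tnth => i; rewrite !tupE add0r.
  have -> : tneg (tscale 2^-1 tau) = tscale (- 2^-1) tau.
    by apply: eq_from_tnth => i; rewrite !tupE; ring.
  by congr (_ * expi _); rewrite tdotZr /k; field.
rewrite e cintRn_Cintegral; last exact: cintegrable_lebn_affine.
rewrite Cintegral_lebn_affine// -/(wig k f x p) (wig_real k mf f2) !mulrA -!rmorphM/=.
congr (_ * _)%:C%C; rewrite gtr0_norm ?invr_gt0// exprVn invrK.
have -> : 2 * pi * hbar = 2 * (pi * hbar) by rewrite mulrA.
by rewrite exprMn invfM mulrAC mulVf ?mul1r// expf_neq0.
Qed.

(** The order of [R[i]] compares real parts only between numbers with equal imaginary parts, so the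
    reality of the Wigner function is needed here. *)
Lemma Wigner_lt0 (hbar : R) (f : X -> R[i]) (z : X * X) : 0 < hbar -> L2Rn f ->
  (Wigner hbar f z < 0) = (wigr (4 / hbar) f z < 0).
Proof.
move=> hb0 f2; rewrite Wigner_wigr// ltcE/= eqxx/= pmulr_rlt0//.
by rewrite invr_gt0 exprn_gt0// mulr_gt0// pi_gt0.
Qed.

End wigner_link.

(** Over a single point the Wigner function is the squared modulus of [f], so the negativity set is
    empty. *)
Lemma wigr_dim0_ge0 (R : realType) (k : R) (f : 0.-tuple R -> R[i]) z :
  L2Rn f -> 0 <= wigr k f z.
Proof.
move=> /L2Rn_integrable[mf f2]; rewrite /wigr /wig Cintegral_lebn0; last first.
  exact: (cintegrable_measurable (cintegrable_wig k mf f2 z.1 z.2)).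
rewrite /tdot big_ord0 mulr0 oppr0 expiE cos0 sin0 mulr1 /autocorr.
have -> : tadd z.1 (tneg [tuple]) = tadd z.1 [tuple] by apply: eq_from_tnth => -[].
by case: (f _) => a b /=; rewrite mulrN opprK addr_ge0// -expr2 sqr_ge0.
Qed.

(** * Product majorants on phase space *)

Section majorants.
Variables (R : realType) (n : nat).
Local Notation X := (n.-tuple R).
Local Notation L := (lebn R n).
Local Notation LL := (L \x L)%E.
Local Notation leb := (@lebesgue_measure R).
Local Notation mR := (measurableTypeR R).

(** One form for both majorants: the indicator of a square and a Gaussian are products over the
    coordinates of z - z0, so their integrals are powers of a one-dimensional one. *)
Definition product_bump (c : R) (phi : R -> R) (z0 z : X * X) : R :=
  c * (tprod phi (tadd (tneg z0.1) z.1) * tprod phi (tadd (tneg z0.2) z.2)).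

Variables (c : R) (phi : R -> R) (J : R) (z0 : X * X).
Hypothesis c0 : 0 <= c.
Hypothesis mphi : measurable_fun [set: mR] phi.
Hypothesis phi0 : forall x, 0 <= phi x.
Hypothesis phiJ : (\int[leb]_x (phi x)%:E = J%:E)%E.

Lemma product_bump_ge0 z : 0 <= product_bump c phi z0 z.
Proof. by rewrite mulr_ge0// mulr_ge0// tprod_ge0. Qed.

Lemma measurable_product_bump : measurable_fun setT (product_bump c phi z0).
Proof.
apply: measurable_funM; first exact: measurable_cst.
have mt v : measurable_fun setT (fun t : X => tprod phi (tadd v t)).
  by apply: (measurable_translate v (F := tprod phi)); exact: measurable_tprod.
apply: measurable_funM.
  exact: (measurableT_comp (mt (tneg z0.1)) measurable_fst).
exact: (measurableT_comp (mt (tneg z0.2)) measurable_snd).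
Qed.

Lemma integral_product_bump :
  (\int[LL]_z (product_bump c phi z0 z)%:E = (c * (J ^+ n * J ^+ n))%:E)%E.
Proof.
have J0 : 0 <= J by rewrite -lee_fin -phiJ; apply: integral_ge0 => x _; rewrite lee_fin.
have mt v : measurable_fun setT (fun t : X => (tprod phi (tadd v t))%:E).
  by apply/measurable_EFinP; apply: (measurable_translate v (F := tprod phi)); exact: measurable_tprod.
have t0 v (t : X) : (0 <= (tprod phi (tadd v t))%:E)%E by rewrite lee_fin tprod_ge0.
have it v : (\int[L]_t (tprod phi (tadd v t))%:E = (J ^+ n)%:E)%E.
  rewrite (ge0_integral_lebn_translate v (F := fun t => (tprod phi t)%:E)).
  - exact: integral_tprod.
  - by apply/measurable_EFinP; exact: measurable_tprod.
  - by move=> t; rewrite lee_fin tprod_ge0.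
rewrite fubini_tonelli1; last 2 first.
- by apply/measurable_EFinP; exact: measurable_product_bump.
- by move=> z; rewrite lee_fin product_bump_ge0.
rewrite /fubini_F.
transitivity (\int[L]_x ((c * J ^+ n)%:E * (tprod phi (tadd (tneg z0.1) x))%:E))%E.
  apply: eq_integral => x _.
  transitivity (\int[L]_y ((c * tprod phi (tadd (tneg z0.1) x))%:E *
      (tprod phi (tadd (tneg z0.2) y))%:E))%E.
    by apply: eq_integral => y _; rewrite /product_bump/= -EFinM mulrA.
  rewrite ge0_integralZl//; last by rewrite lee_fin mulr_ge0// tprod_ge0.
  by rewrite it -!EFinM mulrAC.
rewrite ge0_integralZl//; last by rewrite lee_fin mulr_ge0// exprn_ge0.
by rewrite it -EFinM mulrA.
Qed.

End majorants.

Section ball_estimates.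
Variable R : realType.
Local Notation leb := (@lebesgue_measure R).
Local Notation mR := (measurableTypeR R).

Lemma euclid_ball_sum n (z0 z : n.-tuple R * n.-tuple R) (r : R) : 0 < r ->
  euclid_ball z0 r z -> \sum_(i < n) (tnth z.1 i - tnth z0.1 i) ^+ 2
    + \sum_(i < n) (tnth z.2 i - tnth z0.2 i) ^+ 2 < r ^+ 2.
Proof.
move=> r0; rewrite /euclid_ball/= /dist2n; set S := _ + _ => Sr.
have S0 : 0 <= S by rewrite addr_ge0// sumr_ge0// => i _; rewrite sqr_ge0.
by rewrite -(sqr_sqrtr S0) ltr_pXn2r// ?nnegrE ?sqrtr_ge0// ltW.
Qed.

Lemma euclid_ball_coord n (z0 z : n.-tuple R * n.-tuple R) (r : R) i : 0 < r ->
  euclid_ball z0 r z ->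
  `|tnth z.1 i - tnth z0.1 i| < r /\ `|tnth z.2 i - tnth z0.2 i| < r.
Proof.
move=> r0 /(euclid_ball_sum r0) Sr.
have S1 (u : 'I_n -> R) : u i ^+ 2 <= \sum_(j < n) u j ^+ 2.
  by rewrite (bigD1 i)//= lerDl sumr_ge0// => j _; rewrite sqr_ge0.
have S0 (u : 'I_n -> R) : 0 <= \sum_(j < n) u j ^+ 2.
  by rewrite sumr_ge0// => j _; rewrite sqr_ge0.
have sq (a : R) : a ^+ 2 < r ^+ 2 -> `|a| < r.
  by rewrite -(real_normK (num_real a)) ltr_pXn2r// ?nnegrE// ltW.
have := S1 (fun j => tnth z.1 j - tnth z0.1 j); have := S1 (fun j => tnth z.2 j - tnth z0.2 j).
have := S0 (fun j => tnth z.1 j - tnth z0.1 j); have := S0 (fun j => tnth z.2 j - tnth z0.2 j).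
by move=> *; split; apply: sq; lra.
Qed.

Lemma integral_gauss_scaled (l : R) : 0 < l ->
  (\int[leb]_x (expR (- (l * x) ^+ 2))%:E = (l^-1 * Num.sqrt pi)%:E)%E.
Proof.
move=> l0; have ln0 : l != 0 by rewrite gt_eqF.
have mg : measurable_fun [set: mR] (fun x => (@gauss_fun R x)%:E).
  by apply/measurable_EFinP; exact: measurable_gauss_fun.
have := ge0_integral_leb_affine 0 ln0 mg.
rewrite integralT_gauss gtr0_norm// -EFinM => <-.
  by apply: eq_integral => x _; rewrite add0r.
by move=> x; rewrite lee_fin gauss_fun_ge0.
Qed.

(** Compares the loss e^N of the Gaussian majorant with the available slack 4^N. It follows from
    exp(-1/2) > 1 - 1/2. *)
Lemma expR1_lt4 : expR 1 < 4 :> R.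
Proof.
have h : 2^-1 < expR (- 2^-1) :> R.
  have := @expR_gt1Dx R (- 2^-1); rewrite oppr_eq0 invr_eq0 pnatr_eq0 => /(_ isT).
  by apply: le_lt_trans; lra.
have h2 : expR 2^-1 < 2 :> R.
  by move: h; rewrite expRN ltf_pV2 ?posrE ?expR_gt0.
have -> : expR 1 = expR 2^-1 * expR 2^-1 :> R by rewrite -expRD; congr expR; lra.
by have := expR_gt0 (2^-1 : R); nra.
Qed.

(** The inequality 2 N! <= N^N starts at N = 2, which is why dimension one is treated apart. *)
Lemma double_fact_le n : (2 * n.+2`! <= n.+2 ^ n.+2)%N.
Proof.
elim: n => [//|n IHn]; rewrite factS mulnCA expnS leq_mul2l/=.
by apply: leq_trans IHn _; rewrite leq_exp2r.
Qed.

End ball_estimates.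

(** The negated bound with its roots removed, in terms of the dimensionless quantity rho = 8 r^2 /
    hbar. *)
Lemma radius_power_lt (R : realType) (n : nat) (hbar r : R) : 0 < hbar -> 0 < r ->
  r < 2^-1 * Num.sqrt (hbar / 2 * ((n.+1`!)%:R / 2) `^ (n.+1%:R^-1)) ->
  (8 * r ^+ 2 / hbar) ^+ n.+1 < (n.+1`!)%:R / 2.
Proof.
move=> hb0 r0; set P := _ `^ _ => rP.
have F0 : 0 <= (n.+1`!)%:R / 2 :> R by rewrite divr_ge0.
have PN : P ^+ n.+1 = (n.+1`!)%:R / 2.
  by rewrite -powR_mulrn ?powR_ge0// /P -powRrM mulVf// powRr1.
have hP0 : 0 <= hbar / 2 * P by rewrite mulr_ge0 ?powR_ge0// divr_ge0// ltW.
have r2 : (2 * r) ^+ 2 < hbar / 2 * P.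
  rewrite -(sqr_sqrtr hP0) ltr_pXn2r ?nnegrE ?sqrtr_ge0 ?mulr_ge0 ?ltW//.
  by rewrite mulrC -ltr_pdivlMr// mulrC.
rewrite -PN ltr_pXn2r ?nnegrE ?powR_ge0 ?divr_ge0 ?mulr_ge0 ?sqr_ge0 ?ltW//.
by rewrite ltr_pdivrMr//; move: r2; rewrite exprMn; lra.
Qed.

Theorem theorem4 (R : realType) (hbar : R) (n : nat)
    (f : n.-tuple R -> R[i]) (R0 : R) (z0 : n.-tuple R * n.-tuple R) :
  0 < hbar ->
  L2Rn f ->
  [set z | Wigner hbar f z < 0] !=set0 ->
  0 < R0 ->
  [set z | Wigner hbar f z < 0] `<=` euclid_ball z0 R0 ->
  2^-1 * Num.sqrt (hbar / 2 * ((n`!)%:R / 2) `^ (n%:R^-1)) <= R0.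
Proof.
move=> hb0 f2 [m0 /=]; rewrite Wigner_lt0// => wm0 R00 sub.
case: n f z0 f2 m0 wm0 sub => [|n] f z0 f2 m0 wm0 sub.
  by move: wm0; rewrite ltNge wigr_dim0_ge0.
rewrite leNgt; apply/negP => /(radius_power_lt hb0 R00) rhoN.
set k := 4 / hbar in wm0.
have k0 : 0 < k by rewrite divr_gt0.
have hbn : hbar != 0 by rewrite gt_eqF.
have p0 : (pi : R) != 0 by rewrite gt_eqF// pi_gt0.
have wball z : wigr k f z < 0 -> euclid_ball z0 R0 z.
  by move=> wz; apply: sub => /=; rewrite Wigner_lt0.
have wcoord z i : wigr k f z < 0 ->
    `|tnth z.1 i - tnth z0.1 i| < R0 /\ `|tnth z.2 i - tnth z0.2 i| < R0.
  by move=> /wball; exact: euclid_ball_coord.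
have [mf if2] := L2Rn_integrable f2.
have main (c J : R) (phi : R -> R) : 0 <= c ->
    measurable_fun [set: measurableTypeR R] phi -> (forall x, 0 <= phi x) ->
    (\int[@lebesgue_measure R]_x (phi x)%:E = J%:E)%E ->
    (forall z, wigr k f z < 0 -> 1 <= product_bump c phi z0 z) ->
    1 <= 4 * (k / (2 * pi)) ^+ n.+1 * (c * (J ^+ n.+1 * J ^+ n.+1)).
  move=> c0 mphi phi0 phiJ Gw; rewrite leNgt; apply/negP => CI.
  exact: (negativity_contradiction k0 mf if2 (measurable_product_bump c z0 mphi)
    (product_bump_ge0 z0 c0 phi0) (integral_product_bump z0 c0 mphi phi0 phiJ) Gw CI wm0 R00 wcoord).
case: n => [|n] in f z0 f2 m0 sub rhoN k0 wm0 wball wcoord mf if2 main *.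
  pose D := `[- R0, R0]%classic : set (measurableTypeR R).
  have mD : measurable D by exact: measurable_itv.
  have D2 : (\int[@lebesgue_measure R]_x (\1_D x)%:E = (2 * R0)%:E)%E.
    rewrite integral_indic// setIT; apply: (etrans (lebesgue_measure_itv `[- R0, R0])).
    by rewrite /= lte_fin ifT -?EFinB; [congr EFin; ring|lra].
  have : 1 <= 4 * (k / (2 * pi)) ^+ 1 * (1 * ((2 * R0) ^+ 1 * (2 * R0) ^+ 1)).
    apply: (main _ _ (\1_D)) => //.
    have one (x y : R) : `|x - y| < R0 -> \1_D (- y + x) = 1 :> R.
      move=> xy; rewrite indicE mem_set// /D/= in_itv/= addrC.
      by move: xy; rewrite ltr_norml => /andP[/ltW -> /ltW ->].
    move=> z wz; rewrite /product_bump /tprod !big1 ?mulr1// => i _; rewrite tnth_tadd tnth_tneg.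
      by rewrite one//; have [] := wcoord z i wz.
    by rewrite one//; have [] := wcoord z i wz.
  (* A square of area 4 R0^2 gives 4 rho / pi, with rho < 1/2 and pi >= 2. *)
  apply/negP; rewrite -ltNge !expr1 mul1r.
  move: rhoN; rewrite expr1 (_ : 1`! = 1)%N// => rho1.
  have -> : 4 * (k / (2 * pi)) * (2 * R0 * (2 * R0)) = 4 * (8 * R0 ^+ 2 / hbar) / pi.
    by rewrite /k; move: (pi : R) p0 => p pn0; field; rewrite hbn pn0.
  by rewrite ltr_pdivrMr ?pi_gt0// mul1r; have := pi_ge2 R; lra.
pose N : R := n.+2%:R; have N0 : 0 < N by [].
(* With l^2 R0^2 = N, the factor exp(N) lifts the Gaussian to at least 1 on the ball; this exponent
   minimizes the integral of such a majorant. *)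
pose l := Num.sqrt N / R0.
have l0 : 0 < l by rewrite divr_gt0// sqrtr_gt0.
have l2 : l ^+ 2 * R0 ^+ 2 = N.
  by rewrite -exprMn /l divfK ?gt_eqF// sqr_sqrtr// ltW.
have mphi : measurable_fun [set: measurableTypeR R] (fun x : R => expR (- (l * x) ^+ 2)).
  apply: continuous_measurable_fun => x.
  have c1 : l * y @[y --> x] --> l * x by apply: cvgMl_tmp; exact: cvg_id.
  have c2 := cvg_comp _ (@gauss_fun R) c1 (@continuous_gauss_fun R _).
  exact: c2.
have Gw z : wigr k f z < 0 ->
    1 <= product_bump (expR N) (fun x => expR (- (l * x) ^+ 2)) z0 z.
  move=> /wball /(euclid_ball_sum R00) Sr; rewrite /product_bump /tprod -!expR_sum -!expRD.
  rewrite -expR0 ler_expR.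
  have sE (a b : n.+2.-tuple R) : \sum_(i < n.+2) - (l * tnth (tadd (tneg b) a) i) ^+ 2 =
      - (l ^+ 2 * \sum_(i < n.+2) (tnth a i - tnth b i) ^+ 2).
    rewrite mulr_sumr -sumrN; apply: eq_bigr => i _; rewrite tnth_tadd tnth_tneg.
    by congr (- _); ring.
  rewrite !sE -opprD -mulrDr subr_ge0 -l2 ler_wpM2l ?sqr_ge0//; exact: ltW.
have := main _ _ _ (ltW (expR_gt0 N)) mphi (fun x => expR_ge0 _) (integral_gauss_scaled l0) Gw.
apply/negP; rewrite -ltNge.
have JJ : l^-1 * Num.sqrt pi * (l^-1 * Num.sqrt pi) = pi * R0 ^+ 2 / N.
  rewrite mulrACA -[Num.sqrt pi * _]expr2 sqr_sqrtr ?pi_ge0// -invfM -expr2 -l2.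
  by field; rewrite !gt_eqF.
have -> : expR N = expR 1 ^+ n.+2 by rewrite -expRM_natr mul1r.
rewrite -exprMn JJ -exprMn -mulrA -exprMn.
have -> : k / (2 * pi) * (expR 1 * (pi * R0 ^+ 2 / N)) = expR 1 / 4 * (8 * R0 ^+ 2 / hbar) / N.
  rewrite /k; move: (pi : R) p0 => p pn0; field.
  by rewrite hbn pn0 gt_eqF.
(* It remains to bound 4 (e / 4)^N rho^N / N^N by 1: the second factor is at most 1, rho^N < N! / 2,
   and 2 N! <= N^N. *)
rewrite 2!exprMn exprVn mulrA ltr_pdivrMr ?exprn_gt0// mul1r.
have e1 : (expR 1 / 4) ^+ n.+2 <= 1 :> R.
  by rewrite exprn_ile1 ?divr_ge0 ?expR_ge0// ler_pdivrMr// mul1r ltW// expR1_lt4.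
have fN : 2 * (n.+2`!)%:R <= N ^+ n.+2 by rewrite /N -natrX -natrM ler_nat double_fact_le.
apply: lt_le_trans fN.
have r0 : 0 <= (8 * R0 ^+ 2 / hbar) ^+ n.+2.
  by rewrite exprn_ge0// divr_ge0 ?mulr_ge0 ?sqr_ge0// ltW.
have := ler_wpM2r r0 e1; lra.
Qed.
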